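(* Let $A$ be a local algebra with maximal ideal $I_A$ and let $P$ be a differential manifold modelled on an affine space $(M,V)$. For every chart $\xi:\mathcal U\subset P\to\xi(\mathcal U)\subset M$ of $P$, the map $$A\xi: A\mathcal U\to A(\xi(\mathcal U))=\xi(\mathcal U)\times (I_A\otimes V),$$ which covers $\xi$ in the sense that $\alpha^T_{\xi(\mathcal U)}\circ A\xi=\xi\circ\alpha^T_{\mathcal U}$ (where $\alpha^T_{\xi(\mathcal U)}$ is identified with the projection onto $\xi(\mathcal U)$), is a local trivialization of $AP$. Consequently $\alpha^T_P:AP\to P$ is a differentiable fibre bundle.
   Context: A local algebra is an associative, commutative real algebra $A$ with identity, finite-dimensional over $\mathbb R$, having a unique maximal ideal $I_A$, with $A/I_A\simeq\mathbb R$. Let $0_A:A\to\mathbb R$ be the induced identity-preserving algebra homomorphism with kernel $I_A$. Tensor products are over $\mathbb R$. Manifolds are paracompact smooth manifolds modelled on finite-dimensional real affine spaces; $(M,V)$ denotes an affine space $M$ with associated vector space $V$. For a manifold $P$, $AP$ is the set of all identity-preserving real algebra homomorphisms $u:C^\infty(P)\to A$. For each $u\in AP$ there is exactly one $p\in P$ such that $0_A\circ u$ is evaluation at $p$; put $\alpha^T_P(u)=p$, which defines a map $\alpha^T_P:AP\to P$. A smooth map $\varphi:P\to Q$ induces $A\varphi:AP\to AQ$, $A\varphi(u)(g)=u(g\circ\varphi)$ for $g\in C^\infty(Q)$. For an open subset $\mathcal U\subset P$ with inclusion $\iota_{\mathcal U}$, the map $A\iota_{\mathcal U}:A\mathcal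 U\to AP$ is injective with image $(\alpha^T_P)^{-1}(\mathcal U)$, and $A\mathcal U$ is identified with this subset of $AP$ (the same applies to open subsets of $M$). For an affine space $(M,V)$, with basis $(e_1,\dots,e_m)$ of $V$ and dual basis $(e^1,\dots,e^m)$, the map $AM\to M\times(I_A\otimes V)$, $u\mapsto\big(x,\sum_i u(x^i)\otimes e_i\big)$, where $x=\alpha^T_M(u)$ and $x^i:M\to\mathbb R$, $x^i(y)=e^i(y-x)$, is a bijection independent of the chosen basis. By means of it $AM$ is identified with $M\times(I_A\otimes V)$, from which it gets its affine space structure, $\alpha^T_M$ is identified with the projection onto $M$, and $A\mathcal W$ is identified with $\mathcal W\times(I_A\otimes V)$ for $\mathcal W\subset M$ open. The smooth manifold structure on $AP$ is the one whose atlas consists of the maps $A\xi:A\mathcal U\subset AP\to A(\xi(\mathcal U))\subset AM$, where $\xi:\mathcal U\subset P\to\xi(\mathcal U)\subset M$ ranges over the admissible charts of $P$.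
   Formalization: Assumes every countably complete ultrafilter on the set P is principal; this is exactly what makes each 0_A∘u an evaluation, so that the projection α^T_P is defined. It can fail only for P of at least measurable cardinality, e.g. a discrete P with A = ℝ. *)

(* Defs.v *)
From HB Require Import structures.
From mathcomp Require Import all_boot all_order all_algebra falgebra.
From mathcomp Require Import all_classical all_reals all_analysis.

Set Implicit Arguments.
Unset Strict Implicit.
Unset Printing Implicit Defensive.

Import Order.TTheory GRing.Theory Num.Theory.
Import numFieldNormedType.Exports.

Local Open Scope classical_set_scope.
Local Open Scope ring_scope.

Section Ck.
Variable R : realType.

(* [f] is of class C^k on the open set [W]: [Df w] is the differential of [f] at
   [w], and being C^k' is required of each directional derivative
   [w |-> Df w v]. *)
Fixpoint Ck (k : nat) (n : nat) (F : normedModType R)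
    (f : 'rV[R]_n -> F) (W : set 'rV[R]_n) : Prop :=
  match k with
  | 0%N => forall w, W w -> {for w, continuous f}
  | k'.+1 => exists Df : 'rV[R]_n -> 'rV[R]_n -> F,
      (forall w, W w -> is_diff w f (Df w)) /\
      (forall v, Ck k' (Df ^~ v) W)
  end.

Lemma CkS k n (F : normedModType R) (f : 'rV[R]_n -> F) W :
  Ck k.+1 f W -> Ck k f W.
Proof.
elim: k f => [|k IH] f.
  by move=> [Df [df _]] w /df [/differentiable_continuous].
by case=> Df [df cDf]; exists Df; split=> // v; apply/IH/cDf.
Qed.

Lemma Ck_sub k n (F : normedModType R) (f : 'rV[R]_n -> F) W W' :
  W' `<=` W -> Ck k f W -> Ck k f W'.
Proof.
move=> sW; elim: k f => [|k IH] f; first by move=> H w /sW/H.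
by case=> Df [df cDf]; exists Df; split=> [w /sW/df //|v]; apply/IH/cDf.
Qed.

Lemma Ck_cst k n (F : normedModType R) (a : F) (W : set 'rV[R]_n) :
  Ck k (cst a) W.
Proof.
elim: k a => [|k IH] a; first by move=> w _; apply: cst_continuous.
by exists (fun=> cst 0); split=> [w _|v]; [apply: is_diff_cst|apply: IH].
Qed.

Lemma Ck_add k n (F : normedModType R) (f g : 'rV[R]_n -> F) W :
  Ck k f W -> Ck k g W -> Ck k (f \+ g) W.
Proof.
elim: k f g => [|k IH] f g.
  by move=> cf cg w Ww; apply: continuousD; [apply: cf|apply: cg].
move=> [Df [df cDf]] [Dg [dg cDg]].
exists (fun w => Df w \+ Dg w); split=> [w Ww|v].
  by have ? := df w Ww; have ? := dg w Ww; apply: is_diffD.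
exact: (IH (Df ^~ v) (Dg ^~ v) (cDf v) (cDg v)).
Qed.

Lemma Ck_mul k n (f g : 'rV[R]_n -> R) W :
  Ck k f W -> Ck k g W -> Ck k (f \* g) W.
Proof.
elim: k f g => [|k IH] f g.
  by move=> cf cg w Ww; apply: continuousM; [apply: cf|apply: cg].
move=> cf cg; have cf' := CkS cf; have cg' := CkS cg.
case: cf cg => [Df [df cDf]] [Dg [dg cDg]].
exists (fun w v => f w * Dg w v + g w * Df w v); split=> [w Ww|v].
  by have ? := df w Ww; have ? := dg w Ww; apply: is_diff_eq.
apply: (@Ck_add _ _ _ (f \* Dg ^~ v) (g \* Df ^~ v)).
  exact: (IH f (Dg ^~ v) cf' (cDg v)).
exact: (IH g (Df ^~ v) cg' (cDf v)).
Qed.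

Lemma Ck_sum k n m (f : 'I_m -> 'rV[R]_n -> R) W :
  (forall j, Ck k (f j) W) -> Ck k (fun w => \sum_j f j w) W.
Proof.
elim: m f => [|m IH] f cf.
  rewrite (_ : (fun _ => _) = cst 0); first exact: Ck_cst.
  by apply/funext => w; rewrite big_ord0.
rewrite (_ : (fun _ => _) = f ord0 \+ (fun w => \sum_(j < m) f (lift ord0 j) w)).
  by apply: Ck_add => //; apply: IH.
by apply/funext => w; rewrite big_ord_recl.
Qed.

Lemma Ck_coord k n m (f : 'rV[R]_n -> 'rV[R]_m) W j :
  Ck k f W -> Ck k (fun w => f w 0 j) W.
Proof.
elim: k f => [|k IH] f.
  move=> cf w Ww; apply: (@continuous_comp _ _ _ f (fun x : 'rV[R]_m => x 0 j)).
    exact: cf.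
  exact: coord_continuous.
case=> Df [df cDf]; exists (fun w v => Df w v 0 j); split=> [w Ww|v]; last first.
  exact: (IH (Df ^~ v) (cDf v)).
have dfw := df w Ww.
have dj : is_diff (f w) (fun x : 'rV[R]_m => x 0 j : R) (fun x => x 0 j).
  have lj : linear_for *%R (fun x : 'rV[R]_m => x 0 j : R).
    by move=> a x y; rewrite !mxE.
  pose l : {linear 'rV[R]_m -> R} := HB.pack (fun x : 'rV[R]_m => x 0 j : R)
    (GRing.isLinear.Build R 'rV[R]_m R *%R (fun x : 'rV[R]_m => x 0 j : R) lj).
  have cl : continuous l by apply: coord_continuous.
  apply: DiffDef; first exact: (@linear_differentiable _ _ _ l).
  by rewrite (diff_lin _ cl).
exact: (@is_diff_comp _ _ _ _ f (Df w) _ _ w dfw dj).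
Qed.

Lemma Ck_comp k n m (f : 'rV[R]_n -> 'rV[R]_m) (g : 'rV[R]_m -> R) W W' :
  (forall w, W w -> W' (f w)) -> Ck k f W -> Ck k g W' -> Ck k (g \o f) W.
Proof.
move=> fW; elim: k g => [|k IH] g.
  by move=> cf cg w Ww; apply: continuous_comp; [apply: cf|apply/cg/fW].
move=> cf; have cf' := CkS cf; case: cf => [Df [df cDf]] [Dg [dg cDg]].
exists (fun w v => \sum_j Df w v 0 j * Dg (f w) (delta_mx 0 j)).
split=> [w Ww|v]; last first.
  apply: Ck_sum => j; apply: Ck_mul; first exact: (Ck_coord j (cDf v)).
  exact: (IH (Dg ^~ (delta_mx 0 j)) cf' (cDg _)).
have dfw := df w Ww; have dgw := dg _ (fW w Ww).
apply: is_diff_eq; apply/funext => v /=.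
case: dgw => _ <-; rewrite {1}[Df w v]row_sum_delta linear_sum.
by apply: eq_bigr => j _; rewrite linearZ.
Qed.

End Ck.

Section CkLinear.
Variable R : realType.

Lemma Ck_id k n (W : set 'rV[R]_n) : Ck k (id : 'rV[R]_n -> 'rV[R]_n) W.
Proof.
case: k => [|k]; first by move=> w _; apply: cvg_id.
exists (fun=> id); split=> [w _|v]; first exact: is_diff_id.
exact: Ck_cst.
Qed.

Lemma Ck_scalar k n (l : {scalar 'rV[R]_n}) (W : set 'rV[R]_n) : Ck k l W.
Proof.
rewrite (_ : GRing.Linear.sort l
  = fun w => \sum_j (fun w => w 0 j * l (delta_mx 0 j)) w); last first.
  apply/funext => w; rewrite {1}[w]row_sum_delta linear_sum.
  by apply: eq_bigr => j _; rewrite linearZ.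
apply: Ck_sum => j; apply: (@Ck_mul _ _ _ (fun w => w 0 j) (cst _)).
  exact/Ck_coord/Ck_id.
exact: Ck_cst.
Qed.

End CkLinear.

(* An affine space with associated vector space [V]: a nonempty set on which
   the additive group of [V] acts simply transitively; [vsub y x] is [y - x]. *)
Record affineSpace (R : realType) (V : vectType R) := AffineSpace {
  aff_pt :> Type;
  vadd : aff_pt -> V -> aff_pt;
  vsub : aff_pt -> aff_pt -> V;
  aff_inhabited : exists _ : aff_pt, True;
  vadd0 : forall x, vadd x 0 = x;
  vaddA : forall x u v, vadd (vadd x u) v = vadd x (u + v);
  vaddK : forall x v, vsub (vadd x v) x = v;
  vsubK : forall x y, vadd x (vsub y x) = y
}.

Section AffineTopology.
Variables (R : realType) (V : vectType R) (M : affineSpace V).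
Implicit Types o x y : M.

Definition aff_origin : M := projT1 (cid (aff_inhabited M)).

Lemma vsub_vadd x v y : vsub (vadd x v) y = v + vsub x y.
Proof. by rewrite -{1}(vsubK y x) vaddA vaddK addrC. Qed.

(* Affine coordinates with origin [o], and the inverse parametrisation. *)
Definition aff_coord o (y : M) : 'rV[R]_(\dim {:V}) :=
  passmx.rVof (vbasis {:V}) (vsub y o).
Definition aff_param o (w : 'rV[R]_(\dim {:V})) : M :=
  vadd o (passmx.vecof (vbasis {:V}) w).

Lemma aff_coordK o : cancel (aff_coord o) (aff_param o).
Proof. by move=> y; rewrite /aff_param /aff_coord passmx.rVofK ?vsubK // vbasisP. Qed.

Definition aff_op : set_system M :=
  [set U | forall o, open (aff_param o @^-1` U)].

Lemma aff_opT : aff_op setT.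
Proof. by move=> o; rewrite preimage_setT; exact: openT. Qed.

Lemma aff_opI : setI_closed aff_op.
Proof. by move=> U U' H H' o; rewrite preimage_setI; exact: openI. Qed.

Lemma aff_op_bigU (I : Type) (f : I -> set M) :
  (forall i, aff_op (f i)) -> aff_op (\bigcup_i f i).
Proof.
by move=> H o; rewrite preimage_bigcup; apply: bigcup_open => i _; apply: H.
Qed.

End AffineTopology.

HB.instance Definition _ (R : realType) (V : vectType R) (M : affineSpace V) :=
  gen_eqMixin (aff_pt M).
HB.instance Definition _ (R : realType) (V : vectType R) (M : affineSpace V) :=
  gen_choiceMixin (aff_pt M).
HB.instance Definition _ (R : realType) (V : vectType R) (M : affineSpace V) :=
  isOpenTopological.Build (aff_pt M) (@aff_opT R V M) (@aff_opI R V M)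
    (@aff_op_bigU R V M).

Section SmoothOn.
Variables (R : realType).

(* The values of [f] off [W] are irrelevant when [W] is open, the only case
   used; asking for an open neighbourhood of [W] makes the notion meaningful
   for every [W]. *)
Definition smooth_on (V : vectType R) (M : affineSpace V)
    (F : normedModType R) (W : set M) (f : M -> F) : Prop :=
  exists U : set M, [/\ open U, W `<=` U &
    forall (o : M) k, Ck k (f \o aff_param o) (aff_param o @^-1` U)].

Definition smooth_on_aff (V V' : vectType R) (M : affineSpace V)
    (N : affineSpace V') (W : set M) (h : M -> N) : Prop :=
  forall o' : N, smooth_on W (aff_coord o' \o h).

Variables (V : vectType R) (M : affineSpace V).

Lemma smooth_on_cst (W : set M) (a : R) : smooth_on W (cst a).
Proof. by exists setT; split=> [||o k]; [exact: openT| |exact: Ck_cst]. Qed.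

Lemma smooth_on_add (W : set M) (f g : M -> R) :
  smooth_on W f -> smooth_on W g -> smooth_on W (f \+ g).
Proof.
move=> [U [oU WU cf]] [U' [oU' WU' cg]]; exists (U `&` U'); split.
- exact: openI.
- by move=> x Wx; split; [exact: WU|exact: WU'] .
- move=> o k; apply: (Ck_add (f := f \o aff_param o) (g := g \o aff_param o)).
    by apply: Ck_sub (cf o k) => w [].
  by apply: Ck_sub (cg o k) => w [].
Qed.

Lemma smooth_on_mul (W : set M) (f g : M -> R) :
  smooth_on W f -> smooth_on W g -> smooth_on W (f \* g).
Proof.
move=> [U [oU WU cf]] [U' [oU' WU' cg]]; exists (U `&` U'); split.
- exact: openI.
- by move=> x Wx; split; [exact: WU|exact: WU'] .
- move=> o k; apply: (Ck_mul (f := f \o aff_param o) (g := g \o aff_param o)).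
    by apply: Ck_sub (cf o k) => w [].
  by apply: Ck_sub (cg o k) => w [].
Qed.

Lemma smooth_on_sub (F : normedModType R) (W W' : set M) (f : M -> F) :
  W' `<=` W -> smooth_on W f -> smooth_on W' f.
Proof. by move=> sW [U [oU WU cf]]; exists U; split=> // x /sW/WU. Qed.

Lemma smooth_on_comp (V' : vectType R) (N : affineSpace V') (W : set M)
    (W' : set N) (h : M -> N) (g : N -> R) :
  (forall x, W x -> W' (h x)) -> smooth_on_aff W h -> smooth_on W' g ->
  smooth_on W (g \o h).
Proof.
move=> hW ch [U' [oU' WU' cg]]; have o' := aff_origin N.
have [U [oU WU co]] := ch o'.
have hE o w : h (aff_param o w) =
    aff_param o' ((aff_coord o' \o h \o aff_param o) w).
  by rewrite /= aff_coordK.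
exists (U `&` h @^-1` U'); split.
- move=> o; rewrite openE => w [Uw U'w].
  apply: filterI; first by apply: open_nbhs_nbhs; split; [exact: (oU o)|exact: Uw].
  have cw : {for w, continuous (aff_coord o' \o h \o aff_param o)}.
    exact: (co o 0%N w Uw).
  have nU : nbhs ((aff_coord o' \o h \o aff_param o) w) (aff_param o' @^-1` U').
    by apply: open_nbhs_nbhs; split; [exact: (oU' o')|rewrite /= aff_coordK].
  have nG : nbhs w ((aff_coord o' \o h \o aff_param o) @^-1`
      (aff_param o' @^-1` U')) := cw _ nU.
  move: nG; rewrite (_ : _ @^-1` _ = aff_param o @^-1` (h @^-1` U')) //.
  by apply/funext => z; rewrite /preimage /= aff_coordK.
- by move=> x Wx; split; [apply: WU|apply/WU'/hW].
- move=> o k; rewrite (_ : _ \o _ = (g \o aff_param o') \o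
      (aff_coord o' \o h \o aff_param o)); last first.
    by apply/funext => w; rewrite /= aff_coordK.
  apply: (Ck_comp (W' := aff_param o' @^-1` U')).
  + by move=> w [_ U'w]; rewrite /= aff_coordK.
  + by apply: Ck_sub (co o k) => w [].
  + exact: cg.
Qed.

Lemma smooth_on_coord (W : set M) (x : M) (i : 'I_(\dim {:V})) :
  smooth_on W (fun y => coord (vbasis {:V}) i (vsub y x)).
Proof.
exists setT; split=> [||o k]; [exact: openT|by []|].
pose l : 'rV[R]_(\dim {:V}) -> R :=
  fun w => coord (vbasis {:V}) i (passmx.vecof (vbasis {:V}) w).
have ll : linear_for *%R l.
  by move=> a u v; rewrite /l [passmx.vecof _ _]passmx.vecof_linear linearD linearZ.
pose l' : {scalar 'rV[R]_(\dim {:V})} := HB.pack l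
  (GRing.isLinear.Build R _ R *%R l ll).
rewrite (_ : _ \o _ = l' \+ cst (coord (vbasis {:V}) i (vsub o x))).
  apply: (Ck_add (F := R)); [exact: Ck_scalar|exact: Ck_cst].
by apply/funext => w; rewrite /= /aff_param vsub_vadd linearD.
Qed.

End SmoothOn.

(* A chart is a partially defined map; its values off [cdom] are irrelevant. *)
Record chart (T M : Type) := Chart { cdom : set T; cmap :> T -> M }.

(* A set with a family of charts; the conditions making it a manifold are in
   [is_atlas] and [is_manifold] below. *)
Record atlasSpace (R : realType) (V : vectType R) (M : affineSpace V) :=
  AtlasSpace { pt :> Type; atlas : set (chart pt M) }.
Arguments atlas {R V M} _ _.

HB.instance Definition _ (R : realType) (V : vectType R) (M : affineSpace V)
  (P : atlasSpace M) := gen_eqMixin (pt P).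
HB.instance Definition _ (R : realType) (V : vectType R) (M : affineSpace V)
  (P : atlasSpace M) := gen_choiceMixin (pt P).

(* The topology generated by the sets c^-1(U), for [c] a chart of the atlas and
   [U] open in the model; if the atlas is one, this is the manifold topology. *)
HB.instance Definition _ (R : realType) (V : vectType R) (M : affineSpace V)
  (P : atlasSpace M) := isSubBaseTopological.Build (pt P)
    [set B : set (pt P) | exists c (U : set M),
       [/\ atlas P c, open U & B = cdom c `&` c @^-1` U]] id.

Definition paracompact (T : topologicalType) : Prop :=
  forall C : set (set T), (forall U, C U -> open U) -> \bigcup_(U in C) U = setT ->
  exists D : set (set T),
    [/\ forall U, D U -> open U,
        \bigcup_(U in D) U = setT,
        forall U, D U -> exists2 U', C U' & U `<=` U' &
        forall x : T, exists2 B, nbhs x B &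
          finite_set [set U | D U /\ U `&` B !=set0]].

Section Manifold.
Variables (R : realType) (V : vectType R) (M : affineSpace V).
Implicit Types (P : atlasSpace M).

Definition is_chart (T : Type) (c : chart T M) : Prop :=
  {in cdom c &, injective c} /\ open (c @` cdom c).

Definition smooth_transition (T : Type) (c d : chart T M) : Prop :=
  let W := c @` (cdom c `&` cdom d) in
  open W /\ exists2 h : M -> M,
    (forall p, cdom c p -> cdom d p -> h (c p) = d p) & smooth_on_aff W h.

Definition compatible (T : Type) (c d : chart T M) : Prop :=
  smooth_transition c d /\ smooth_transition d c.

Definition is_atlas P : Prop :=
  [/\ forall c, atlas P c -> is_chart c,
      forall c d, atlas P c -> atlas P d -> compatible c d &
      forall p : P, exists2 c, atlas P c & cdom c p].

Definition is_manifold P : Prop :=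
  [/\ is_atlas P, hausdorff_space (pt P) & paracompact (pt P)].

(* The charts of the maximal atlas containing [atlas P]. *)
Definition admissible P (c : chart P M) : Prop :=
  is_chart c /\ forall d, atlas P d -> compatible c d.

Definition submfd P (U : set P) : atlasSpace M :=
  @AtlasSpace R V M {p : P | U p}
    [set c | exists2 d, atlas P d & c = Chart (sval @^-1` cdom d) (d \o sval)].

Definition affmfd : atlasSpace M := @AtlasSpace R V M M [set Chart setT id].

End Manifold.

Section Product.
Variables (R : realType) (V V' : vectType R).

Section AffineProduct.
Variables (M : affineSpace V) (N : affineSpace V').

Let add (x : M * N) (v : V * V') : M * N := (vadd x.1 v.1, vadd x.2 v.2).
Let sub (y x : M * N) : (V * V')%type := (vsub y.1 x.1, vsub y.2 x.2).

Lemma prod_inhabited : exists _ : M * N, True.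
Proof. by exists (aff_origin M, aff_origin N). Qed.

Lemma prod_vadd0 x : add x 0 = x.
Proof. by case: x => x y; rewrite /add /= !vadd0. Qed.

Lemma prod_vaddA x u v : add (add x u) v = add x (u + v).
Proof. by rewrite /add /= !vaddA. Qed.

Lemma prod_vaddK x v : sub (add x v) x = v.
Proof. by case: v => v w; rewrite /sub /= !vaddK. Qed.

Lemma prod_vsubK x y : add x (sub y x) = y.
Proof. by case: y => y z; rewrite /add /= !vsubK. Qed.

Definition affprod : affineSpace (V * V')%type :=
  @AffineSpace R (V * V')%type (M * N)%type add sub
    prod_inhabited prod_vadd0 prod_vaddA prod_vaddK prod_vsubK.

End AffineProduct.

Definition prodmfd (M : affineSpace V) (N : affineSpace V')
    (P : atlasSpace M) (Q : atlasSpace N) : atlasSpace (affprod M N) :=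
  @AtlasSpace R _ (affprod M N) (P * Q)%type
    [set e | exists c d, [/\ atlas P c, atlas Q d &
       e = Chart (cdom c `*` cdom d) (fun p => (c p.1, d p.2))]].

End Product.

Section VectAffine.
Variables (R : realType) (V : vectType R).

Lemma vect_inhabited : exists _ : V, True. Proof. by exists 0. Qed.
Lemma vect_vaddK (x v : V) : x + v - x = v. Proof. by rewrite addrC addKr. Qed.
Lemma vect_vsubK (x y : V) : x + (y - x) = y. Proof. by rewrite addrC subrK. Qed.

Definition vectaff : affineSpace V :=
  @AffineSpace R V V +%R (fun y x => y - x) vect_inhabited
    (@addr0 _) (fun x u v => esym (addrA x u v)) vect_vaddK vect_vsubK.

End VectAffine.

Section SmoothMap.
Variables (R : realType) (V V' : vectType R).
Variables (M : affineSpace V) (N : affineSpace V').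

(* [h] represents d o f o c^-1, on the set W where it is defined. *)
Definition smooth_map (P : atlasSpace M) (Q : atlasSpace N) (f : P -> Q) : Prop :=
  continuous f /\
  forall c d, atlas P c -> atlas Q d ->
  let W := c @` (cdom c `&` f @^-1` cdom d) in
  exists2 h : M -> N,
    (forall p, cdom c p -> cdom d (f p) -> h (c p) = d (f p)) &
    smooth_on_aff W h.

End SmoothMap.

Definition diffeo (R : realType) (V V' : vectType R) (M : affineSpace V)
    (N : affineSpace V') (P : atlasSpace M) (Q : atlasSpace N)
    (f : P -> Q) : Prop :=
  smooth_map f /\ exists g : Q -> P, [/\ smooth_map g, cancel f g & cancel g f].

Section SmoothFunctions.
Variables (R : realType) (V : vectType R) (M : affineSpace V).
Variable P : atlasSpace M.

Definition smooth_fun (f : P -> R) : Prop :=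
  forall c, atlas P c -> exists2 h : M -> R,
    (forall p, cdom c p -> h (c p) = f p) & smooth_on (c @` cdom c) h.

Definition smooth_pred : {pred (pt P -> R)} := fun f => `[< smooth_fun f >].

Fact smooth_subring : subring_closed smooth_pred.
Proof.
have cst_s (a : R) : cst a \in smooth_pred.
  by apply/asboolP => c _; exists (cst a) => //; apply: smooth_on_cst.
have mul_s : {in smooth_pred &, forall f g, f * g \in smooth_pred}.
  move=> f g /asboolP sf /asboolP sg; apply/asboolP => c cP.
  have [hf ef cf] := sf c cP; have [hg eg cg] := sg c cP.
  by exists (hf \* hg); [move=> p cp /=; rewrite ef ?eg|apply: smooth_on_mul].
split=> //; first exact: cst_s.
move=> f g sf sg.
have /asboolP {}sg : - g \in smooth_pred.
  rewrite (_ : - g = cst (-1) * g); first exact: mul_s.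
  by apply/funext => p; rewrite /cst /GRing.mul /= mulN1r.
move: sf => /asboolP sf; apply/asboolP => c cP.
have [hf ef cf] := sf c cP; have [hg eg cg] := sg c cP.
by exists (hf \+ hg); [move=> p cp /=; rewrite ef ?eg|apply: smooth_on_add].
Qed.

Fact smooth_scale : GRing.scaler_closed smooth_pred.
Proof.
move=> a f sf; rewrite (_ : a *: f = cst a * f) //.
have [_ _ mul_s] := smooth_subring; apply: mul_s => //.
by apply/asboolP => c _; exists (cst a) => //; apply: smooth_on_cst.
Qed.

HB.instance Definition _ :=
  GRing.isSubringClosed.Build (pt P -> R) smooth_pred smooth_subring.
HB.instance Definition _ :=
  GRing.isScaleClosed.Build R (pt P -> R) smooth_pred smooth_scale.

Record Cinf := MkCinf { cinf_fun :> P -> R; cinfP : cinf_fun \in smooth_pred }.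

HB.instance Definition _ := [isSub for cinf_fun].
HB.instance Definition _ := [Choice of Cinf by <:].
HB.instance Definition _ :=
  GRing.SubChoice_isSubComPzRing.Build _ _ Cinf smooth_subring.
HB.instance Definition _ := [SubZmodule_isSubLmodule of Cinf by <:].

End SmoothFunctions.
Arguments smooth_pred {R V M} P _.

Definition is_ideal (R : realType) (A : falgType R) (I : {vspace A}) : Prop :=
  forall a x : A, x \in I -> a * x \in I.

(* Every ideal of a unital finite-dimensional algebra is a subspace. *)
Definition maximal_ideal (R : realType) (A : falgType R) (I : {vspace A}) : Prop :=
  [/\ is_ideal I, I != fullv &
      forall J : {vspace A}, is_ideal J -> (I <= J)%VS -> J != fullv -> J = I].

(* The isomorphism A/I_A ~ R is given through the morphism [zeroA] it induces,
   i.e. a unital morphism to R with kernel I_A; such a morphism is unique. *)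
Record localAlgebra (R : realType) := LocalAlgebra {
  la_sort :> falgType R;
  la_mulC : commutative (@GRing.mul la_sort);
  la_ideal : {vspace la_sort};
  la_maximal : maximal_ideal la_ideal;
  la_unique : forall J : {vspace la_sort}, maximal_ideal J -> J = la_ideal;
  zeroA : {lrmorphism la_sort -> R^o};
  zeroA_ker : forall a, (zeroA a == 0) = (a \in la_ideal)
}.

Section Tensor.
Variables (R : realType) (U V : vectType R).

(* U (x) V for finite-dimensional spaces, realised as Hom(V^*, U); see
   [tens_universal]. *)
Definition tensor : vectType R := 'Hom('Hom(V, R^o), U).

Definition tens (u : U) (v : V) : tensor :=
  linfun (fun l : 'Hom(V, R^o) => l v *: u).

Fact tens_subproof (u : U) (v : V) : linear (fun l : 'Hom(V, R^o) => l v *: u).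
Proof. by move=> a l l'; rewrite !lfunE /= !lfunE /= scalerDl scalerA. Qed.

Lemma tensE u v (l : 'Hom(V, R^o)) : tens u v l = l v *: u.
Proof.
pose f : {linear 'Hom(V, R^o) -> U} := HB.pack (fun l : 'Hom(V, R^o) => l v *: u)
  (GRing.isLinear.Build R 'Hom(V, R^o) U *:%R _ (tens_subproof u v)).
exact: (lfunE f l).
Qed.

Lemma tens_linearl v : linear (tens^~ v).
Proof.
move=> a u u'; apply/lfunP => l; rewrite !lfunE /= !lfunE /= !tensE.
by rewrite scalerDr !scalerA mulrC.
Qed.

Lemma tens_linearr u : linear (tens u).
Proof.
move=> a v v'; apply/lfunP => l; rewrite !lfunE /= !lfunE /= !tensE.
by rewrite linearP scalerDl scalerA.
Qed.

Lemma tens_universal (T : lmodType R) (b : U -> V -> T) :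
  (forall v, linear (b^~ v)) -> (forall u, linear (b u)) ->
  exists f : {linear tensor -> T}, (forall u v, f (tens u v) = b u v) /\
    forall g : {linear tensor -> T}, (forall u v, g (tens u v) = b u v) -> g =1 f.
Proof.
move=> bl br.
pose e := vbasis {:V}.
pose e' i : 'Hom(V, R^o) := linfun (coord e i : V -> R^o).
have e'E i v : e' i v = coord e i v by rewrite lfunE.
pose br' u : {linear V -> T} := HB.pack (b u) (GRing.isLinear.Build R V T *:%R _ (br u)).
pose bl' v : {linear U -> T} := HB.pack (b^~ v) (GRing.isLinear.Build R U T *:%R _ (bl v)).
have lf : linear (fun x : tensor => \sum_i b (x (e' i)) e`_i).
  move=> a x y; rewrite scaler_sumr -big_split /=; apply: eq_bigr => i _.
  by rewrite !lfunE /= !lfunE /= bl.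
pose f : {linear tensor -> T} := HB.pack (fun x : tensor => \sum_i b (x (e' i)) e`_i)
  (GRing.isLinear.Build R tensor T *:%R _ lf).
exists f; split=> [u v|g gE x].
  rewrite /f /= [v in RHS](coord_vbasis (memvf v)) -[RHS]/(br' u _) linear_sum.
  apply: eq_bigr => i _; rewrite tensE e'E -[LHS]/(bl' e`_i _) !linearZ.
  by [].
have xE : x = \sum_i tens (x (e' i)) e`_i.
  apply/lfunP => l; rewrite sum_lfunE.
  have -> : l = \sum_(i < \dim {:V}) l e`_i *: e' i.
    apply/lfunP => v; rewrite sum_lfunE {1}(coord_vbasis (memvf v)) linear_sum.
    apply: eq_bigr => i _; rewrite linearZ !lfunE /= e'E; exact: mulrC.
  rewrite linear_sum; apply: eq_bigr => i _; rewrite linearZ tensE.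
  congr (_ *: _); rewrite sum_lfunE (bigD1 i) //= big1 => [|j ji].
    by rewrite addr0 !lfunE /= e'E coord_free ?(basis_free (vbasisP _)) // eqxx;
       rewrite [RHS]mulr1.
  rewrite !lfunE /= e'E coord_free ?(basis_free (vbasisP _)) //.
  by rewrite eq_sym (negbTE ji) [LHS]mulr0.
by rewrite {1}xE linear_sum; apply: eq_bigr => i _; rewrite gE.
Qed.

End Tensor.

Section WeilPoints.
Variables (R : realType) (A : localAlgebra R).

Record weil_pt (V : vectType R) (M : affineSpace V) (P : atlasSpace M) := WeilPt {
  weil_hom :> {rmorphism Cinf P -> A};
  weil_scal : scalable weil_hom
}.

Section Projection.
Variables (V : vectType R) (M : affineSpace V) (P : atlasSpace M).

Lemma weil_pt_inhabited (u : weil_pt P) : exists _ : P, True.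
Proof.
apply: contrapT => P0; have /eqP := oner_neq0 A; apply.
rewrite -(rmorph1 (weil_hom u)) -(rmorph0 (weil_hom u)); congr (weil_hom u _).
by apply: val_inj; apply/funext => p; case: P0; exists p.
Qed.

(* The point p such that 0_A o u is the evaluation at p; the default value of
   [xget] is never used when there is one. *)
Definition alphaT (u : weil_pt P) : P :=
  xget (projT1 (cid (weil_pt_inhabited u)))
    [set p | forall f : Cinf P, zeroA A (u f) = f p].

End Projection.

Section Functoriality.
Variables (V V' : vectType R) (M : affineSpace V) (N : affineSpace V').
Variables (P : atlasSpace M) (Q : atlasSpace N) (phi : P -> Q).
Hypothesis phiP : forall g : Cinf Q, (g : Q -> R) \o phi \in smooth_pred P.

Definition pullback (g : Cinf Q) : Cinf P := MkCinf (phiP g).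

Let Aphi (u : weil_pt P) (g : Cinf Q) : A := u (pullback g).

Fact weil_map_zmod u : zmod_morphism (Aphi u).
Proof.
by move=> f g; rewrite /Aphi -rmorphB; congr (weil_hom u _); apply: val_inj.
Qed.

Fact weil_map_monoid u : monoid_morphism (Aphi u).
Proof.
split=> [|f g]; rewrite /Aphi.
  by rewrite -(rmorph1 (weil_hom u)); congr (weil_hom u _); apply: val_inj.
by rewrite -rmorphM; congr (weil_hom u _); apply: val_inj.
Qed.

Fact weil_map_scal u : scalable (Aphi u).
Proof.
by move=> a f; rewrite /Aphi -weil_scal; congr (weil_hom u _); apply: val_inj.
Qed.

(* A phi; of the smoothness of [phi] only [phiP] is needed. *)
Definition weil_map (u : weil_pt P) : weil_pt Q :=
  @WeilPt V' N Q
    (HB.pack (Aphi u)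
      (GRing.isZmodMorphism.Build (Cinf Q) A (Aphi u) (weil_map_zmod u))
      (GRing.isMonoidMorphism.Build (Cinf Q) A (Aphi u) (weil_map_monoid u)))
    (weil_map_scal u).

End Functoriality.

End WeilPoints.

(* The cardinal of [T] is smaller than every measurable cardinal. Already for a
   discrete manifold P, where C^oo(P) is the algebra of all functions P -> R, the
   unital morphisms C^oo(P) -> R are the countably complete ultrafilters on P,
   so that they are all evaluations at points iff P is nonmeasurable. *)
Definition nonmeasurable (T : Type) : Prop :=
  forall F : set_system T, UltraFilter F ->
    (forall G : nat -> set T, (forall n, F (G n)) -> F (\bigcap_n G n)) ->
    exists t, F [set t].

Section WeilBundle.
Variables (R : realType) (A : localAlgebra R).
Variables (V : vectType R) (M : affineSpace V).

Definition weil_fibre : vectType R := tensor (subvs_of (la_ideal A)) V.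

Definition weil_model : affineSpace (V * weil_fibre)%type :=
  affprod M (vectaff weil_fibre).

Section Inclusion.
Variables (P : atlasSpace M) (U : set P).

Fact inclusion_pull (g : Cinf P) :
  (g : P -> R) \o (sval : submfd U -> P) \in smooth_pred (submfd U).
Proof.
apply/asboolP => _ [d dP ->]; have /asboolP := cinfP g.
move=> /(_ d dP) [h hE hs]; exists h => [p dp|]; first by rewrite /= hE.
by apply: smooth_on_sub hs => _ [p dp <-]; exists (sval p).
Qed.

Definition weil_incl : weil_pt A (submfd U) -> weil_pt A P :=
  weil_map inclusion_pull.

End Inclusion.

Section AffineIdentification.
Variable W : set M.

Fact affine_coord_smooth (x : M) (i : 'I_(\dim {:V})) :
  (fun y : submfd (W : set (affmfd M)) => coord (vbasis {:V}) i (vsub (sval y) x))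
    \in smooth_pred (submfd (W : set (affmfd M))).
Proof.
apply/asboolP => _ [_ -> ->].
exists (fun y => coord (vbasis {:V}) i (vsub y x)) => //.
exact: smooth_on_coord.
Qed.

Definition affine_coord x i : Cinf (submfd (W : set (affmfd M))) :=
  MkCinf (affine_coord_smooth x i).

(* The identification of A W with W x (I_A (x) V), written in the basis
   [vbasis {:V}] but independent of it; u(x^i) lies in I_A, on which [vsproj] is
   the identity. *)
Definition weil_aff (u : weil_pt A (submfd (W : set (affmfd M)))) :
    prodmfd (submfd (W : set (affmfd M))) (affmfd (vectaff weil_fibre)) :=
  let x := alphaT u in
  (x, \sum_i tens (vsproj (la_ideal A) (u (affine_coord (sval x) i)))
                  (vbasis {:V})`_i).

End AffineIdentification.

Section Charts.
Variables (P : atlasSpace M) (c : chart P M).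

Definition chart_dom : atlasSpace M := submfd (cdom c).
Definition chart_im : atlasSpace M := submfd (c @` cdom c : set (affmfd M)).

Definition chart_map (p : chart_dom) : chart_im :=
  exist _ (c (sval p)) (imageP c (svalP p)).

Hypothesis cP : admissible c.

Fact chart_pull (g : Cinf chart_im) :
  (g : chart_im -> R) \o chart_map \in smooth_pred chart_dom.
Proof.
apply/asboolP => _ [d dP ->]; have /asboolP := cinfP g.
move=> /(_ (Chart (sval @^-1` setT) (id \o sval))) [|h hE hs].
  by exists (Chart setT id).
have [_ /(_ d dP) [_ [_ [t tE ts]]]] := cP.
exists (h \o t).
  move=> p dp; rewrite /= tE //; last exact: (svalP p).
  by rewrite -hE.
apply: (@smooth_on_comp _ _ _ _ _ _ (c @` cdom c)).
- move=> _ [p dp <-]; rewrite /= tE //; last exact: (svalP p).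
  exact/imageP/(svalP p).
- move=> o'; apply: smooth_on_sub (ts o') => _ [p dp <-] /=.
  by exists (sval p); split=> //; exact: (svalP p).
- apply: smooth_on_sub hs => _ [p cp <-].
  by exists (exist _ (c p) (imageP c cp)).
Qed.

Definition weil_chart_map : weil_pt A chart_dom -> weil_pt A chart_im :=
  weil_map chart_pull.

(* A xi, with A(xi(U)) identified with xi(U) x (I_A (x) V) *)
Definition weil_triv (u : weil_pt A chart_dom) :
    prodmfd chart_im (affmfd (vectaff weil_fibre)) :=
  weil_aff (weil_chart_map u).

(* A xi as a chart of AP, AU being identified with a subset of AP by
   [weil_incl]. *)
Definition weil_chart : chart (weil_pt A P) weil_model :=
  Chart (range (@weil_incl P (cdom c)))
    (fun w => xget (aff_origin weil_model)
       [set y : weil_model | exists2 u, weil_incl u = w &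
          y = (sval (weil_triv u).1, (weil_triv u).2)]).

End Charts.

Definition weil_bundle (P : atlasSpace M) : atlasSpace weil_model :=
  @AtlasSpace R _ weil_model (weil_pt A P)
    [set e | exists c (cP : admissible c), e = weil_chart cP].

End WeilBundle.

Section FibreBundle.
Variables (R : realType) (VE VB VF : vectType R).
Variables (ME : affineSpace VE) (MB : affineSpace VB) (MF : affineSpace VF).
Variables (E : atlasSpace ME) (B : atlasSpace MB) (F : atlasSpace MF).

(* [Psi : D -> C x F] is a local trivialization of [pi : E -> B] over the open
   set [U], covering the diffeomorphism [psi : U -> C]; here [j] identifies [D]
   with the open submanifold pi^-1(U) of [E]. *)
Definition local_trivialization (VC VD : vectType R) (MC : affineSpace VC)
    (MD : affineSpace VD) (C : atlasSpace MC) (D : atlasSpace MD)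
    (pi : E -> B) (U : set B) (j : D -> E)
    (psi : submfd U -> C) (Psi : D -> prodmfd C F) : Prop :=
  [/\ open U,
      exists2 j' : D -> submfd (pi @^-1` U), diffeo j' & sval \o j' = j,
      diffeo psi,
      diffeo Psi &
      forall (e : D) (Ue : U (pi (j e))), (Psi e).1 = psi (exist U (pi (j e)) Ue)].
Arguments local_trivialization {VC VD MC MD C D} pi U j psi Psi.

Definition fibre_bundle (pi : E -> B) : Prop :=
  [/\ is_manifold E, is_manifold B, is_manifold F,
      smooth_map pi /\ range pi = setT &
      forall b, exists U : set B, U b /\
        exists Phi : submfd (pi @^-1` U) -> prodmfd (submfd U) F,
          local_trivialization pi U (sval : submfd (pi @^-1` U) -> E)
            (@id (submfd U)) Phi].

End FibreBundle.
Arguments local_trivialization {R VE VB VF ME MB MF E B F VC VD MC MD C D}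
  pi U j psi Psi.

(* Main.v *)
Require Import Defs.
From HB Require Import structures.
From mathcomp Require Import all_boot all_order all_algebra falgebra.
From mathcomp Require Import all_classical all_reals all_analysis.
From mathcomp Require Import ring lra zify.

Set Implicit Arguments.
Unset Strict Implicit.
Unset Printing Implicit Defensive.

Import Order.TTheory GRing.Theory Num.Theory.
Import numFieldNormedType.Exports.

Local Open Scope classical_set_scope.
Local Open Scope ring_scope.

(* Near the point p = alpha(u), a function f on P is, in a chart, a Taylor
   polynomial plus a remainder which Hadamard's lemma writes with coefficients
   in a high power of the maximal ideal at p; as I_A is nilpotent, the morphism u
   is given by the evaluation of Taylor polynomials at the tuple a of the elements
   u(x^i - x^i(p)) of I_A, and conversely every tuple of I_A so defines a point
   of AP above p. Hence A xi is a bijection onto xi(U) x (I_A (x) V), and the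
   transition functions (x, a) |-> (h(x), sum over k > 0 of the Taylor terms of h
   at x evaluated at a) are smooth because they are polynomial in a with
   coefficients the partial derivatives of h.
   That u depends only on the germ of f at p follows from a bump function, which
   0_A sends to 1 and which is therefore sent by u to a unit of A. That 0_A o u is
   an evaluation is Milnor's exercise on each sigma-compact open piece of P; that
   the pieces, taken together, cause no trouble is the only use of the
   nonmeasurability of P.
   The bundle is paracompact because it is again a disjoint union of open pieces
   each exhausted by countably many compact sets: the preimages of the pieces of
   P, exhausted by products of chart balls with balls of the fibre. *)

(** * Calculus *)

(** The tension that shapes the proof is between global and local: a point of AP is a morphism on
    globally defined functions, while charts, Taylor polynomials and Hadamard's lemma live near one
    point. [wgerm] carries each morphism to germs; after that, two morphisms are compared by their
    values on coordinates only. The algebras of a chart domain and of its image occur as well, since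
    AU and A(xi(U)) consist of morphisms on them. They are not open pieces of an argument about P
    but spaces of their own, and neither their cardinal nor their paracompactness should matter. The
    predicate [tame] records what they share with P: each of them has a global chart, which yields
    the evaluation property by itself. Analysis is confined to the transition functions. Every
    diffeomorphism in the conclusion is obtained by exhibiting global charts of source and target in
    which the map is the identity. *)

Section IsDiff.
Variables (R : realType) (E F : normedModType R).

Lemma is_diff_eps (f : E -> F) (df : {linear E -> F}) x : continuous df ->
  (forall e : R, 0 < e ->
     \forall h \near (0 : E), `|f (h + x) - f x - df h| <= e * `|h|) ->
  is_diff x f df.
Proof.
move=> cdf H.
have fE : f \o shift x = cst (f x) + df +o_ 0 id.
  apply/eqaddoP => e e0; have := H e e0; apply: filterS => h.
  by rewrite !fctE /= opprD addrA.
have dE := diff_unique cdf fE.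
by apply: DiffDef => //; apply/diff_locallyP; rewrite dE.
Qed.

Lemma is_diff_near (f g : E -> F) df x : (\forall y \near x, f y = g y) ->
  is_diff x f df -> is_diff x g df.
Proof.
move=> fg [dfx <-]; apply: is_diff_eps; first exact: diff_continuous.
move=> e e0; have /diff_locallyP[_ /eqaddoP/(_ e e0)] := dfx.
have : \forall h \near (0 : E), f (h + x) = g (h + x).
  move: fg; rewrite (near_shift 0) => fg; apply: filterS fg => h.
  by rewrite /= subr0 addrC.
apply: filterS2 => h fgh; rewrite !fctE /= fgh opprD addrA.
by rewrite (nbhs_singleton fg).
Qed.

End IsDiff.

Lemma continuous_near (T U : topologicalType) (f g : T -> U) x :
  (\forall y \near x, f y = g y) -> {for x, continuous f} ->
  {for x, continuous g}.
Proof.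
move=> fg cf; have : f @ x --> g x by rewrite -(nbhs_singleton fg); exact: cf.
apply: cvg_trans; apply: near_eq_cvg; exact: fg.
Qed.

Section CkMore.
Variables (R : realType) (n : nat).
Implicit Types (F G : normedModType R) (W : set 'rV[R]_n).

Lemma Ck_eq k F (f g : 'rV[R]_n -> F) W : open W ->
  (forall w, W w -> f w = g w) -> Ck k f W -> Ck k g W.
Proof.
move=> oW; case: k => [|k] fg.
  move=> cf w Ww; apply: continuous_near (cf w Ww).
  by apply: filterS (open_nbhs_nbhs (conj oW Ww)) => y /fg ->.
case=> Df [df cDf]; exists Df; split=> // w Ww.
apply: is_diff_near (df w Ww).
by apply: filterS (open_nbhs_nbhs (conj oW Ww)) => y /fg ->.
Qed.

(** The differential quantified in [Ck] is traded for the canonical ['d f w]. Being the same on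
    every neighbourhood, it can be glued, which is what [Ck_local] rests on. *)
Lemma CkSE k F (f : 'rV[R]_n -> F) W : open W ->
  Ck k.+1 f W <-> (forall w, W w -> differentiable f w) /\
                  (forall v, Ck k (fun w => 'd f w v) W).
Proof.
move=> oW; split.
  case=> Df [df cDf]; split=> [w /df[]//|v].
  by apply: Ck_eq (cDf v) => // w /df[_ ->].
case=> df cdf; exists (fun w => 'd f w : _ -> _); split=> // w /df ?.
exact: differentiableP.
Qed.

Lemma Ck_local k F (f : 'rV[R]_n -> F) W :
  (forall w, W w -> exists U, [/\ open U, U w & Ck k f U]) -> Ck k f W.
Proof.
elim: k f => [|k IH] f H.
  by move=> w Ww; have [U [oU Uw cf]] := H w Ww; exact: cf.
exists (fun w => 'd f w : _ -> _); split=> [w Ww|v].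
  have [U [oU Uw /(CkSE _ _ oU)[df _]]] := H w Ww.
  exact/differentiableP/df.
apply: IH => w Ww; have [U [oU Uw /(CkSE _ _ oU)[_ df]]] := H w Ww.
by exists U.
Qed.

Lemma Ck_scalel k F (f : 'rV[R]_n -> R) (v : F) W :
  Ck k f W -> Ck k (fun w => f w *: v) W.
Proof.
elim: k f => [|k IH] f.
  by move=> cf w Ww; apply: continuousZr_tmp; exact: cf.
case=> Df [df cDf]; exists (fun w h => Df w h *: v); split=> [w Ww|h].
  have [dw <-] := df w Ww.
  by apply: DiffDef; [exact: differentiableZl|rewrite diffZl].
exact: (IH _ (cDf h)).
Qed.

Lemma Ck_big k F m (f : 'I_m -> 'rV[R]_n -> F) W :
  (forall j, Ck k (f j) W) -> Ck k (fun w => \sum_j f j w) W.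
Proof.
elim: m f => [|m IH] f cf.
  rewrite (_ : (fun _ => _) = cst 0); first exact: Ck_cst.
  by apply/funext => w; rewrite big_ord0.
rewrite (_ : (fun _ => _) = f ord0 \+ (fun w => \sum_(j < m) f (lift ord0 j) w)).
  by apply: Ck_add => //; apply: IH.
by apply/funext => w; rewrite big_ord_recl.
Qed.

Lemma Ck_inv k (f : 'rV[R]_n -> R) W :
  (forall w, W w -> f w != 0) -> Ck k f W -> Ck k (fun w => (f w)^-1) W.
Proof.
move=> f0; elim: k => [|k IH].
  by move=> cf w Ww; apply: continuousV; [exact: f0|exact: cf].
move=> cf; have ci := IH (CkS cf); case: cf => Df [df cDf].
exists (fun w h => - ((f w)^-1 * (f w)^-1) * Df w h); split=> [w Ww|h].
  have [dfw <-] := df w Ww.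
  apply: DiffDef; first exact/differentiableV/f0.
  rewrite diffV ?f0//; apply/funext => h; rewrite /= -[LHS]/(_ * _).
  by congr (- _ * _); rewrite expr2 invfM.
rewrite (_ : (fun _ => _) = ((fun w => (f w)^-1) \* (fun w => (f w)^-1)) \*
   ((fun w => -1) \* Df^~ h)); last by apply/funext => w /=; ring.
apply: Ck_mul; first exact: Ck_mul.
by apply: Ck_mul; [exact: Ck_cst|exact: cDf].
Qed.

End CkMore.

Section SmoothAt.
Variables (R : realType).

(** One neighbourhood serves all orders k; this makes smoothness at a point an open condition,
    stable under derivation. *)
Definition smooth_at n (F : normedModType R) (f : 'rV[R]_n -> F) w :=
  exists U, [/\ open U, U w & forall k, Ck k f U].

Section Basic.
Variables (n : nat) (F : normedModType R).
Implicit Types (f g : 'rV[R]_n -> F).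

Lemma smooth_at_Ck f (W : set 'rV[R]_n) :
  (forall w, W w -> smooth_at f w) -> forall k, Ck k f W.
Proof.
by move=> H k; apply: Ck_local => w /H[U [oU Uw cf]]; exists U.
Qed.

Lemma smooth_at_near f w : smooth_at f w -> \forall v \near w, smooth_at f v.
Proof.
move=> [U [oU Uw cf]]; apply: filterS (open_nbhs_nbhs (conj oU Uw)) => v Uv.
by exists U.
Qed.

Lemma smooth_at_eq f g w : (\forall v \near w, f v = g v) ->
  smooth_at f w -> smooth_at g w.
Proof.
move=> fg [U [oU Uw cf]].
exists (U `&` [set v | f v = g v]°); split.
- by apply: openI => //; exact: open_interior.
- by split.
- move=> k; apply: (@Ck_eq _ _ _ _ f).
  + by apply: openI => //; exact: open_interior.
  + by move=> v [_ /interior_subset].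
  + by apply: Ck_sub (cf k) => v [].
Qed.

Lemma smooth_at_continuous f w : smooth_at f w -> {for w, continuous f}.
Proof. by move=> [U [oU Uw /(_ 0%N)]]; exact. Qed.

Lemma smooth_at_differentiable f w : smooth_at f w -> differentiable f w.
Proof. by move=> [U [oU Uw /(_ 1%N) /(CkSE _ _ oU)[df _]]]; exact: df. Qed.

Lemma smooth_at_diff f w v : smooth_at f w -> smooth_at (fun z => 'd f z v) w.
Proof.
move=> [U [oU Uw cf]]; exists U; split=> // k.
by have /(CkSE _ _ oU)[_] := cf k.+1.
Qed.

Lemma smooth_at_derive f w v : smooth_at f w -> smooth_at ('D_v f) w.
Proof.
move=> fw; apply: smooth_at_eq (smooth_at_diff v fw).
apply: filterS (smooth_at_near fw) => z /smooth_at_differentiable df.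
by rewrite deriveE.
Qed.

Lemma smooth_at_cst (a : F) (w : 'rV[R]_n) : smooth_at (fun=> a) w.
Proof. by exists setT; split=> // [|k]; [exact: openT|exact: Ck_cst]. Qed.

Let smooth_at2 f g w : smooth_at f w -> smooth_at g w ->
  exists U, [/\ open U, U w & forall k, Ck k f U /\ Ck k g U].
Proof.
move=> [U [oU Uw cf]] [U' [oU' Uw' cg]]; exists (U `&` U'); split=> //.
  exact: openI.
by move=> k; split; [apply: Ck_sub (cf k) => ? []|apply: Ck_sub (cg k) => ? []].
Qed.

Lemma smooth_atD f g w : smooth_at f w -> smooth_at g w ->
  smooth_at (fun z => f z + g z) w.
Proof.
move=> fw gw; have [U [oU Uw H]] := smooth_at2 fw gw.
by exists U; split=> // k; have [] := H k; exact: Ck_add.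
Qed.

Lemma smooth_at_sum m (f : 'I_m -> 'rV[R]_n -> F) w :
  (forall j, smooth_at (f j) w) -> smooth_at (fun z => \sum_j f j z) w.
Proof.
elim: m f => [|m IH] f cf.
  rewrite (_ : (fun _ => _) = fun=> 0); first exact: smooth_at_cst.
  by apply/funext => z; rewrite big_ord0.
rewrite (_ : (fun _ => _) = fun z => f ord0 z + \sum_(j < m) f (lift ord0 j) z).
  by apply: smooth_atD => //; apply: IH.
by apply/funext => z; rewrite big_ord_recl.
Qed.

End Basic.

Section Scalar.
Variables (n : nat).
Implicit Types (f g : 'rV[R]_n -> R).

Lemma smooth_atM f g w : smooth_at f w -> smooth_at g w ->
  smooth_at (fun z => f z * g z) w.
Proof.
move=> [U [oU Uw cf]] [U' [oU' Uw' cg]]; exists (U `&` U'); split=> //.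
  exact: openI.
by move=> k; apply: (@Ck_mul _ _ _ f g);
  [apply: Ck_sub (cf k) => ? []|apply: Ck_sub (cg k) => ? []].
Qed.

Lemma smooth_atV f w : f w != 0 -> smooth_at f w ->
  smooth_at (fun z => (f z)^-1) w.
Proof.
move=> f0 fw; have [U [oU Uw cf]] := fw.
have /smooth_at_continuous fc := fw.
have nf : \forall z \near w, f z != 0.
  exact: (cvgr_neq0 (f w) fc f0).
exists (U `&` [set z | f z != 0]°); split.
- by apply: openI => //; exact: open_interior.
- by split.
- move=> k; apply: Ck_inv => [z [_ /interior_subset]//|].
  by apply: Ck_sub (cf k) => z [].
Qed.

Lemma smooth_at_prod m (f : 'I_m -> 'rV[R]_n -> R) w :
  (forall j, smooth_at (f j) w) -> smooth_at (fun z => \prod_j f j z) w.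
Proof.
elim: m f => [|m IH] f cf.
  rewrite (_ : (fun _ => _) = fun=> 1); first exact: smooth_at_cst.
  by apply/funext => z; rewrite big_ord0.
rewrite (_ : (fun _ => _) = fun z => f ord0 z * \prod_(j < m) f (lift ord0 j) z).
  by apply: smooth_atM => //; apply: IH.
by apply/funext => z; rewrite big_ord_recl.
Qed.

Lemma smooth_at_scalel (F : normedModType R) f (v : F) w :
  smooth_at f w -> smooth_at (fun z => f z *: v) w.
Proof.
by move=> [U [oU Uw cf]]; exists U; split=> // k; apply: Ck_scalel.
Qed.

Lemma smooth_at_linear (f : 'rV[R]_n -> R) w : linear_for *%R f -> smooth_at f w.
Proof.
move=> lf; exists setT; split=> // [|k]; first exact: openT.
pose l : {scalar 'rV[R]_n} :=
  HB.pack f (GRing.isLinear.Build R 'rV[R]_n R *%R f lf).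
exact: (@Ck_scalar _ _ _ l).
Qed.

Lemma smooth_at_coord i w : smooth_at (fun z : 'rV[R]_n => z 0 i) w.
Proof. by apply: smooth_at_linear => a u v; rewrite !mxE. Qed.

End Scalar.

Section Comp.
Variables (n m : nat).

Lemma smooth_at_row (f : 'rV[R]_n -> 'rV[R]_m) w :
  (forall j, smooth_at (fun z => f z 0 j) w) -> smooth_at f w.
Proof.
move=> cf; rewrite (_ : f = fun w => \sum_j f w 0 j *: delta_mx 0 j).
  by apply: smooth_at_sum => j; apply: smooth_at_scalel.
by apply/funext => z; exact: row_sum_delta.
Qed.

Lemma smooth_at_rowE (f : 'rV[R]_n -> 'rV[R]_m) j w :
  smooth_at f w -> smooth_at (fun z => f z 0 j) w.
Proof.
by move=> [U [oU Uw cf]]; exists U; split=> // k; apply: Ck_coord.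
Qed.

Lemma smooth_at_comp (f : 'rV[R]_n -> 'rV[R]_m) (g : 'rV[R]_m -> R) w :
  smooth_at f w -> smooth_at g (f w) -> smooth_at (g \o f) w.
Proof.
move=> fw [U' [oU' Uw' cg]]; have fc := smooth_at_continuous fw.
have [U [oU Uw cf]] := fw.
have nU : nbhs w (f @^-1` U') by apply: fc; exact: open_nbhs_nbhs.
exists (U `&` (f @^-1` U')°); split=> //.
- by apply: openI => //; exact: open_interior.
- move=> k; apply: (Ck_comp (W' := U')) (cg k) => [z [_ /interior_subset]//|].
  by apply: Ck_sub (cf k) => z [].
Qed.

End Comp.

Lemma smooth_at_vcomp n m p (f : 'rV[R]_n -> 'rV[R]_m) (g : 'rV[R]_m -> 'rV[R]_p) w :
  smooth_at f w -> smooth_at g (f w) -> smooth_at (g \o f) w.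
Proof.
move=> fw gw; apply: smooth_at_row => j.
exact: (smooth_at_comp fw (smooth_at_rowE j gw)).
Qed.

Lemma smooth_at_id n (w : 'rV[R]_n) : smooth_at id w.
Proof. by apply: smooth_at_row => j; exact: smooth_at_coord. Qed.

End SmoothAt.

Lemma near_norm_lt (R : realType) (V : normedModType R) (x : V) (e : R) :
  0 < e -> \forall y \near x, `|y - x| < e.
Proof.
move=> e0; apply/nbhs_ballP; exists e => // y.
by rewrite -ball_normE /= distrC.
Qed.

Lemma near_norm_le (R : realType) (V : normedModType R) (e : R) :
  0 < e -> \forall y \near (0 : V), `|y| <= e.
Proof.
move=> e0; apply: filterS (near_norm_lt (0 : V) e0) => y.
by rewrite subr0 => /ltW.
Qed.

(** * Flat functions and bump functions *)

Section FlatFunctions.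
Variable R : realType.
Implicit Types (p : {poly R}) (t s : R).

Lemma pow_le_expR k : exists2 C : R, 0 <= C & forall s, 0 <= s -> s ^+ k <= C * expR s.
Proof.
case: k => [|k].
  by exists 1 => // s s0; rewrite expr0 mul1r -expR0 ler_expR.
(* With K = k + 1, the constant comes from s^K = K^K (s/K)^K and s/K <= exp(s/K). *)
exists (k.+1%:R ^+ k.+1) => [|s s0]; first by rewrite exprn_ge0.
have k0 : (k.+1%:R : R) != 0 by rewrite pnatr_eq0.
have -> : s = k.+1%:R * (s / k.+1%:R) by rewrite mulrC divfK.
rewrite exprMn ler_wpM2l ?exprn_ge0// expRM_natl lerXn2r ?nnegrE ?expR_ge0//.
  by rewrite divr_ge0.
by apply: le_trans (expR_ge1Dx _); rewrite lerDr.
Qed.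

Lemma poly_le_expR p : exists2 C : R, 0 <= C & forall s, 0 <= s -> `|p.[s]| <= C * expR s.
Proof.
have /choice[C H] k : exists C : R,
    0 <= C /\ forall s, 0 <= s -> s ^+ k <= C * expR s.
  by have [C C0 H] := pow_le_expR k; exists C.
exists (\sum_(i < size p) `|p`_i| * C i).
  by apply: sumr_ge0 => i _; rewrite mulr_ge0//; have [] := H i.
move=> s s0; rewrite horner_coef mulr_suml; apply: le_trans (ler_norm_sum _ _ _) _.
apply: ler_sum => i _; rewrite normrM -mulrA ler_wpM2l// normrX ger0_norm//.
by have [_] := H i; exact.
Qed.

Definition flat p t : R := if 0 < t then p.[t^-1] * expR (- t^-1) else 0.

(** The derivative of p(1/t) exp(-1/t) is t^-2 (p - p')(1/t) exp(-1/t). *)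
Definition flat_der p : {poly R} := 'X^2 * (p - p^`()).

(** A quadratic bound makes the derivative at 0 vanish. It is gained by comparing p X^2, instead of
    p, with the exponential at 1/t. *)
Lemma flat_le p : exists2 C : R, 0 <= C & forall t, `|flat p t| <= C * t ^+ 2.
Proof.
have [C C0 H] := poly_le_expR (p * 'X^2); exists C => // t.
rewrite /flat; case: ifPn => t0; last by rewrite normr0 mulr_ge0 ?sqr_ge0.
have ti0 : 0 <= t^-1 by rewrite invr_ge0 ltW.
have := H _ ti0; rewrite hornerM hornerXn !normrM (ger0_norm (expR_ge0 _)).
rewrite (ger0_norm ti0) => {}H.
rewrite expRN ler_pdivrMr ?expR_gt0// mulrAC -ler_pdivrMr ?exprn_gt0//.
by rewrite -exprVn expr2.
Qed.

Lemma is_derive_flat p t : is_derive t 1 (flat p) (flat (flat_der p) t).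
Proof.
have [t0|t0|->] := ltrgt0P t.
- have nf : {near t, (fun s => p.[s^-1] * expR (- s^-1)) =1 flat p}.
    by near=> s; rewrite /flat ifT//; near: s; exact: lt_nbhsr.
  apply: (near_eq_is_derive nf).
  have tn0 : t != 0 by rewrite gt_eqF.
  have dV : is_derive t 1 (fun s : R => s^-1) (- t ^- 2).
    have := @is_deriveV _ id t 1 1 tn0 (is_derive_id _ _).
    by rewrite /GRing.scale /= mulr1.
  have dN : is_derive t 1 (fun s : R => - s^-1) (t ^- 2).
    by have := is_deriveN dV; rewrite opprK.
  have dp := is_derive1_comp (is_derive_poly p t^-1) dV.
  have de := @is_derive1_comp _ expR (fun s => - s^-1) t _ _ (is_derive_expR (- t^-1)) dN.
  have := is_deriveM dp de.
  rewrite /GRing.scale /= /flat t0 /flat_der => H.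
  apply: is_derive_eq H _.
  by rewrite hornerM hornerXn hornerD hornerN exprVn; ring.
- have nf : {near t, cst 0 =1 flat p}.
    near=> s; rewrite /flat ifF//; apply/negbTE; rewrite -leNgt ltW//.
    by near: s; exact: lt_nbhsl.
  rewrite [X in is_derive _ _ _ X](_ : _ = 0); last by rewrite /flat ltNge ltW.
  by apply: (near_eq_is_derive nf).
- rewrite [X in is_derive _ _ _ X](_ : _ = 0); last by rewrite /flat ltxx.
  have [C C0 H] := flat_le p.
  have C1 : 0 < C + 1 by rewrite ltr_wpDl.
  have : is_diff 0 (flat p) (\0 : R -> R).
    apply: is_diff_eps => [|e e0]; first exact: cst_continuous.
    near=> h; rewrite addr0 {2}/flat ltxx !subr0.
    apply: le_trans (H h) _; rewrite -[h ^+ 2]ger0_norm ?sqr_ge0// normrX expr2.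
    rewrite mulrA ler_wpM2r//.
    apply: (@le_trans _ _ ((C + 1) * `|h|)).
      by rewrite ler_wpM2r// lerDl.
    rewrite mulrC -ler_pdivlMr//; near: h.
    by apply: (@near_norm_le R R); rewrite divr_gt0.
  case=> df dfE; apply: DeriveDef; first exact/derivable1_diffP.
  by rewrite deriveE// dfE.
Unshelve. all: by end_near. Qed.

Lemma flat_ge0 t : 0 <= flat 1 t.
Proof. by rewrite /flat; case: ifP => // _; rewrite hornerC mul1r expR_ge0. Qed.

Lemma flat_gt0 t : 0 < t -> 0 < flat 1 t.
Proof. by rewrite /flat => ->; rewrite hornerC mul1r expR_gt0. Qed.

Lemma flat_eq0 t : t <= 0 -> flat 1 t = 0.
Proof. by rewrite /flat ltNge => ->. Qed.

(* The class of the functions [flat p] is closed under derivation, hence they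
   are smooth. *)
Lemma Ck_flat k n (f : 'rV[R]_n -> R) W p :
  Ck k f W -> Ck k (fun w => flat p (f w)) W.
Proof.
elim: k p => [|k IH] p.
  move=> cf w Ww; apply: (@continuous_comp _ _ _ f (flat p)); first exact: cf.
  have [df _] := is_derive_flat p (f w).
  exact/differentiable_continuous/derivable1_diffP.
move=> cf; have cf' := CkS cf; case: cf => Df [df cDf].
exists (fun w v => Df w v * flat (flat_der p) (f w)); split=> [w Ww|v].
  have [dfw <-] := df w Ww.
  have [dg dgE] := is_derive_flat p (f w).
  have {}dg : differentiable (flat p) (f w) by apply/derivable1_diffP.
  apply: DiffDef; first exact: differentiable_comp.
  rewrite (diff_comp dfw dg); apply/funext => v /=.
  rewrite -dgE -[X in 'd _ _ X]mulr1 -[X in 'd _ _ X]/(_ *: _) linearZ.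
  by rewrite [in RHS]deriveE.
by apply: Ck_mul; [exact: cDf|exact: IH].
Qed.

Lemma smooth_at_flat n (f : 'rV[R]_n -> R) p w :
  smooth_at f w -> smooth_at (fun w => flat p (f w)) w.
Proof. by case=> U [oU Uw cf]; exists U; split=> // k; exact: Ck_flat. Qed.

End FlatFunctions.

Section RowNorm.
Variables (R : realType) (n : nat).
Implicit Types v : 'rV[R]_n.

Lemma row_norm_le v (r : R) : 0 <= r -> (`|v| <= r) <-> (forall i, `|v 0 i| <= r).
Proof.
move=> r0; rewrite -[`|v|]/(mx_norm v) mx_normrE; split=> [/bigmax_leP[_ H] i|H].
  exact: (H (0, i)).
by apply/bigmax_leP; split=> // -[i j] _ /=; rewrite ord1.
Qed.

Lemma row_coord_le v i : `|v 0 i| <= `|v|.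
Proof. exact: (iffLR (row_norm_le v (normr_ge0 v)) (lexx _) i). Qed.

Lemma ballrV (x y : 'rV[R]_n) (r : R) : ball x r y <-> `|y - x| < r.
Proof. by rewrite -ball_normE /= distrC. Qed.

End RowNorm.

Section Bump.
Variables (R : realType) (n : nat).
Implicit Types (x w : 'rV[R]_n) (r : R).

(** Meant for the squares of rescaled coordinates, which are smooth where absolute values are not;
    the thresholds 1 and 4 thus stand for the radii r and 2r. *)
Definition plateau (s : R) := flat 1 (4 - s) / (flat 1 (4 - s) + flat 1 (s - 1)).

Lemma plateau_den s : 0 < flat 1 (4 - s) + flat 1 (s - 1) :> R.
Proof.
have [s4|s4] := ltP s 4.
  by rewrite ltr_wpDr ?flat_ge0// flat_gt0// subr_gt0.
by rewrite ltr_wpDl ?flat_ge0// flat_gt0//; lra.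
Qed.

Lemma plateau_ge0 s : 0 <= plateau s.
Proof. by rewrite divr_ge0 ?flat_ge0// ltW// plateau_den. Qed.

Lemma plateau_le1 s : plateau s <= 1.
Proof. by rewrite ler_pdivrMr ?plateau_den// mul1r lerDl flat_ge0. Qed.

Lemma plateau1 s : s <= 1 -> plateau s = 1.
Proof.
move=> s1; have := plateau_den s; rewrite /plateau (@flat_eq0 _ (s - 1)); last by lra.
by rewrite addr0 => /lt0r_neq0 ?; rewrite divff.
Qed.

Lemma plateau0 s : 4 <= s -> plateau s = 0.
Proof. by move=> s4; rewrite /plateau flat_eq0 ?mul0r//; lra. Qed.

(** The norm on row vectors is the maximum norm, its balls are cubes, and a product over the
    coordinates fits them exactly. *)
Definition cube_bump x r w : R := \prod_i plateau (((w - x) 0 i / r) ^+ 2).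

Lemma bump_ge0 x r w : 0 <= cube_bump x r w.
Proof. by apply: prodr_ge0 => i _; exact: plateau_ge0. Qed.

Lemma bump_le1 x r w : cube_bump x r w <= 1.
Proof. by apply: prodr_ile1 => i _; rewrite plateau_ge0 plateau_le1. Qed.

Lemma bump1 x r w : 0 < r -> ball x r w -> cube_bump x r w = 1.
Proof.
move=> r0 /ballrV/ltW/(row_norm_le _ (ltW r0)) H; rewrite /cube_bump big1// => i _.
apply: plateau1.
rewrite exprMn exprVn ler_pdivrMr ?exprn_gt0// mul1r.
by rewrite -[X in X <= _]ger0_norm ?sqr_ge0// normrX lerXn2r ?nnegrE// ltW.
Qed.

Lemma bump_support x r w : 0 < r -> cube_bump x r w != 0 -> `|w - x| <= 2 * r.
Proof.
move=> r0 /prodf_neq0 H; apply/row_norm_le; first by rewrite mulr_ge0// ltW.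
move=> i; have := H i isT; apply: contraNT; rewrite -ltNge => Hi.
apply/eqP/plateau0; rewrite exprMn exprVn ler_pdivlMr ?exprn_gt0//.
rewrite -[X in _ <= X]ger0_norm ?sqr_ge0// normrX.
have -> : 4 * r ^+ 2 = (2 * r) ^+ 2 by ring.
by rewrite lerXn2r ?nnegrE ?mulr_ge0// ltW.
Qed.

Lemma smooth_at_bump x r w : smooth_at (cube_bump x r) w.
Proof.
apply: smooth_at_prod => i.
have sc : smooth_at (fun z : 'rV[R]_n => (z - x) 0 i / r) w.
  apply: smooth_atM; last exact: smooth_at_cst.
  under eq_fun do rewrite mxE.
  by apply: smooth_atD; [exact: smooth_at_coord|exact: smooth_at_cst].
have s2 : smooth_at (fun z : 'rV[R]_n => ((z - x) 0 i / r) ^+ 2) w.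
  by under eq_fun do rewrite expr2; exact: smooth_atM.
have sN (a : R) : smooth_at (fun z : 'rV[R]_n => a - ((z - x) 0 i / r) ^+ 2) w.
  apply: smooth_atD; first exact: smooth_at_cst.
  under eq_fun do rewrite -mulN1r.
  by apply: smooth_atM => //; exact: smooth_at_cst.
have sP (a : R) : smooth_at (fun z : 'rV[R]_n => ((z - x) 0 i / r) ^+ 2 - a) w.
  by apply: smooth_atD => //; exact: smooth_at_cst.
apply: smooth_atM; first exact: smooth_at_flat.
apply: smooth_atV; first by rewrite gt_eqF// plateau_den.
by apply: smooth_atD; exact: smooth_at_flat.
Qed.

End Bump.

(** * Integration over the unit interval and Hadamard's lemma *)

Section UnitIntegral.
Variable R : realType.
Implicit Types (f g : R -> R).

Local Notation mu := (@lebesgue_measure R).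

Definition unit_integral f : R := \int[mu]_(t in `[0, 1]) f t.

Definition unit_continuous f := forall t, 0 <= t <= 1 -> {for t, continuous f}.

Lemma unit_continuous_within f : unit_continuous f -> {within `[0, 1], continuous f}.
Proof.
move=> cf; apply: continuous_in_subspaceT => t.
by rewrite inE /= in_itv /= => /cf.
Qed.

Lemma unit_integrable f : unit_continuous f -> mu.-integrable `[0, 1] (EFin \o f).
Proof.
move=> /unit_continuous_within cf; apply: continuous_compact_integrable => //.
exact: segment_compact.
Qed.

Lemma unit_continuousD f g : unit_continuous f -> unit_continuous g ->
  unit_continuous (fun t => f t + g t).
Proof. by move=> cf cg t t1; apply: continuousD; [exact: cf|exact: cg]. Qed.

Lemma unit_continuousM f g : unit_continuous f -> unit_continuous g ->
  unit_continuous (fun t => f t * g t).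
Proof. by move=> cf cg t t1; apply: continuousM; [exact: cf|exact: cg]. Qed.

Lemma unit_continuous_cst (a : R) : unit_continuous (fun=> a).
Proof. by move=> t _; apply: cst_continuous. Qed.

Lemma unit_continuousB f g : unit_continuous f -> unit_continuous g ->
  unit_continuous (fun t => f t - g t).
Proof. by move=> cf cg t t1; apply: continuousB; [exact: cf|exact: cg]. Qed.

Lemma unit_continuous_sum m (f : 'I_m -> R -> R) :
  (forall j, unit_continuous (f j)) -> unit_continuous (fun t => \sum_j f j t).
Proof.
elim: m f => [|m IH] f cf.
  by under eq_fun do rewrite big_ord0; exact: unit_continuous_cst.
under eq_fun do rewrite big_ord_recl.
by apply: unit_continuousD => //; exact: IH.
Qed.

Lemma unit_continuousX k : unit_continuous (fun t => t ^+ k).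
Proof. by move=> t _; exact: exprn_continuous. Qed.

Lemma unit_integralB f g : unit_continuous f -> unit_continuous g ->
  unit_integral (fun t => f t - g t) = unit_integral f - unit_integral g.
Proof. by move=> cf cg; apply: RintegralB => //; exact: unit_integrable. Qed.

Lemma unit_integralD f g : unit_continuous f -> unit_continuous g ->
  unit_integral (fun t => f t + g t) = unit_integral f + unit_integral g.
Proof. by move=> cf cg; apply: RintegralD => //; exact: unit_integrable. Qed.

Lemma unit_integralZ f (a : R) : unit_continuous f ->
  unit_integral (fun t => a * f t) = a * unit_integral f.
Proof. by move=> cf; apply: RintegralZl => //; exact: unit_integrable. Qed.

Lemma unit_integral_cst (a : R) : unit_integral (fun=> a) = a.
Proof.
rewrite /unit_integral Rintegral_cst//.
have H : mu `[0%R, 1%R]%classic = 1%:E.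
  by rewrite lebesgue_measure_itv /= lte_fin ltr01 oppr0 addr0.
transitivity (a * fine (1%:E : \bar R)); last by rewrite /= mulr1.
exact: (congr1 (fun z => a * fine z) H).
Qed.

Lemma unit_integral_sum m (f : 'I_m -> R -> R) :
  (forall j, unit_continuous (f j)) ->
  unit_integral (fun t => \sum_j f j t) = \sum_j unit_integral (f j).
Proof.
elim: m f => [|m IH] f cf.
  by under eq_fun do rewrite big_ord0; rewrite unit_integral_cst big_ord0.
under eq_fun do rewrite big_ord_recl.
rewrite unit_integralD//; last exact: unit_continuous_sum.
by rewrite big_ord_recl IH.
Qed.

Lemma unit_integral_norm f (a : R) : unit_continuous f ->
  (forall t, 0 <= t <= 1 -> `|f t| <= a) -> `|unit_integral f| <= a.
Proof.
move=> cf fa; apply: le_trans (le_normr_Rintegral _ (unit_integrable cf)) _ => //.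
have cn : unit_continuous (fun t => `|f t|).
  by move=> t t1; apply: continuous_comp; [exact: cf|exact: norm_continuous].
rewrite -[leRHS]unit_integral_cst; apply: le_Rintegral => //.
- exact: unit_integrable.
- exact/unit_integrable/unit_continuous_cst.
Qed.

Lemma unit_integral_FTC f g : (forall t : R, 0 <= t <= 1 -> is_derive t 1 g (f t)) ->
  unit_continuous f -> unit_integral f = g 1 - g 0.
Proof.
move=> dg cf; rewrite /unit_integral /Rintegral.
have cg (t : R) : 0 <= t <= 1 -> {for t, continuous g}.
  by move=> /dg[d _]; apply/differentiable_continuous/derivable1_diffP.
rewrite (@continuous_FTC2 _ f g)//.
- exact: unit_continuous_within.
- split.
  + move=> t; rewrite in_itv /= => /andP[t0 t1].
    by have [] := dg t; rewrite ?(ltW t0) ?(ltW t1).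
  + by apply: cvg_at_right_filter; apply: cg; rewrite lexx ler01.
  + by apply: cvg_at_left_filter; apply: cg; rewrite lexx ler01.
- move=> t; rewrite in_itv /= => /andP[t0 t1].
  by rewrite derive1E; have [] := dg t; rewrite ?(ltW t0) ?(ltW t1).
Qed.

End UnitIntegral.

Lemma continuous_eps (R : realType) (E F : normedModType R) (f : E -> F) y :
  (forall e : R, 0 < e -> \forall h \near (0 : E), `|f y - f (h + y)| <= e) ->
  {for y, continuous f}.
Proof.
move=> H; apply/cvgrPdist_le => e e0; apply/nbhs0P.
by apply: filterS (H e e0) => h; rewrite [h + y]addrC.
Qed.

Section Hadamard.
Variables (R : realType) (n : nat).
Local Notation E := 'rV[R]_n.

Lemma scalar_continuous (f : E -> R) : linear_for *%R f -> continuous f.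
Proof. by move=> lf w; exact/smooth_at_continuous/smooth_at_linear. Qed.

Definition partial i (f : E -> R) : E -> R := 'D_(delta_mx 0 i) f.

Lemma diff_partial (f : E -> R) w v : differentiable f w ->
  'd f w v = \sum_i v 0 i * partial i f w.
Proof.
move=> df; rewrite [v in LHS]row_sum_delta linear_sum; apply: eq_bigr => i _.
by rewrite linearZ /= /partial deriveE.
Qed.

Lemma CkS_partial k (f : E -> R) (W : set E) : open W -> Ck k.+1 f W ->
  (forall w, W w -> differentiable f w) /\ forall i, Ck k (partial i f) W.
Proof.
move=> oW /(CkSE _ _ oW)[df cf]; split=> // i.
by apply: Ck_eq (cf (delta_mx 0 i)) => // w /df dw; rewrite /partial deriveE.
Qed.

Lemma is_diff_partial (f : E -> R) (D : 'I_n -> R) w :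
  (forall e : R, 0 < e ->
    \forall h \near (0 : E), `|f (h + w) - f w - \sum_i h 0 i * D i| <= e * `|h|) ->
  is_diff w f (fun h => \sum_i h 0 i * D i).
Proof.
move=> H.
have lL : linear_for *%R (fun h : E => \sum_i h 0 i * D i).
  move=> a u v; rewrite mulr_sumr -big_split; apply: eq_bigr => i _ /=.
  by rewrite !mxE mulrDl mulrA.
pose L : {scalar E} := HB.pack (fun h : E => \sum_i h 0 i * D i)
  (GRing.isLinear.Build R E R *%R _ lL).
exact: (@is_diff_eps _ _ _ f L w (scalar_continuous lL)).
Qed.

Lemma is_derive_line (f : E -> R) z h (s : R) : differentiable f (z + s *: h) ->
  is_derive s 1 (fun s => f (z + s *: h)) ('d f (z + s *: h) h).
Proof.
move=> df; have da : is_diff s ((fun=> z) + (fun s : R => id s *: h) : R -> E)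
    (0 + fun t => t *: h).
  exact: is_diffD.
have dc := is_diff_comp da (differentiableP df).
case: dc => dc dcE.
apply: DeriveDef; first exact/derivable1_diffP.
by rewrite deriveE// dcE /= !fctE add0r scale1r.
Qed.

(** Differentiation under the integral sign needs an estimate uniform in the base point z;
    continuity of the partial derivatives provides it through the mean value theorem. *)
Lemma strict_diff (f : E -> R) (W : set E) w : open W -> Ck 1 f W -> W w ->
  forall e : R, 0 < e -> \forall z \near w & h \near (0 : E),
    `|f (z + h) - f z - \sum_i h 0 i * partial i f z| <= e * `|h|.
Proof.
move=> oW /(CkS_partial oW)[df cp] Ww e e0.
(* Each of the n coordinates contributes two errors, from the intermediate point to w and from w to
   z; the 1 keeps the denominator nonzero when n = 0. *)
have e1 : 0 < e / (n%:R + n%:R + 1) by rewrite divr_gt0// ltr_wpDl// addr_ge0.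
set e' := e / _ in e1.
have [d d0 Hd] : exists2 d : R, 0 < d & forall z, `|z - w| < d ->
    W z /\ forall i, `|partial i f z - partial i f w| < e'.
  have : \forall z \near w, W z /\ forall i, `|partial i f z - partial i f w| < e'.
    apply: filterI; first exact: open_nbhs_nbhs.
    have Hi (i : 'I_n) : \forall z \near w, `|partial i f z - partial i f w| < e'.
      have /cvgrPdist_lt/(_ _ e1) := cp i w Ww.
      by apply: filterS => z; rewrite distrC.
    exact: (@filter_forall E 'I_n (fun i z => `|partial i f z - partial i f w| < e') (nbhs w) _ Hi).
  by move=> /nbhs_ballP[d d0 Hd]; exists d => // z zw; apply: Hd; exact/ballrV.
have d2 : 0 < d / 2 by rewrite divr_gt0.
exists ([set z | `|z - w| < d / 2], [set h : E | `|h| < d / 2]).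
  split; first exact: (near_norm_lt (w : E) d2).
  by apply: filterS (near_norm_lt (0 : E) d2) => h; rewrite subr0.
move=> [z h] /= [zw h0].
have Hs (s : R) : 0 <= s <= 1 -> `|z + s *: h - w| < d.
  move=> /andP[s0 s1]; rewrite addrAC [d]splitr.
  apply: le_lt_trans (ler_normD _ _) _; rewrite ltrD// normrZ ger0_norm//.
  by apply: le_lt_trans h0; rewrite ler_piMl.
have dg (s : R) : 0 <= s <= 1 ->
    is_derive s 1 (fun s => f (z + s *: h)) (\sum_i h 0 i * partial i f (z + s *: h)).
  move=> s1; have [Wz _] := Hd _ (Hs s s1).
  by rewrite -diff_partial; [exact/is_derive_line/df|exact: df].
have cont : {within `[0, 1], continuous (fun s => f (z + s *: h))}.
  apply: unit_continuous_within => s /dg[d1 _].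
  exact/differentiable_continuous/derivable1_diffP.
have [|c c01] := MVT (@ltr01 R) _ cont (df := fun s => \sum_i h 0 i * partial i f (z + s *: h)).
  by move=> s; rewrite in_itv /= => /andP[s0 s1]; apply: dg; rewrite !ltW.
rewrite scale1r scale0r addr0 subr0 mulr1 => ->.
rewrite -sumrB; apply: le_trans (ler_norm_sum _ _ _) _.
have b0 : 0 < n%:R + n%:R + 1 :> R by rewrite ltr_wpDl// addr_ge0.
apply: (@le_trans _ _ (\sum_(i < n) `|h| * (e' + e'))).
  apply: ler_sum => i _; rewrite -mulrBr normrM ler_pM ?row_coord_le//.
  move: c01; rewrite in_itv /= => /andP[/ltW c0 /ltW c1].
  have [|_ /(_ i)/ltW H1] := Hd _ (Hs c _); first by rewrite c0.
  have [|_ /(_ i)/ltW H2] := Hd _ (Hs 0 _); first by rewrite lexx ler01.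
  rewrite scale0r addr0 distrC in H2.
  have -> : partial i f (z + c *: h) - partial i f z =
    (partial i f (z + c *: h) - partial i f w) + (partial i f w - partial i f z) by ring.
  by apply: le_trans (ler_normD _ _) _; exact: lerD.
rewrite sumr_const card_ord -mulrnAr mulrC ler_wpM2r//.
rewrite -mulr_natr /e' -mulrDl -mulrAC ler_pdivrMr//.
rewrite -subr_ge0; have -> : e * (n%:R + n%:R + 1) - (e + e) * n%:R = e by ring.
exact: ltW.
Qed.

Variable r : R.
Local Notation B := (ball (0 : E) r).

Lemma ball0_scale (t : R) y : 0 <= t <= 1 -> B y -> B (t *: y).
Proof.
move=> /andP[t0 t1] /ballrV; rewrite subr0 => yr; apply/ballrV.
by rewrite subr0 normrZ ger0_norm//; apply: le_lt_trans yr; rewrite ler_piMl.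
Qed.

(** The tube lemma: compactness of [0, 1] makes the neighbourhood of 0 independent of t. *)
Lemma unit_near (P : E -> R -> Prop) :
  (forall t : R, 0 <= t <= 1 -> \forall t' \near t & h \near (0 : E), P h t') ->
  \forall h \near (0 : E), forall t : R, 0 <= t <= 1 -> P h t.
Proof.
move=> H; have Hh : \forall h \near (0 : E), `[0%R, 1%R]%classic `<=` P h.
  have /compact_near_coveringP/(_ E (nbhs (0 : E)) P) := @segment_compact R 0 1.
  by apply=> t; rewrite /= in_itv /= => /H.
by apply: filterS Hh => h Hh t t1; apply: Hh; rewrite /= in_itv.
Qed.

(* The averages which occur in the classical proof of Hadamard's lemma; their
   class, with all m, is closed under differentiation. *)
Definition segment_mean m (f : E -> R) y := unit_integral (fun t => t ^+ m * f (t *: y)).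

Lemma scale_line_cvg (t : R) (y : E) :
  (fun p : R * E => p.1 *: (p.2 + y)) @ (nbhs t, nbhs (0 : E)) --> t *: y.
Proof.
have -> : t *: y = t *: (0 + y) by rewrite add0r.
apply: (@cvgZ _ _ _ _ _ (fun p : R * E => p.1) (fun p : R * E => p.2 + y)).
  exact: cvg_fst.
by apply: cvgD; [exact: cvg_snd|exact: cvg_cst].
Qed.

Lemma segment_mean_integrand m (f : E -> R) y : Ck 0 f B -> B y ->
  unit_continuous (fun t => t ^+ m * f (t *: y)).
Proof.
move=> cf By; apply: unit_continuousM; first exact: unit_continuousX.
move=> t t1; apply: (@continuous_comp _ _ _ (fun t : R => t *: y) f).
  exact: scalel_continuous.
by apply: cf; exact: ball0_scale.
Qed.

Lemma Ck_segment_mean k m (f : E -> R) : Ck k f B -> Ck k (segment_mean m f) B.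
Proof.
have oB : open B by exact: ball_open.
have near_B y : B y -> \forall h \near (0 : E), B (h + y).
  move=> By; have /nbhs0P : nbhs y B by exact: open_nbhs_nbhs.
  by apply: filterS => h; rewrite addrC.
elim: k m f => [|k IH] m f cf.
  move=> y By; apply: continuous_eps => e e0.
  have Hn : \forall h \near (0 : E), forall t, 0 <= t <= 1 ->
      `|f (t *: y) - f (t *: (h + y))| <= e.
    apply: unit_near => t t1.
    have e2 : 0 < e / 2 by rewrite divr_gt0.
    have /cvgrPdist_lt/(_ _ e2)/scale_line_cvg[[A1 A2] /= [nA1 nA2] A12] :=
      cf _ (ball0_scale t1 By).
    exists (A1, A2) => // -[t' h] [/= A1t A2h].
    have H1 := A12 (t', h) (conj A1t A2h).
    have H2 := A12 (t', 0) (conj A1t (nbhs_singleton nA2)).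
    rewrite /= add0r distrC in H2; rewrite /= in H1.
    apply/ltW; rewrite [e]splitr; apply: le_lt_trans (ltrD H2 H1).
    by apply: le_trans (ler_normD _ _); rewrite addrA subrK.
  apply: filterS2 (near_B _ By) Hn => h Bh Hh.
  rewrite -unit_integralB; [|exact: segment_mean_integrand..].
  apply: unit_integral_norm => [|t t1].
    by apply: unit_continuousB; exact: segment_mean_integrand.
  rewrite -mulrBr normrM; apply: le_trans (Hh t t1).
  case/andP: t1 => t0 t1; rewrite ler_piMl// normrX exprn_ile1// ger0_norm//.
have [df cp] := CkS_partial oB cf.
(* Deriving f (t y) in y brings out a factor t, hence the exponent [m.+1]. *)
exists (fun y h => \sum_i h 0 i * segment_mean m.+1 (partial i f) y).
split=> [y By|v]; last first.
  apply: Ck_big => i; apply: Ck_mul; first exact: Ck_cst.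
  exact: IH.
apply: is_diff_partial => e e0.
have cf1 : Ck 1 f B by elim: k cf {IH cp} => // k IH /CkS.
have cf0 := CkS cf1; have [_ cp0] := CkS_partial oB cf1.
(* The second bound on t belongs to the predicate given to [unit_near]: this predicate is also
   tested at t' near t, possibly outside [0, 1], where t' h need not be smaller than h. *)
have Hn : \forall h \near (0 : E), forall t, 0 <= t <= 1 -> 0 <= t <= 1 ->
  `|f (t *: (h + y)) - f (t *: y) - \sum_i (t *: h) 0 i * partial i f (t *: y)|
    <= e * `|h|.
  apply: unit_near => t t1.
  have [[Z K] /= [nZ nK] ZK] := strict_diff oB cf1 (ball0_scale t1 By) e0.
  have [[A1 A2] /= [nA1 nA2] A12] := scale_line_cvg nZ.
  have [[A3 A4] /= [nA3 nA4] A34] : nbhs (t, (0 : E)) ((fun p => p.1 *: (p.2 + 0)) @^-1` K).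
    by apply: scale_line_cvg; rewrite scaler0.
  exists (A1 `&` A3, A4); first by split=> //; exact: filterI.
  move=> [t' h] [/= [A1t A3t] A4h] t'1.
  have Zt := A12 (t', 0) (conj A1t (nbhs_singleton nA2)).
  have Kt := A34 (t', h) (conj A3t A4h).
  rewrite /= add0r in Zt; rewrite /= addr0 in Kt.
  have /= := ZK (t' *: y, t' *: h) (conj Zt Kt).
  rewrite [h + y]addrC scalerDr => H; apply: le_trans H _; rewrite ler_wpM2l ?(ltW e0)// normrZ.
  by case/andP: t'1 => t'0 t'1; rewrite ler_piMl// ger0_norm.
apply: filterS2 (near_B _ By) Hn => h Bh Hh.
have ci i : unit_continuous (fun t => h 0 i * (t ^+ m.+1 * partial i f (t *: y))).
  by apply: unit_continuousM; [exact: unit_continuous_cst|exact: segment_mean_integrand].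
have cB : unit_continuous (fun t => t ^+ m * f (t *: (h + y)) - t ^+ m * f (t *: y)).
  by apply: unit_continuousB; exact: segment_mean_integrand.
have -> : segment_mean m f (h + y) - segment_mean m f y -
    \sum_i h 0 i * segment_mean m.+1 (partial i f) y =
  unit_integral (fun t => (t ^+ m * f (t *: (h + y)) - t ^+ m * f (t *: y)) -
    \sum_i h 0 i * (t ^+ m.+1 * partial i f (t *: y))).
  rewrite unit_integralB//; last exact: unit_continuous_sum.
  rewrite unit_integralB; [|exact: segment_mean_integrand..].
  rewrite unit_integral_sum//; congr (_ - _); apply: eq_bigr => i _.
  by rewrite unit_integralZ//; exact: segment_mean_integrand.
apply: unit_integral_norm => [|t t1].
  by apply: unit_continuousB => //; exact: unit_continuous_sum.
have -> : t ^+ m * f (t *: (h + y)) - t ^+ m * f (t *: y) -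
    \sum_i h 0 i * (t ^+ m.+1 * partial i f (t *: y)) =
  t ^+ m * (f (t *: (h + y)) - f (t *: y) -
    \sum_i (t *: h) 0 i * partial i f (t *: y)).
  rewrite !mulrBr mulr_sumr; congr (_ - _); apply: eq_bigr => i _.
  by rewrite mxE exprS; ring.
rewrite normrM; apply: le_trans (Hh t t1 t1).
case/andP: t1 => t0 t1; rewrite ler_piMl// normrX exprn_ile1// ger0_norm//.
Qed.

(** The fundamental theorem of calculus for t |-> f (t y) on [0, 1]. *)
Lemma segment_mean_expand (f : E -> R) : Ck 1 f B -> forall y, B y ->
  f y = f 0 + \sum_i y 0 i * segment_mean 0 (partial i f) y.
Proof.
have oB : open B by exact: ball_open.
move=> cf1 y By; have cf0 := CkS cf1; have [df cp0] := CkS_partial oB cf1.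
have ci i : unit_continuous (fun t => y 0 i * (t ^+ 0 * partial i f (t *: y))).
  by apply: unit_continuousM; [exact: unit_continuous_cst|exact: segment_mean_integrand].
have := @unit_integral_FTC R (fun t => \sum_i y 0 i * (t ^+ 0 * partial i f (t *: y)))
  (fun t => f (0 + t *: y)).
rewrite unit_integral_sum// scale1r scale0r !add0r => H.
have dl (t : R) : 0 <= t <= 1 -> is_derive t 1 (fun t0 : R => f (0 + t0 *: y))
    (\sum_i y 0 i * (t ^+ 0 * partial i f (t *: y))).
  move=> t1; have dft : differentiable f (0 + t *: y).
    by rewrite add0r; exact/df/ball0_scale.
  have := is_derive_line dft; rewrite diff_partial// => dl.
  by apply: is_derive_eq dl _; apply: eq_bigr => i _; rewrite expr0 mul1r add0r.
have {}H := H dl (unit_continuous_sum ci).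
have -> : f y = f 0 + (f y - f 0) by ring.
rewrite -H; congr (_ + _); apply: eq_bigr => i _.
by rewrite unit_integralZ//; exact: segment_mean_integrand.
Qed.

End Hadamard.

Lemma hadamard (R : realType) n (f : 'rV[R]_n -> R) x : smooth_at f x ->
  exists g : 'I_n -> 'rV[R]_n -> R, (forall i, smooth_at (g i) x) /\
    \forall y \near x, f y = f x + \sum_i (y 0 i - x 0 i) * g i y.
Proof.
move=> sf; pose f0 := f \o (fun z => z + x).
have sx (a : 'rV[R]_n) w : smooth_at (fun z : 'rV[R]_n => z + a) w.
  by apply: smooth_atD; [exact: smooth_at_id|exact: smooth_at_cst].
have [U [oU U0 cU]] : smooth_at f0 0.
  by apply: smooth_at_comp; [exact: sx|rewrite add0r].
have /nbhs_ballP[r /= r0 rU] : nbhs (0 : 'rV[R]_n) U by exact: open_nbhs_nbhs.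
have cB k := Ck_sub rU (cU k).
have oB : open (ball (0 : 'rV[R]_n) r) by exact: ball_open.
exists (fun i => segment_mean 0 (partial i f0) \o (fun z => z - x)).
split=> [i|].
  apply: smooth_at_comp; first exact: sx.
  rewrite subrr; exists (ball 0 r); split=> //; first exact: ballxx.
  by move=> k; apply: Ck_segment_mean; have [_] := CkS_partial oB (cB k.+1); exact.
have : \forall y \near x, `|y - x| < r by exact: near_norm_lt.
apply: filterS => y yx.
have -> : f y = f0 (y - x) by rewrite /f0 /= subrK.
rewrite (segment_mean_expand (cB 1%N)); last by apply/ballrV; rewrite subr0.
rewrite {1}/f0 /= add0r; congr (_ + _); apply: eq_bigr => i _.
by rewrite !mxE.
Qed.

(** * Local algebras and Taylor expansions *)

Section LocalAlgebraTheory.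
Variables (R : realType) (A : localAlgebra R).
Local Notation I := (la_ideal A).
Local Notation N := (\dim {: A}).
Implicit Types (a b c x y : A) (s : seq A).

Lemma zeroAM a b : zeroA A (a * b) = zeroA A a * zeroA A b.
Proof. exact: rmorphM. Qed.

Lemma zeroAB a b : zeroA A (a - b) = zeroA A a - zeroA A b.
Proof. exact: rmorphB. Qed.

Lemma zeroA1 : zeroA A 1 = 1.
Proof. exact: rmorph1. Qed.

Lemma zeroAZ (r : R) a : zeroA A (r *: a) = r * zeroA A a.
Proof. exact: linearZ. Qed.

Lemma la_idealM a x : x \in I -> a * x \in I.
Proof. by rewrite -!zeroA_ker zeroAM => /eqP ->; rewrite mulr0. Qed.

(** Finite dimension replaces Zorn's lemma: a proper ideal that is not maximal is enlarged, its
    codimension drops, and the process ends at a maximal ideal, which is I_A by uniqueness. *)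
Lemma proper_ideal_sub (J : {vspace A}) : is_ideal J -> J != fullv -> (J <= I)%VS.
Proof.
have [n] := ubnP (N - \dim J); elim: n J => // n IH J nJ iJ pJ.
have [mJ|] := pselect (maximal_ideal J); first by rewrite (la_unique mJ).
move=> nmJ; have [J' [iJ' JJ' pJ' neJ]] : exists J' : {vspace A},
    [/\ is_ideal J', (J <= J')%VS, J' != fullv & J' <> J].
  apply: contrapT => H; apply: nmJ; split=> // J' iJ' JJ' pJ'.
  by apply: contrapT => neJ; apply: H; exists J'.
apply: (subv_trans JJ'); apply: IH => //.
have lt1 : (\dim J < \dim J')%N.
  rewrite ltn_neqAle dimvS// andbT; apply: contra_notN neJ => /eqP e.
  by apply/esym/eqP; rewrite eqEdim JJ' e leqnn.
have : (\dim J' <= N)%N by apply: dimvS; exact: subvf.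
by move: nJ lt1; lia.
Qed.

Definition principal a : {vspace A} := limg (amull a).

Lemma principal_ideal a : is_ideal (principal a).
Proof.
move=> b y /memv_imgP[c _ ->]; apply/memv_imgP; exists (b * c).
  exact: memvf.
by rewrite !lfunE /= !mulrA (la_mulC b).
Qed.

Lemma mem_principal a b : a * b \in principal a.
Proof. by apply/memv_imgP; exists b; rewrite ?memvf// lfunE. Qed.

(** The principal ideal of an element outside I_A is not contained in I_A, hence not proper. *)
Lemma la_unit a : zeroA A a != 0 -> exists b, a * b = 1.
Proof.
move=> a0; have [aT|aT] := eqVneq (principal a) fullv.
  have : 1 \in principal a by rewrite aT memvf.
  by move=> /memv_imgP[b _ ->]; exists b; rewrite lfunE.
have /subvP/(_ a) := proper_ideal_sub (@principal_ideal a) aT.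
by rewrite -{1}[a]mulr1 mem_principal -zeroA_ker (negbTE a0) => /(_ isT).
Qed.

Lemma la_regular a y : zeroA A a != 0 -> a * y = 0 -> y = 0.
Proof.
move=> /la_unit[b ab] ay.
by rewrite -[y]mul1r -ab (la_mulC a) -mulrA ay mulr0.
Qed.

(** Nakayama's argument: a further factor x in I_A strictly shrinks the principal ideal, since y = x
    y b would give (1 - b x) y = 0, where [zeroA] sends 1 - b x to 1, so that y = 0. The nilpotency
    of I_A, with exponent dim A, follows. *)
Lemma la_dim_prod s : all (mem I) s -> \prod_(x <- s) x != 0 ->
  (\dim (principal (\prod_(x <- s) x)%R) + size s <= N)%N.
Proof.
elim: s => [|x s IH] /=; first by rewrite addn0 => _ _; exact/dimvS/subvf.
move=> /andP[xI sI]; rewrite big_cons; set y := \prod_(_ <- _) _ => xy0.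
have y0 : y != 0 by apply: contra_neq xy0 => ->; rewrite mulr0.
apply: leq_trans (IH sI y0); rewrite addnS ltn_add2r ltn_neqAle.
have sub : (principal (x * y)%R <= principal y)%VS.
  apply/subvP => _ /memv_imgP[c _ ->].
  by rewrite lfunE /= (la_mulC x y) -mulrA mem_principal.
rewrite dimvS// andbT; apply/negP => /eqP e.
have {}e : principal (x * y) = principal y by apply/eqP; rewrite eqEdim sub e leqnn.
have : y \in principal (x * y) by rewrite e -{1}[y]mulr1 mem_principal.
move=> /memv_imgP[b _]; rewrite lfunE /= => yE; move/eqP: y0; apply.
apply: (@la_regular (1 - b * x)).
  rewrite zeroAB zeroA1 (eqP (_ : zeroA A (b * x) == 0)) ?subr0 ?oner_eq0//.
  by rewrite zeroA_ker la_idealM.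
by rewrite mulrBl mul1r -mulrA la_mulC -yE subrr.
Qed.

Lemma la_nilp s : all (mem I) s -> (N <= size s)%N -> \prod_(x <- s) x = 0.
Proof.
move=> sI Ns; apply/eqP/negPn/negP => p0; have := la_dim_prod sI p0.
suff : (0 < \dim (principal (\prod_(x <- s) x)%R))%N by lia.
rewrite lt0n dimv_eq0; apply: contraNneq p0 => e.
by have := mem_principal (\prod_(x <- s) x) 1; rewrite e mulr1 memv0.
Qed.

(* [la_ord k] is a filtration of A by ideals containing the powers of I_A. *)
Definition la_ord k a :=
  forall s, all (mem I) s -> (N <= size s + k)%N -> a * \prod_(x <- s) x = 0.

Lemma la_ord0 a : la_ord 0 a.
Proof. by move=> s sI; rewrite addn0 => /(la_nilp sI) ->; rewrite mulr0. Qed.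

Lemma la_ord_eq0 k a : (N <= k)%N -> la_ord k a -> a = 0.
Proof. by move=> Nk /(_ [::] isT Nk); rewrite big_nil mulr1. Qed.

Lemma la_ordS k a b : a \in I -> la_ord k b -> la_ord k.+1 (a * b).
Proof.
move=> aI kb s sI Ns; have := kb (a :: s); rewrite /= aI sI big_cons => <- //.
  by rewrite mulrA (la_mulC b).
by rewrite addSnnS.
Qed.

Lemma la_ordZ k (r : R) b : la_ord k b -> la_ord k (r *: b).
Proof. by move=> kb s sI Ns; rewrite -scalerAl kb// scaler0. Qed.

Lemma la_ordD k a b : la_ord k a -> la_ord k b -> la_ord k (a + b).
Proof. by move=> ka kb s sI Ns; rewrite mulrDl ka// kb// addr0. Qed.

Lemma la_ord_sum k m (F : 'I_m -> A) : (forall i, la_ord k (F i)) -> la_ord k (\sum_i F i).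
Proof.
move=> H; elim/big_ind: _ => // [|a b]; last exact: la_ordD.
by move=> s _ _; rewrite mul0r.
Qed.

End LocalAlgebraTheory.

(** The reindexing behind the Cauchy product of two truncated Taylor sums; the vanishing hypothesis
    will come from nilpotency. *)
Lemma big_triangle (V : nmodType) (F : nat -> nat -> V) N :
  (forall j k, (N <= j + k)%N -> F j k = 0) ->
  \sum_(j < N) \sum_(k < N) F j k = \sum_(n < N) \sum_(k < n.+1) F k (n - k)%N.
Proof.
move=> F0.
transitivity (\sum_(j < N) \sum_(n < N | (j <= n)%N) F j (n - j)%N).
  apply: eq_bigr => j _; rewrite -(big_mkord xpredT (F j)).
  rewrite -(big_mkord (fun n => j <= n)%N (fun n => F j (n - j)%N)).
  have jN : (j <= N)%N by rewrite ltnW.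
  have -> : \sum_(0 <= k < N) F j k = \sum_(0 <= k < N - j) F j k.
    rewrite (@big_cat_nat _ _ _ (N - j)%N) ?leq_subr//=.
    rewrite [X in _ + X]big_nat_cond [X in _ + X]big1 ?addr0// => i.
    by move=> /andP[/andP[Ni _] _]; apply: F0; lia.
  rewrite [RHS](@big_cat_nat _ _ _ j)//=.
  rewrite [X in _ = X + _]big_nat_cond [X in _ = X + _]big1 ?add0r; last first.
    by move=> i /andP[/andP[_ ij]]; rewrite leqNgt ij.
  have -> : \sum_(j <= i < N | (j <= i)%N) F j (i - j)%N =
      \sum_(0 + j <= i < N | (j <= i)%N) F j (i - j)%N by rewrite add0n.
  rewrite big_addn [RHS]big_mkcond /=.
  by apply: eq_bigr => i _; rewrite leq_addl addnK.
rewrite (exchange_big_dep predT)//=; apply: eq_bigr => n _.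
rewrite -(big_mkord (fun j => j <= n)%N (fun j => F j (n - j)%N)).
rewrite -(big_mkord xpredT (fun j => F j (n - j)%N)).
rewrite (@big_cat_nat _ _ _ n.+1)//= [X in _ + X]big_nat_cond.
rewrite [X in _ + X]big1 ?addr0.
  rewrite big_nat_cond [RHS]big_nat_cond; apply: eq_bigl => j.
  by rewrite ltnS andbT andbb.
by move=> i /andP[/andP[ni _]]; rewrite leqNgt ni.
Qed.

(** * Taylor expansions with values in A *)

Section Jets.
Variables (R : realType) (A : localAlgebra R) (n : nat).
Local Notation I := (la_ideal A).
Local Notation N := (\dim {: A}).
Local Notation E := 'rV[R]_n.
Implicit Types (f g : E -> R) (x : E) (a : 'I_n -> A).

Lemma smooth_at_partial i f x : smooth_at f x -> smooth_at (partial i f) x.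
Proof. exact: smooth_at_derive. Qed.

Lemma partial_near i f g x : (\forall y \near x, f y = g y) ->
  \forall y \near x, partial i f y = partial i g y.
Proof.
by move=> /nbhs_interior; apply: filterS => y fg; exact: near_eq_derive.
Qed.

Lemma partialD i f g x : smooth_at f x -> smooth_at g x ->
  \forall y \near x, partial i (fun z => f z + g z) y = partial i f y + partial i g y.
Proof.
move=> /smooth_at_near sf /smooth_at_near sg.
apply: filterS2 sf sg => y /smooth_at_differentiable df /smooth_at_differentiable dg.
by apply: deriveD; exact: diff_derivable.
Qed.

Lemma partialM i f g x : smooth_at f x -> smooth_at g x ->
  \forall y \near x, partial i (fun z => f z * g z) y =
    partial i f y * g y + f y * partial i g y.
Proof.
move=> /smooth_at_near sf /smooth_at_near sg.
apply: filterS2 sf sg => y /smooth_at_differentiable df /smooth_at_differentiable dg.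
rewrite /partial deriveM; [|exact: diff_derivable..].
by rewrite addrC /GRing.scale /= [X in X + _]mulrC.
Qed.

Lemma partial_cst i (r : R) x : partial i (fun=> r) x = 0.
Proof. exact: derive_cst. Qed.

Lemma partial_coord i j x : partial i (fun z => z 0 j) x = (j == i)%:R.
Proof.
have lj : linear_for *%R (fun z : E => z 0 j) by move=> c u v; rewrite !mxE.
pose l : {scalar E} := HB.pack (fun z : E => z 0 j : R)
  (GRing.isLinear.Build R E R *%R (fun z : E => z 0 j : R) lj).
have cl : continuous l by exact: scalar_continuous.
rewrite /partial deriveE; last exact: (@linear_differentiable _ _ _ l).
by rewrite (diff_lin _ cl) /= mxE eqxx.
Qed.

(* The homogeneous part of degree k of the Taylor expansion at x of f,
   evaluated at the n-tuple a of elements of A. *)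
Fixpoint jet k f x a : A :=
  if k is k'.+1 then k%:R^-1 *: \sum_i a i * jet k' (partial i f) x a
  else f x *: 1.

Arguments jet : simpl never.

Lemma jet0 f x a : jet 0 f x a = f x *: 1. Proof. by []. Qed.

Lemma jetE k f x a :
  jet k.+1 f x a = k.+1%:R^-1 *: \sum_i a i * jet k (partial i f) x a.
Proof. by []. Qed.

(** Euler's identity for the homogeneous part of degree k + 1. It lets inductions on the degree do
    without multi-indices and factorials. *)
Lemma jetS k f x a : k.+1%:R *: jet k.+1 f x a = \sum_i a i * jet k (partial i f) x a.
Proof. by rewrite jetE scalerA mulfV ?scale1r// pnatr_eq0. Qed.

Lemma jet_near k f g x a : (\forall y \near x, f y = g y) -> jet k f x a = jet k g x a.
Proof.
elim: k f g => [|k IH] f g fg; first by rewrite !jet0 (nbhs_singleton fg).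
rewrite !jetE; congr (_ *: _); apply: eq_bigr => i _.
by rewrite (IH _ _ (partial_near i fg)).
Qed.

Lemma jetD k f g x a : smooth_at f x -> smooth_at g x ->
  jet k (fun z => f z + g z) x a = jet k f x a + jet k g x a.
Proof.
elim: k f g => [|k IH] f g sf sg; first by rewrite !jet0 scalerDl.
rewrite !jetE -scalerDr -big_split; congr (_ *: _); apply: eq_bigr => i _.
rewrite (jet_near _ _ (partialD i sf sg)) IH ?mulrDr//; exact: smooth_at_partial.
Qed.

(** After multiplication by k + 1 and the product rule for the partial derivatives, the term of
    index j receives the weight j from the derivatives of f and k + 1 - j from those of g; the
    weights add up to k + 1. *)
Lemma jetM k f g x a : smooth_at f x -> smooth_at g x ->
  jet k (fun z => f z * g z) x a = \sum_(j < k.+1) jet j f x a * jet (k - j)%N g x a.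
Proof.
elim: k f g => [|k IH] f g sf sg.
  by rewrite big_ord1 !jet0 -scalerAl mul1r scalerA.
have k0 : (k.+1%:R : R) != 0 by rewrite pnatr_eq0.
apply: (scalerI k0); rewrite jetS.
have sp i := smooth_at_partial i sf; have sq i := smooth_at_partial i sg.
transitivity (\sum_(j < k.+1) j.+1%:R *: (jet j.+1 f x a * jet (k - j)%N g x a) +
   \sum_(j < k.+1) (k - j).+1%:R *: (jet j f x a * jet (k - j).+1 g x a)).
  rewrite -big_split /=.
  under eq_bigr do rewrite (jet_near _ _ (partialM _ sf sg))
    (jetD _ _ (smooth_atM (sp _) sg) (smooth_atM sf (sq _))) !IH// -big_split mulr_sumr.
  rewrite exchange_big /=; apply: eq_bigr => j _.
  rewrite scalerAl jetS scalerAr jetS mulr_suml mulr_sumr -big_split /=.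
  apply: eq_bigr => i _; rewrite mulrDr !mulrA; congr (_ + _ * _).
  exact: la_mulC.
rewrite scaler_sumr.
pose T j := jet j f x a * jet (k.+1 - j)%N g x a.
have -> : \sum_(j < k.+1) j.+1%:R *: (jet j.+1 f x a * jet (k - j)%N g x a) =
    \sum_(j < k.+2) j%:R *: T j.
  by rewrite [RHS]big_ord_recl /= scale0r add0r.
have -> : \sum_(j < k.+1) (k - j).+1%:R *: (jet j f x a * jet (k - j).+1 g x a) =
    \sum_(j < k.+2) (k.+1 - j)%:R *: T j.
  rewrite [RHS]big_ord_recr /= subnn scale0r addr0; apply: eq_bigr => j _.
  by rewrite /T subSn// -ltnS.
rewrite -big_split /=; apply: eq_bigr => j _; rewrite -scalerDl -natrD subnKC//.
by rewrite -ltnS.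
Qed.

Lemma jet_cst k (r : R) x a : jet k.+1 (fun=> r) x a = 0.
Proof.
elim: k r => [|k IH] r; rewrite jetE big1 ?scaler0// => i _;
  rewrite (_ : partial i _ = fun=> 0) ?IH ?jet0 ?scale0r ?mulr0//;
  by apply/funext => z; exact: partial_cst.
Qed.

Let partial_coordE i j : partial i (fun z : E => z 0 j) = fun=> (j == i)%:R.
Proof. by apply/funext => z; exact: partial_coord. Qed.

Lemma jet_coord1 j x a : jet 1 (fun z => z 0 j) x a = a j.
Proof.
rewrite jetE invr1 scale1r (bigD1 j)//= big1 => [|i ij].
  by rewrite partial_coordE jet0 eqxx scale1r mulr1 addr0.
by rewrite partial_coordE jet0 eq_sym (negbTE ij) scale0r mulr0.
Qed.

Lemma jet_coord2 k j x a : jet k.+2 (fun z => z 0 j) x a = 0.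
Proof.
by rewrite jetE big1 ?scaler0// => i _; rewrite partial_coordE jet_cst mulr0.
Qed.

Section Taylor.
Variable a : 'I_n -> A.
Hypothesis aI : forall i, a i \in I.

Lemma jet_ord k f x : la_ord k (jet k f x a).
Proof.
elim: k f => [|k IH] f; first exact: la_ord0.
by rewrite jetE; apply/la_ordZ/la_ord_sum => i; apply: la_ordS.
Qed.

(** The j factors taken from the tuple a are moved onto z one at a time, each raising its order by
    one. *)
Lemma jet_mul_eq0 j k f x z : la_ord k z -> (N <= j + k)%N -> jet j f x a * z = 0.
Proof.
elim: j k f z => [|j IH] k f z kz.
  by rewrite add0n => Nk; rewrite (la_ord_eq0 Nk kz) mulr0.
move=> Njk; rewrite jetE -scalerAl mulr_suml big1 ?scaler0// => i _.
by rewrite (la_mulC (a i)) -mulrA (IH k.+1) ?addnS -?addSn//; exact: la_ordS.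
Qed.

(* Every bound above N gives the same value; N + 2 terms make the value at the
   coordinate functions visible even if N = 1. *)
Definition taylor f x : A := \sum_(k < N.+2) jet k f x a.

Lemma taylor_near f g x : (\forall y \near x, f y = g y) -> taylor f x = taylor g x.
Proof. by move=> fg; apply: eq_bigr => k _; exact: jet_near. Qed.

Lemma taylorD f g x : smooth_at f x -> smooth_at g x ->
  taylor (fun z => f z + g z) x = taylor f x + taylor g x.
Proof. by move=> sf sg; rewrite -big_split; apply: eq_bigr => k _; exact: jetD. Qed.

Lemma taylorM f g x : smooth_at f x -> smooth_at g x ->
  taylor (fun z => f z * g z) x = taylor f x * taylor g x.
Proof.
move=> sf sg; rewrite /taylor mulr_suml.
under [RHS]eq_bigr do rewrite mulr_sumr.
rewrite (big_triangle (F := fun j k => jet j f x a * jet k g x a)).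
  by apply: eq_bigr => k _; exact: jetM.
move=> j k Njk; apply: (@jet_mul_eq0 j k); [exact: jet_ord|lia].
Qed.

Lemma taylor_cst (r : R) x : taylor (fun=> r) x = r *: 1.
Proof. by rewrite /taylor big_ord_recl big1 ?addr0// => k _; exact: jet_cst. Qed.

Lemma taylorZ (r : R) f x : smooth_at f x ->
  taylor (fun z => r * f z) x = r *: taylor f x.
Proof.
move=> sf; rewrite taylorM//; last exact: smooth_at_cst.
by rewrite taylor_cst -scalerAl mul1r.
Qed.

Lemma taylor_coord j x : taylor (fun z => z 0 j) x = x 0 j *: 1 + a j.
Proof.
rewrite /taylor 2!big_ord_recl big1 ?addr0 => [|k _]; last exact: jet_coord2.
by rewrite jet0; congr (_ + _); exact: jet_coord1.
Qed.

Lemma jetS_ideal k f x : jet k.+1 f x a \in I.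
Proof.
rewrite jetE memvZ// memv_suml// => i _; rewrite la_mulC; exact: la_idealM.
Qed.

Lemma zeroA_taylor f x : zeroA A (taylor f x) = f x.
Proof.
rewrite /taylor big_ord_recl; set y := \sum_(_ < _) _.
have yI : y \in I by apply: memv_suml => k _; exact: jetS_ideal.
rewrite jet0 raddfD /=; move: yI; rewrite -zeroA_ker => /eqP.
by rewrite zeroAZ zeroA1 mulr1 => ->; rewrite addr0.
Qed.

End Taylor.
End Jets.

(** * Morphisms on germs *)

Section GermHom.
Variables (R : realType) (A : localAlgebra R) (n : nat).
Local Notation I := (la_ideal A).
Local Notation E := 'rV[R]_n.
Implicit Types (f g : E -> R) (x : E) (Phi Psi : (E -> R) -> A).

(** An algebra morphism from the germs at x to A. To avoid a quotient, it is carried by all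
    functions and constrained only on those smooth at x; the last clause gives linearity by way of
    the product. *)
Definition germ_hom x Phi : Prop :=
  [/\ forall f g, smooth_at f x -> (\forall y \near x, f y = g y) -> Phi f = Phi g,
      forall f g, smooth_at f x -> smooth_at g x ->
        Phi (fun z => f z + g z) = Phi f + Phi g,
      forall f g, smooth_at f x -> smooth_at g x ->
        Phi (fun z => f z * g z) = Phi f * Phi g &
      forall r : R, Phi (fun=> r) = r *: 1].

Lemma germ_hom_taylor x (a : 'I_n -> A) : (forall i, a i \in I) ->
  germ_hom x (fun f => taylor a f x).
Proof.
move=> aI; split=> [f g _|f g|f g|r].
- exact: taylor_near.
- exact: taylorD.
- exact: taylorM.
- exact: taylor_cst.
Qed.

Lemma germ_hom_sum x Phi m (f : 'I_m -> E -> R) : germ_hom x Phi ->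
  (forall j, smooth_at (f j) x) -> Phi (fun z => \sum_j f j z) = \sum_j Phi (f j).
Proof.
move=> [PhiN PhiD PhiM Phic]; elim: m f => [|m IH] f sf.
  by under eq_fun do rewrite big_ord0; rewrite Phic scale0r big_ord0.
under eq_fun do rewrite big_ord_recl.
by rewrite PhiD ?IH ?big_ord_recl//; exact: smooth_at_sum.
Qed.

Lemma germ_hom_hadamard x Phi (g : 'I_n -> E -> R) f : germ_hom x Phi ->
  (forall i, smooth_at (g i) x) -> smooth_at f x ->
  (\forall y \near x, f y = f x + \sum_i (y 0 i - x 0 i) * g i y) ->
  Phi f = f x *: 1 + \sum_i (Phi (fun z => z 0 i) - x 0 i *: 1) * Phi (g i).
Proof.
move=> hPhi sg sf fE.
have [PhiN PhiD PhiM Phic] := hPhi.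
have sc i (r : R) : smooth_at (fun z : E => z 0 i + r) x.
  by apply: smooth_atD; [exact: smooth_at_coord|exact: smooth_at_cst].
rewrite (PhiN _ _ sf fE) PhiD; last 2 first.
- exact: smooth_at_cst.
- by apply: smooth_at_sum => i; apply: smooth_atM.
rewrite Phic (germ_hom_sum hPhi) => [|i]; last exact: smooth_atM.
congr (_ + _); apply: eq_bigr => i _; rewrite PhiM// PhiD ?Phic ?scaleNr//.
- exact: smooth_at_coord.
- exact: smooth_at_cst.
Qed.

(* Hadamard's lemma pushes the difference of the two morphisms ever deeper into
   the filtration of A. *)
Lemma germ_hom_uniq x Phi Psi : germ_hom x Phi -> germ_hom x Psi ->
  (forall i, Phi (fun z => z 0 i) = Psi (fun z => z 0 i)) ->
  (forall i, Phi (fun z => z 0 i) - x 0 i *: 1 \in I) ->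
  forall f, smooth_at f x -> Phi f = Psi f.
Proof.
move=> hPhi hPsi PhiPsi PhiI.
suff H k f : smooth_at f x -> la_ord k (Phi f - Psi f).
  by move=> f /(H (\dim {: A}))/la_ord_eq0 => /(_ (leqnn _))/subr0_eq.
elim: k f => [|k IH] f sf; first exact: la_ord0.
have [g [sg fE]] := hadamard sf.
rewrite (germ_hom_hadamard hPhi sg sf fE) (germ_hom_hadamard hPsi sg sf fE).
rewrite opprD addrACA subrr add0r -sumrB.
apply: la_ord_sum => i; rewrite -PhiPsi -mulrBr.
by apply: la_ordS => //; exact: IH.
Qed.

End GermHom.

(** * Paracompactness *)

Section CompactCover.
Variable T : topologicalType.

Lemma compact_pointwise_cover (K : set T) (U : T -> set T) : compact K ->
  (forall x, K x -> open (U x) /\ U x x) ->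
  exists s : seq T, (forall x, x \in s -> K x) /\ K `<=` \bigcup_(x in [set` s]) U x.
Proof.
move=> /compact_near_coveringP cK H.
(* Compactness is used as a near-covering property with respect to this filter, that of finite
   sequences in K ordered by inclusion; a property holding eventually then produces a finite
   subcover. *)
pose F : set_system (seq T) := fun A => exists2 s0 : seq T, {in s0, forall x, K x} &
  forall s, {in s, forall x, K x} -> {subset s0 <= s} -> A s.
have FF : Filter F.
  split; first by exists [::].
    move=> A B [s1 s1K As1] [s2 s2K Bs2]; exists (s1 ++ s2).
      by move=> x; rewrite mem_cat => /orP[/s1K|/s2K].
    move=> s sK sub; split; [apply: As1|apply: Bs2] => // x xs; apply: sub.
      by rewrite mem_cat xs.
    by rewrite mem_cat xs orbT.
  by move=> A B AB [s1 s1K As1]; exists s1 => // s sK ss; exact/AB/As1.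
have [x Kx|s sK Hs] := cK _ F (fun s x => (\bigcup_(y in [set` s]) U y) x) FF.
  have [oU Ux] := H x Kx.
  exists (U x, fun s : seq T => is_true (x \in s)).
    split; first exact: open_nbhs_nbhs.
    exists [:: x]; first by move=> y; rewrite inE => /eqP ->.
    by move=> s _; apply; rewrite inE.
  by move=> [y s] [/= Uy xs]; exists x.
by exists s; split => // x Kx; exact: (Hs s).
Qed.

Lemma compact_subcover (K : set T) (C : set (set T)) : compact K ->
  (forall U, C U -> open U) -> K `<=` \bigcup_(U in C) U ->
  exists C' : set (set T), [/\ C' `<=` C, finite_set C' & K `<=` \bigcup_(U in C') U].
Proof.
move=> cK oC KC.
have /choice[U HU] (x : T) : exists U : set T, K x -> C U /\ U x.
  have [/KC[U CU Ux]|nK] := pselect (K x); first by exists U.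
  by exists setT.
have [x Kx|s [sK Ks]] := compact_pointwise_cover (U := U) cK.
  by have [/oC] := HU x Kx.
exists (U @` [set` s]); split.
- by move=> _ [x xs <-]; have [] := HU x (sK x xs).
- exact/finite_image/finite_seq.
- by move=> x /Ks[y ys Uy]; exists (U y) => //; exists y.
Qed.

Definition locally_finite (D : set (set T)) :=
  forall x : T, exists2 B, nbhs x B & finite_set [set U | D U /\ U `&` B !=set0].

Lemma locally_finite_compact (D : set (set T)) (K : set T) :
  locally_finite D -> compact K -> finite_set [set U | D U /\ U `&` K !=set0].
Proof.
move=> lfD cK.
have /choice[B HB] (x : T) : exists B : set T, [/\ open B, B x &
    finite_set [set U | D U /\ U `&` B !=set0]].
  have [B nB fB] := lfD x; exists (B°); split; first exact: open_interior.
    exact: nB.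
  apply: sub_finite_set fB => U [DU [y [Uy By]]]; split=> //; exists y.
  by split=> //; exact: interior_subset.
have [x Kx|s [sK Ks]] := compact_pointwise_cover (U := B) cK.
  by have [] := HB x.
apply: (@sub_finite_set _ _ (\bigcup_(x in [set` s]) [set U | D U /\ U `&` B x !=set0])).
  move=> U [DU [y [Uy /Ks[x xs Bxy]]]]; exists x => //.
  by split=> //; exists y.
by apply: bigcup_finite => [|x _]; [exact: finite_seq|have [] := HB x].
Qed.

(* Inside the piece i, the refinement keeps, of a finite cover of [L i n], the
   parts lying off the earlier [L i k]. *)
Lemma paracompact_sigma_compact (I : Type) (b : T -> I) (O L : I -> nat -> set T) :
  (forall i, open [set x | b x = i]) ->
  (forall i n, [/\ open (O i n), compact (L i n), closed (L i n) & O i n `<=` L i n]) ->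
  (forall x, exists n, O (b x) n x) -> paracompact T.
Proof.
move=> ob HOL cov C oC Ccov.
have /choice[F HF] (p : I * nat) : exists F : set (set T),
    [/\ F `<=` C, finite_set F & L p.1 p.2 `<=` \bigcup_(U in F) U].
  have [_ cL _ _] := HOL p.1 p.2.
  by apply: compact_subcover cL oC _ => x _; rewrite Ccov.
pose S i m U := (U `&` [set x | b x = i]) `\` \bigcup_(k in `I_m) L i k.
exists [set V | exists i m U, F (i, m) U /\ V = S i m U]; split.
- move=> _ [i [m [U [FU ->]]]]; rewrite /S setDE; apply: openI.
    by apply: openI => //; have [+ _ _] := HF (i, m); move=> /(_ U FU); exact: oC.
  apply/closed_openC/closed_bigcup; first exact: finite_II.
  by move=> k _; have [] := HOL i k.
- apply/seteqP; split=> // x _; have [n Onx] := cov x.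
  have exm : exists m, `[< L (b x) m x >].
    by exists n; apply/asboolP; have [_ _ _] := HOL (b x) n; exact.
  case: (ex_minnP exm) => m /asboolP Lm minm.
  have [FC _ LF] := HF (b x, m); have [U FU Ux] := LF x Lm.
  exists (S (b x) m U); first by exists (b x), m, U.
  split=> // -[k /= km Lk]; have := minm k; rewrite leqNgt km => H.
  by have : false by apply: H; exact/asboolP.
- move=> _ [i [m [U [FU ->]]]]; exists U; last by move=> x [[]].
  by have [+ _ _] := HF (i, m); exact.
- move=> x; have [n Onx] := cov x; have [oO cL clL OL] := HOL (b x) n.
  (* This neighbourhood meets only the stages m <= n of its own piece, as [L (b x) n] is removed
     from all later ones. *)
  exists (O (b x) n `&` [set y | b y = b x]).
    by apply: open_nbhs_nbhs; split=> //; exact: openI.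
  apply: (@sub_finite_set _ _ (\bigcup_(m in `I_n.+1) (S (b x) m @` F (b x, m)))).
    move=> _ [[i [m [U [FU ->]]]] [y [[[Uy /= byi] NL] [Oy byx]]]].
    have ix : i = b x by rewrite -byi -byx.
    rewrite ix in FU NL *; exists m; last by exists U.
    rewrite /= ltnS leqNgt; apply/negP => nm; apply: NL; exists n => //.
    exact: OL.
  apply: bigcup_finite => [|m _]; first exact: finite_II.
  by apply: finite_image; have [] := HF (b x, m).
Qed.

(* The saturated sets are the unions of classes of the equivalence relation
   generated by lying in a common member of D. *)
Definition saturated (D : set (set T)) (S : set T) : Prop :=
  forall U, D U -> U `&` S !=set0 -> U `<=` S.

Definition saturation D (p : T) := \bigcap_(S in [set S | saturated D S /\ S p]) S.

Section Saturation.
Variable D : set (set T).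
Hypotheses (oD : forall U, D U -> open U) (cD : \bigcup_(U in D) U = setT).

Lemma saturated_saturation p : saturated D (saturation D p).
Proof.
move=> U DU [x [Ux px]] y Uy S [sS Sp]; apply: (sS U DU) => //.
by exists x; split=> //; exact: px.
Qed.

Lemma saturation_refl p : saturation D p p.
Proof. by move=> S []. Qed.

Lemma saturatedC S : saturated D S -> saturated D (~` S).
Proof.
move=> sS U DU [x [Ux nSx]] y Uy Sy; apply: nSx; apply: (sS U DU) => //.
by exists y.
Qed.

(** Symmetry is the point: if p were not in the class of q, the complement of that class would be a
    saturated set containing p, hence q. *)
Lemma saturation_eq p q : saturation D p q -> saturation D p = saturation D q.
Proof.
move=> pq; have qp : saturation D q p.
  apply: contrapT => nqp; have /(_ _)[] := pq (~` saturation D q).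
    by split; [apply: saturatedC; exact: saturated_saturation|exact: nqp].
  exact: saturation_refl.
apply/seteqP; split=> x; first by apply; split=> //; exact: saturated_saturation.
by apply; split=> //; exact: saturated_saturation.
Qed.

Lemma open_saturated S : saturated D S -> open S.
Proof.
move=> sS; rewrite openE => x Sx; have : [set: T] x by [].
rewrite -cD => -[U DU Ux]; apply: (@filterS _ _ _ U).
  by apply: sS => //; exists x.
by apply: open_nbhs_nbhs; split=> //; exact: oD.
Qed.

Fixpoint reach p n : set (set T) :=
  if n is n'.+1 then \bigcup_(U in reach p n') [set W | D W /\ W `&` U !=set0]
  else [set U | D U /\ U p].

Lemma reach_sub p n : reach p n `<=` D.
Proof. by case: n => [|n] U []// W _ []. Qed.

Lemma saturation_reach p : saturation D p `<=` \bigcup_n \bigcup_(U in reach p n) U.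
Proof.
move=> x; apply; split.
  move=> U DU [y [Uy [n _ [W rW Wy]]]] z Uz; exists n.+1 => //; exists U => //.
  by exists W => //; split=> //; exists y.
have : [set: T] p by [].
by rewrite -cD => -[U DU Up]; exists 0%N => //; exists U.
Qed.

End Saturation.

(* The pieces are the classes of the relation generated by meeting a common
   member of a locally finite refinement D; finitely many members of D meet a
   given compact set, so that a class is reached through countably many. *)
Lemma paracompact_blocks (O L : T -> set T) : paracompact T ->
  (forall x, [/\ open (O x), O x x, O x `<=` L x & compact (L x)]) ->
  exists (b : T -> T) (s : T -> nat -> T),
    (forall i, open [set x | b x = i]) /\ forall x, exists n, O (s (b x) n) x.
Proof.
move=> pT HO; have [U||D [oD cD DO lfD]] := pT (range O).
- by move=> [x _ <-]; have [] := HO x.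
- by apply/seteqP; split=> // x _; exists (O x); [exists x|have [] := HO x].
have [[p0 _]|T0] := pselect (exists p : T, True); last first.
  by exists id, (fun x _ => x); split=> x; case: T0; exists x.
have fD U : D U -> finite_set [set W | D W /\ W `&` U !=set0].
  move=> /DO[_ [x _ <-] UO]; have [_ _ OL cL] := HO x.
  apply: sub_finite_set (locally_finite_compact lfD cL) => W [DW [y [Wy Uy]]].
  by split=> //; exists y; split=> //; apply/OL/UO.
have freach p n : finite_set (reach D p n).
  elim: n => [|n IH] /=.
    have [B nB fB] := lfD p; apply: sub_finite_set fB => U [DU Up].
    by split=> //; exists p; split=> //; exact: nbhs_singleton nB.
  by apply: bigcup_finite => // U /reach_sub; exact: fD.
have creach p : countable (\bigcup_n reach D p n).
  by apply: bigcup_countable => // n _; exact: finite_set_countable.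
(* The countably many reached members of D are traded for sets [O y] containing them, since it is
   the centres y that have to be listed. *)
have /choice[ctr Hctr] (x : T) : exists f : nat -> T, forall n U,
    reach D x n U -> exists k, U `<=` O (f k).
  have [f Hf] : exists f : nat -> set T, (\bigcup_n reach D x n) `<=` range f.
    have [h hinj] := elimT (countable_injP _) (creach x).
    have /choice[f Hf] (k : nat) : exists W, forall U,
        (\bigcup_n reach D x n) U -> h U = k -> U = W.
      have [[W [rW hW]]|nW] := pselect (exists W, (\bigcup_n reach D x n) W /\ h W = k).
        by exists W => U rU hU; apply: hinj; rewrite ?inE ?hU.
      by exists set0 => U rU hU; case: nW; exists U.
    by exists f => U rU; exists (h U) => //; apply/esym/Hf.
  have /choice[g Hg] (k : nat) : exists y, D (f k) -> f k `<=` O y.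
    have [/DO[_ [y _ <-] UO]|nDU] := pselect (D (f k)); first by exists y.
    by exists x.
  exists g => n U rU; have [k _ fkU] := Hf U (ex_intro2 _ _ n I rU).
  by exists k; rewrite -fkU; apply: Hg; rewrite fkU; exact: reach_sub rU.
(* The choice depends only on the class as a set, so that all its points get the same
   representative. *)
pose b p := xget p0 (saturation D p).
have bP p : saturation D p (b p) := xgetI p0 (@saturation_refl D p).
have bE p q : saturation D p q -> b q = b p by rewrite /b => /saturation_eq ->.
exists b, ctr; split=> [i|x].
  rewrite openE => x /= bx; apply: (@filterS _ _ _ (saturation D x)).
    by move=> y /bE; rewrite bx.
  apply: open_nbhs_nbhs; split; last exact: saturation_refl.
  exact: (open_saturated oD cD (@saturated_saturation D x)).
have [n _ [U rU Ux]] : (\bigcup_n \bigcup_(U in reach D (b x) n) U) x.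
  apply: saturation_reach => //.
  by rewrite -(saturation_eq (bP x)); exact: saturation_refl.
by have [k UO] := Hctr _ _ _ rU; exists k; exact: UO.
Qed.

End CompactCover.

Lemma near_continuous (T U : topologicalType) (f : T -> U) x (B : U -> Prop) :
  {for x, continuous f} -> (\forall y \near f x, B y) -> \forall z \near x, B (f z).
Proof. by move=> cf; exact: cf. Qed.

(** * Manifolds *)

Section Shift.
Variables (R : realType) (n : nat).

Lemma Ck_shift k (F : normedModType R) (f : 'rV[R]_n -> F) (a : 'rV[R]_n) W :
  Ck k f W -> Ck k (fun w => f (w + a)) [set w | W (w + a)].
Proof.
have da w : is_diff w (fun z : 'rV[R]_n => z + a) id.
  have := is_diffD (is_diff_id w) (is_diff_cst a w); rewrite addr0; exact.
elim: k f => [|k IH] f.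
  move=> cf w Ww.
  have ca : {for w, continuous (fun z : 'rV[R]_n => z + a)}.
    by have [d _] := da w; exact: differentiable_continuous.
  exact: (continuous_comp ca (cf _ Ww)).
case=> Df [df cDf]; exists (fun w v => Df (w + a) v); split=> [w Ww|v].
  exact: (is_diff_comp (da w) (df _ Ww)).
exact: (IH _ (cDf v)).
Qed.

End Shift.

Section AffineSpaces.
Variables (R : realType) (V : vectType R) (M : affineSpace V).
Local Notation E := 'rV[R]_(\dim {:V}).
Implicit Types (o x y : M) (w : E).

Lemma aff_paramK o : cancel (aff_param o) (aff_coord o).
Proof.
by move=> w; rewrite /aff_coord /aff_param vaddK passmx.vecofK// vbasisP.
Qed.

Lemma vsub_chain o o' y : vsub y o' = vsub y o + vsub o o'.
Proof. by rewrite -{1}(vsubK o y) vsub_vadd. Qed.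

Lemma aff_coord_shift o o' y : aff_coord o' y = aff_coord o y + aff_coord o' o.
Proof. rewrite /aff_coord (vsub_chain o).
by have := passmx.rVof_linear (vbasis {:V}) 1 (vsub y o) (vsub o o'); rewrite !scale1r. Qed.

Lemma aff_param_shift o o' w : aff_param o' w = aff_param o (w + aff_coord o o').
Proof.
by apply: (can_inj (aff_coordK o)); rewrite aff_paramK (aff_coord_shift o') aff_paramK.
Qed.

Lemma open_affP o (U : set M) : open (aff_param o @^-1` U) -> open U.
Proof.
move=> oU; suff H : aff_op U by exact: H.
move=> o'; rewrite (_ : _ @^-1` _ = (fun w => w + aff_coord o o') @^-1` (aff_param o @^-1` U)).
  apply: open_comp => // w _; apply: smooth_at_continuous.
  by apply: smooth_atD; [exact: smooth_at_id|exact: smooth_at_cst].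
by apply/funext => w; rewrite /preimage /= -aff_param_shift.
Qed.

Lemma aff_param_continuous o : continuous (aff_param o).
Proof. by apply/continuousP => U; apply. Qed.

Lemma aff_coord_continuous o : continuous (aff_coord o).
Proof.
apply/continuousP => U oU; apply: (@open_affP o).
by rewrite (_ : _ @^-1` _ = U)//; apply/funext => w; rewrite /preimage /= aff_paramK.
Qed.

Lemma near_aff o x (Q : M -> Prop) :
  (\forall y \near x, Q y) <-> (\forall w \near aff_coord o x, Q (aff_param o w)).
Proof.
split=> H; first by apply: aff_param_continuous; rewrite aff_coordK.
have H' : \forall y \near x, Q (aff_param o (aff_coord o y)) := aff_coord_continuous H.
apply: filterS H' => y.
by rewrite aff_coordK.
Qed.

(** Coordinates with two origins differ by a translation, so one origin is enough. *)
Lemma smooth_onP (F : normedModType R) o (W : set M) (f : M -> F) : open W ->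
  smooth_on W f <-> forall x, W x -> smooth_at (f \o aff_param o) (aff_coord o x).
Proof.
move=> oW; split=> [[U [oU WU cU]] x Wx|H].
  exists (aff_param o @^-1` U); split; [exact: oU|rewrite /= aff_coordK|exact: cU].
  exact: WU.
exists W; split=> // o' k.
have /(Ck_shift (aff_coord o o')) : Ck k (f \o aff_param o) (aff_param o @^-1` W).
  by apply: smooth_at_Ck => w Ww; rewrite -(aff_paramK o w); exact: H.
rewrite (_ : mkset _ = aff_param o' @^-1` W); last first.
  by apply/funext => w; rewrite /preimage /= -aff_param_shift.
by congr Ck; apply/funext => w /=; rewrite -aff_param_shift.
Qed.

End AffineSpaces.

Lemma smooth_on_affP (R : realType) (V V' : vectType R) (M : affineSpace V)
    (N : affineSpace V') (o : M) (o' : N) (W : set M) (h : M -> N) : open W ->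
  smooth_on_aff W h <->
  forall x, W x -> smooth_at (aff_coord o' \o h \o aff_param o) (aff_coord o x).
Proof.
move=> oW; split=> [H x Wx|H o''].
  exact: (iffLR (smooth_onP o (aff_coord o' \o h) oW) (H o')).
apply/(smooth_onP o) => // x Wx.
rewrite (_ : _ \o _ = fun w => (aff_coord o' \o h \o aff_param o) w + aff_coord o'' o').
  by apply: smooth_atD; [exact: H|exact: smooth_at_cst].
by apply/funext => w; rewrite /= (aff_coord_shift o').
Qed.

Lemma finI_from_ind (I : choiceType) (T : Type) (D : set I) (b : I -> set T)
    (K : set T -> Prop) : K setT -> (forall A B, K A -> K B -> K (A `&` B)) ->
  (forall i, D i -> K (b i)) -> forall A, finI_from D b A -> K A.
Proof.
move=> KT KI Kb _ [F sF <-]; rewrite bigcap_fset.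
by rewrite big_seq; elim/big_ind: _ => // i /sF; rewrite inE; exact: Kb.
Qed.

(** * Topology and smooth functions of an atlas *)

Section AtlasTopology.
Variables (R : realType) (V : vectType R) (M : affineSpace V).
Implicit Types (P : atlasSpace M).
Local Notation E := 'rV[R]_(\dim {:V}).
Local Notation o := (aff_origin M).

Lemma open_atlas_ind P (K : set P -> Prop) :
  K setT -> (forall A B, K A -> K B -> K (A `&` B)) ->
  (forall F : set (set P), (forall A, F A -> K A) -> K (\bigcup_(A in F) A)) ->
  (forall c (U : set M), atlas P c -> open U -> K (cdom c `&` c @^-1` U)) ->
  forall B, open B -> K B.
Proof.
move=> KT KI KU Kb B [D' sD' <-]; apply: KU => A /sD'.
by apply: finI_from_ind => // _ [c [U [cP oU ->]]]; exact: Kb.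
Qed.

Lemma open_chart_preimage P c (U : set M) : atlas P c -> open U ->
  open (cdom c `&` c @^-1` U : set P).
Proof.
move=> cP oU; exists [set (cdom c `&` c @^-1` U : set P)]; last by rewrite bigcup_set1.
move=> _ ->.
have H : [set B : set P | exists c (U : set M), [/\ atlas P c, open U &
  B = cdom c `&` c @^-1` U]] (cdom c `&` c @^-1` U) by exists c, U.
exact: (finI_from1 id H).
Qed.

Definition ccoord T (c : chart T M) (p : T) : E := aff_coord o (c p).

(** The inverse of the chart, read in coordinates. The point p0 is only the value off the image; the
    statements that use [cinv] are local, and any p0 will do. *)
Definition cinv P (c : chart P M) (p0 : P) (w : E) : P :=
  xget p0 [set q | cdom c q /\ ccoord c q = w].

Lemma ccoord_inj T (c : chart T M) p q : is_chart c -> cdom c p -> cdom c q ->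
  ccoord c p = ccoord c q -> p = q.
Proof.
move=> [inj _] cp cq /(can_inj (aff_coordK o)); apply: inj; rewrite inE//.
Qed.

Lemma cinvK P (c : chart P M) p0 q : is_chart c -> cdom c q ->
  cinv c p0 (ccoord c q) = q.
Proof.
move=> ic cq; apply: xget_unique => // q' [cq' /(ccoord_inj ic cq' cq)]; exact.
Qed.

Section Atlas.
Variable P : atlasSpace M.
Hypothesis aP : is_atlas P.
Implicit Types (c d e : chart P M) (p q : P).

Lemma atlas_admissible c : atlas P c -> admissible c.
Proof. by case: aP => H1 H2 _ cP; split=> [|d dP]; [exact: H1|exact: H2]. Qed.

Lemma ex_chart (p : P) : exists2 c, atlas P c & cdom c p.
Proof. by case: aP. Qed.

Lemma transition_smooth_at (c d : chart P M) p p0 : is_chart c ->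
  smooth_transition c d -> cdom c p -> cdom d p ->
  (\forall w \near ccoord c p, cdom c (cinv c p0 w) /\ cdom d (cinv c p0 w)
     /\ ccoord c (cinv c p0 w) = w) /\
  smooth_at (ccoord d \o cinv c p0) (ccoord c p).
Proof.
move=> ic [oW [h hE hs]] cp dp.
have Wp : (c @` (cdom c `&` cdom d)) (c p) by exists p.
have nW : \forall w \near ccoord c p, (c @` (cdom c `&` cdom d)) (aff_param o w).
  by apply/near_aff; exact: open_nbhs_nbhs.
have nH : \forall w \near ccoord c p, cdom c (cinv c p0 w) /\ cdom d (cinv c p0 w)
     /\ ccoord c (cinv c p0 w) = w.
  apply: filterS nW => w [q [cq dq] cqw].
  have <- : ccoord c q = w by rewrite /ccoord cqw aff_paramK.
  by rewrite cinvK.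
split=> //.
have := iffLR (smooth_on_affP o o h oW) hs _ Wp.
apply: smooth_at_eq; apply: filterS nH => w [cw [dw wE]] /=.
by rewrite -[in LHS]wE /ccoord aff_coordK hE.
Qed.

(** By induction on the generation of B from the subbase: injectivity of c makes images commute with
    intersections, and for a subbasic set the transition function is continuous. *)
Lemma open_chart_image c (B : set P) : admissible c -> open B ->
  open (c @` (B `&` cdom c)).
Proof.
move=> [[inj oc] adm]; move: B; apply: open_atlas_ind => [|A B oA oB|F HF|d U dP oU].
- by rewrite setTI.
- rewrite (_ : _ @` _ = c @` (A `&` cdom c) `&` c @` (B `&` cdom c)); first exact: openI.
  apply/seteqP; split=> [_ [q [[Aq Bq] cq] <-]|_ [[q [Aq cq] <-] [q' [Bq' cq'] /inj]]].
    by split; exists q.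
  by rewrite !inE => /(_ cq' cq) qq'; exists q => //; rewrite -qq' in Aq cq *.
- rewrite setI_bigcupl image_bigcup; apply: bigcup_open => A FA; exact: HF.
- rewrite openE => _ [q [[dq Uq] cq] <-]; apply/(near_aff o).
  have [ncd sh] := transition_smooth_at q (conj inj oc) (proj1 (adm d dP)) cq dq.
  have oU' : nbhs (ccoord d q) (aff_param o @^-1` U).
    by apply: open_nbhs_nbhs; split; [exact: oU|rewrite /ccoord /= aff_coordK].
  have nU : \forall w \near ccoord c q, U (aff_param o (ccoord d (cinv c q w))).
    apply: (near_continuous (B := fun z => U (aff_param o z)) (smooth_at_continuous sh)).
    by rewrite /= cinvK.
  apply: filterS2 ncd nU => w [cw [dw wE]] Uw; exists (cinv c q w).
    by split=> //; split=> //; rewrite /ccoord aff_coordK in Uw.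
  by rewrite -[in RHS]wE /ccoord aff_coordK.
Qed.

Lemma near_chart_in c p (U : set E) : admissible c -> cdom c p ->
  nbhs (ccoord c p) U -> \forall q \near p, cdom c q /\ U (ccoord c q).
Proof.
move=> [ic adm] cp nU; have [d dP dp] := ex_chart p.
have [_ tdc] := adm d dP; have [id' _] := atlas_admissible dP.
have [ncd sh] := transition_smooth_at p id' tdc dp cp.
have nU' : \forall w \near ccoord d p, U (ccoord c (cinv d p w)).
  by apply: (near_continuous (smooth_at_continuous sh)); rewrite /= cinvK.
pose B w := cdom c (cinv d p w) /\ U (ccoord c (cinv d p w)).
have nB : \forall w \near ccoord d p, B w.
  by apply: filterS2 ncd nU' => w [_ [cw _]] Uw.
have nB' : \forall y \near d p, B (aff_coord o y).
  exact: near_continuous (@aff_coord_continuous _ _ _ o (d p)) nB.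
have oS := open_chart_preimage dP (open_interior [set y | B (aff_coord o y)]).
have : \forall q \near p, cdom d q /\ [set y | B (aff_coord o y)]° (d q).
  by apply: (open_nbhs_nbhs (conj oS _)); split.
apply: filterS => q [dq /interior_subset]; rewrite /= -/(ccoord d q) /B.
by rewrite cinvK.
Qed.

(** The bridge between the topology generated by the atlas and coordinates: c is a local
    homeomorphism, and local properties can be checked on the side of the row vectors. *)
Lemma near_chart c p p0 (Q : P -> Prop) : admissible c -> cdom c p ->
  (\forall q \near p, Q q) <-> (\forall w \near ccoord c p, Q (cinv c p0 w)).
Proof.
move=> ac cp; have [ic _] := ac; split=> [nQ|nQ]; last first.
  have := near_chart_in ac cp nQ; apply: filterS => q [cq].
  by rewrite /= cinvK.
have oQ : open (c @` (Q° `&` cdom c)) by apply: open_chart_image => //; exact: open_interior.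
have : \forall y \near c p, (c @` (Q° `&` cdom c)) y.
  by apply: open_nbhs_nbhs; split=> //; exists p.
move=> /(near_aff o); apply: filterS => w [q [Qq cq] qw].
have <- : ccoord c q = w by rewrite /ccoord qw aff_paramK.
by rewrite cinvK//; exact: interior_subset.
Qed.

Lemma near_cdom c p : admissible c -> cdom c p -> \forall q \near p, cdom c q.
Proof.
move=> ac cp; have nT : nbhs (ccoord c p) setT by exact: filterT.
by apply: filterS (near_chart_in ac cp nT) => q [].
Qed.

Lemma open_cdom c : admissible c -> open (cdom c).
Proof. by move=> ac; rewrite openE => p cp; exact: near_cdom. Qed.

Lemma near_ccoordK c p p0 : admissible c -> cdom c p ->
  \forall w \near ccoord c p, cdom c (cinv c p0 w) /\ ccoord c (cinv c p0 w) = w.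
Proof.
move=> ac cp; have [ic _] := ac; have [_ oc] := ic.
have : \forall y \near c p, (c @` cdom c) y.
  by apply: open_nbhs_nbhs; split=> //; exists p.
move=> /(near_aff o); apply: filterS => w [q cq qw].
have <- : ccoord c q = w by rewrite /ccoord qw aff_paramK.
by rewrite cinvK.
Qed.

(** Admissibility compares a chart only with those of the atlas; two admissible charts are compared
    through an atlas chart e around p. *)
Lemma smooth_transition_admissible c d p p0 : admissible c -> admissible d ->
  cdom c p -> cdom d p -> smooth_at (ccoord d \o cinv c p0) (ccoord c p).
Proof.
move=> ac ad cp dp; have [e eP ep] := ex_chart p.
have [[ic admc] [id' admd]] := (ac, ad); have [ie _] := atlas_admissible eP.
have [nce sce] := transition_smooth_at p0 ic (proj1 (admc e eP)) cp ep.
have [ned sed] := transition_smooth_at p0 ie (proj2 (admd e eP)) ep dp.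
have := @smooth_at_vcomp _ _ _ _ (ccoord e \o cinv c p0) (ccoord d \o cinv e p0)
  (ccoord c p) sce.
rewrite /= cinvK// => /(_ sed); apply: smooth_at_eq.
by apply: filterS nce => w [cw [ew wE]] /=; rewrite cinvK.
Qed.

Definition smooth_near (f : P -> R) (p : P) :=
  exists c, [/\ admissible c, cdom c p & smooth_at (f \o cinv c p) (ccoord c p)].

Lemma smooth_near_chart f p c p0 : smooth_near f p -> admissible c -> cdom c p ->
  smooth_at (f \o cinv c p0) (ccoord c p).
Proof.
move=> [d [ad dp sf]] ac cp; have [[ic _] [id' _]] := (ac, ad).
have scd := smooth_transition_admissible p0 ac ad cp dp.
have := smooth_at_comp scd; rewrite /= cinvK// => /(_ _ sf); apply: smooth_at_eq.
have /(near_chart p0 _ ac cp) := near_cdom ad dp.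
by apply: filterS => w dw; rewrite /= cinvK.
Qed.

Lemma smooth_near_coord c p i : admissible c -> cdom c p -> smooth_near (fun q => ccoord c q 0 i) p.
Proof.
move=> ac cp; exists c; split=> //; apply: smooth_at_eq (smooth_at_coord i _).
by apply: filterS (near_ccoordK p ac cp) => w [_ /= ->].
Qed.

Lemma smooth_near_near f g p : (\forall q \near p, f q = g q) -> smooth_near f p -> smooth_near g p.
Proof.
move=> fg [c [ac cp sf]]; exists c; split=> //; apply: smooth_at_eq sf.
by move: fg => /(near_chart p _ ac cp).
Qed.

Lemma smooth_near_comp n (h : 'rV[R]_n -> R) (f : P -> 'rV[R]_n) p :
  (forall j, smooth_near (fun q => f q 0 j) p) -> smooth_at h (f p) -> smooth_near (h \o f) p.
Proof.
move=> sf sh; have [c cP cp] := ex_chart p; have ac := atlas_admissible cP.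
exists c; split=> //; have [ic _] := ac.
apply: (smooth_at_comp (f := f \o cinv c p) (g := h)); last by rewrite /= cinvK.
by apply: smooth_at_row => j; exact: (smooth_near_chart p (sf j) ac cp).
Qed.

Lemma smooth_nearM f g p : smooth_near f p -> smooth_near g p -> smooth_near (fun q => f q * g q) p.
Proof.
move=> [c [ac cp sf]] /smooth_near_chart/(_ ac cp) sg; exists c; split=> //.
exact: (smooth_atM sf (sg p)).
Qed.

Lemma smooth_near_cst (r : R) p : smooth_near (fun=> r) p.
Proof.
have [c cP cp] := ex_chart p; exists c; split=> //; first exact: atlas_admissible.
exact: smooth_at_cst.
Qed.

Lemma smooth_nearV f p : f p != 0 -> smooth_near f p -> smooth_near (fun q => (f q)^-1) p.
Proof.
move=> f0 [c [ac cp sf]]; exists c; split=> //; have [ic _] := ac.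
by apply: (smooth_atV (f := f \o cinv c p)) => //; rewrite /= cinvK.
Qed.

Lemma smooth_near_continuous f p : smooth_near f p -> {for p, continuous f}.
Proof.
move=> [c [ac cp /smooth_at_continuous cf]] B fB; have [ic _] := ac.
apply/(near_chart p _ ac cp); apply: cf; rewrite /= cinvK//.
Qed.

Lemma smooth_funP f : f \in smooth_pred P <-> forall p, smooth_near f p.
Proof.
split=> [/asboolP sf p|sf].
  have [c cP cp] := ex_chart p; have ac := atlas_admissible cP.
  have [h hE hs] := sf c cP; have [ic _] := ac; have [_ oc] := ic.
  exists c; split=> //.
  have Wp : (c @` cdom c) (c p) by exists p.
  have := iffLR (smooth_onP o _ oc) hs _ Wp; apply: smooth_at_eq.
  apply: filterS (near_ccoordK p ac cp) => w [cw wE] /=.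
  by rewrite -[in LHS]wE /ccoord aff_coordK hE.
apply/asboolP => c cP; have ac := atlas_admissible cP; have [ic _] := ac.
(* An empty P offers no default value for [cinv]; any smooth function on the model then represents
   f. *)
have [[p0 _]|nP] := pselect (exists p : P, True); last first.
  by exists (fun=> 0) => [p|]; [case: nP; exists p|exact: smooth_on_cst].
exists (fun y => f (cinv c p0 (aff_coord o y))) => [p cp|].
  by rewrite -[aff_coord _ _]/(ccoord c p) cinvK.
apply/(smooth_onP o); first by case: ic.
move=> _ [p cp <-]; rewrite (_ : _ \o aff_param o = f \o cinv c p0).
  exact: smooth_near_chart p0 (sf p) ac cp.
by apply/funext => w; rewrite /= aff_paramK.
Qed.

End Atlas.

End AtlasTopology.

Section SmoothMaps.
Variables (R : realType) (V V' : vectType R).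
Variables (M : affineSpace V) (N : affineSpace V').
Variables (P : atlasSpace M) (Q : atlasSpace N).
Hypotheses (aP : is_atlas P) (aQ : is_atlas Q).

(** One target chart per point suffices if f maps a whole neighbourhood into its domain: continuity
    is then a consequence, and other charts are reached by transition functions. *)
Lemma smooth_map_local (f : P -> Q) :
  (forall p, exists d, [/\ admissible d, \forall q \near p, cdom d (f q) &
     forall j, smooth_near (fun q => ccoord d (f q) 0 j) p]) -> smooth_map f.
Proof.
move=> H; have cf : continuous f.
  move=> p B nB; have [d [ad nd sd]] := H p; have [id' _] := ad.
  have dp := nbhs_singleton nd.
  have cc : {for p, continuous (fun q => ccoord d (f q))}.
    have [c cP cp] := ex_chart aP p; have ac := atlas_admissible aP cP.
    move=> U nU; apply/(near_chart aP p _ ac cp).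
    have : smooth_at (fun w => ccoord d (f (cinv c p w))) (ccoord c p).
      by apply: smooth_at_row => j; exact: (smooth_near_chart aP p (sd j) ac cp).
    move=> /smooth_at_continuous cw; apply: (near_continuous cw).
    by have [ic _] := ac; rewrite cinvK.
  have nB' : \forall w \near ccoord d (f p), B (cinv d (f p) w).
    exact: (iffLR (near_chart aQ (f p) B ad dp) nB).
  have := near_continuous cc nB'.
  by apply: filterS2 nd => q dq; rewrite cinvK.
split=> // c d' cP d'Q; have ac := atlas_admissible aP cP.
have ad' := atlas_admissible aQ d'Q; have [[ic _] [id' _]] := (ac, ad').
have [[p0 _]|nP] := pselect (exists p : P, True); last first.
  exists (fun=> aff_origin N) => [p|o']; first by case: nP; exists p.
  exists setT; split=> [||o k]; [exact: openT|by []|exact: Ck_cst].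
exists (fun y => d' (f (cinv c p0 (aff_coord (aff_origin M) y)))) => [p cp _|].
  by rewrite -[aff_coord _ _]/(ccoord c p) cinvK.
have oW : open (c @` (cdom c `&` f @^-1` cdom d')).
  rewrite setIC; apply: open_chart_image => //.
  by apply: open_comp => [p _|]; [exact: cf|exact: open_cdom].
apply/(smooth_on_affP (aff_origin M) (aff_origin N)) => // _ [p [cp d'p] <-].
have [d [ad nd sd]] := H p; have dp := nbhs_singleton nd.
have st := smooth_transition_admissible aQ (f p) ad ad' dp d'p.
have sc : smooth_at (fun w => ccoord d (f (cinv c p0 w))) (ccoord c p).
  by apply: smooth_at_row => j; exact: (smooth_near_chart aP p0 (sd j) ac cp).
have := @smooth_at_vcomp _ _ _ _ _ (ccoord d' \o cinv d (f p)) _ sc.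
rewrite cinvK// => /(_ st); apply: smooth_at_eq.
have /(near_chart aP p0 _ ac cp) := nd.
apply: filterS => w dw; have [idd _] := ad.
by rewrite /= cinvK// aff_paramK.
Qed.

Lemma smooth_map_chart (f : P -> Q) :
  (forall p, exists c d (H : 'rV[R]_(\dim {:V}) -> 'rV[R]_(\dim {:V'})),
    [/\ admissible c, cdom c p, admissible d, smooth_at H (ccoord c p) &
        \forall q \near p, cdom d (f q) /\ ccoord d (f q) = H (ccoord c q)]) ->
  smooth_map f.
Proof.
move=> HH; apply: smooth_map_local => p; have [c [d [H [ac cp ad sH nH]]]] := HH p.
exists d; split=> // [|j]; first by apply: filterS nH => q [].
have : smooth_near (fun q => H (ccoord c q) 0 j) p.
  have := @smooth_near_comp _ _ _ _ aP _ (fun w => H w 0 j) (ccoord c) p; apply.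
    by move=> i; exact: smooth_near_coord.
  exact: smooth_at_rowE.
by apply: smooth_near_near => //; apply: filterS nH => q [_ ->].
Qed.

End SmoothMaps.

Lemma smooth_at_ext (R : realType) n (F : normedModType R) (f g : 'rV[R]_n -> F) w :
  f =1 g -> smooth_at f w -> smooth_at g w.
Proof. by move=> /funext ->. Qed.

Lemma hausdorff_injective (T U : topologicalType) (f : T -> U) :
  hausdorff_space U -> continuous f -> injective f -> hausdorff_space T.
Proof.
move=> hU cf injf p q pq; apply/injf/hU => A B nA nB.
have [x [Ax Bx]] := pq _ _ (cf p _ nA) (cf q _ nB).
by exists (f x).
Qed.

Section AffineManifold.
Variables (R : realType) (V : vectType R) (M : affineSpace V).
Local Notation E := 'rV[R]_(\dim {:V}).
Local Notation o := (aff_origin M).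

Lemma compatible_refl (T : Type) (c : chart T M) : is_chart c -> compatible c c.
Proof.
move=> [_ oc]; suff H : smooth_transition c c by split.
split; rewrite setIid //; exists id => //.
apply/(smooth_on_affP o o) => // x _.
by apply: smooth_at_ext (smooth_at_id _) => w /=; rewrite aff_paramK.
Qed.

Lemma affmfd_is_atlas : is_atlas (affmfd M).
Proof.
have ic : is_chart (Chart setT id : chart M M).
  by split => /=; [move=> ? ? _ _|rewrite image_id; exact: openT].
split=> [_ ->//|_ _ -> ->|p]; first exact: compatible_refl.
by exists (Chart setT id).
Qed.

Lemma compact_closed_ball (n : nat) (x : 'rV[R]_n) (r : R) :
  compact [set w | `|w - x| <= r].
Proof.
apply: bounded_closed_compact.
  exists (r + `|x|); split; first exact: num_real.
  move=> y ry w /= wr; apply/ltW; apply: le_lt_trans ry.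
  by rewrite -[w](subrK x); apply: le_trans (ler_normD _ _) _; rewrite lerD2r.
rewrite (_ : mkset _ = (fun w => `|w - x|) @^-1` [set t | t <= r])//.
apply: closed_comp => [w _|]; last exact: closed_le.
apply: continuous_comp; last exact: norm_continuous.
apply: smooth_at_continuous; apply: smooth_atD; first exact: smooth_at_id.
exact: smooth_at_cst.
Qed.

End AffineManifold.

Section ChartTopology.
Variables (R : realType) (V : vectType R) (M : affineSpace V).
Variable P : atlasSpace M.
Hypothesis aP : is_atlas P.
Implicit Types (c : chart P M) (p : P).

Lemma ccoord_continuous c p : admissible c -> cdom c p -> {for p, continuous (ccoord c)}.
Proof.
by move=> ac cp B nB; apply: filterS (near_chart_in aP ac cp nB) => q [].
Qed.

Lemma cinv_continuous c p p0 : admissible c -> cdom c p ->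
  {for ccoord c p, continuous (cinv c p0)}.
Proof.
move=> ac cp B; have [ic _] := ac; rewrite cinvK// => nB.
exact: (iffLR (near_chart aP p0 B ac cp) nB).
Qed.

Lemma compact_cinv c p0 (K : set 'rV[R]_(\dim {:V})) : admissible c -> compact K ->
  (forall w, K w -> exists2 p, cdom c p & ccoord c p = w) ->
  compact (cinv c p0 @` K).
Proof.
move=> ac cK KH; apply: continuous_compact => //.
apply: continuous_in_subspaceT => w; rewrite inE => /KH[p cp <-].
exact: cinv_continuous.
Qed.

End ChartTopology.

Lemma compact_chart_preimage (R : realType) (V : vectType R) (M : affineSpace V)
    (P : atlasSpace M) (c : chart P M) (K : set 'rV[R]_(\dim {:V})) :
  is_atlas P -> admissible c -> compact K ->
  (forall w, K w -> exists2 p, cdom c p & ccoord c p = w) ->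
  compact [set p | cdom c p /\ K (ccoord c p)].
Proof.
move=> aP ac cK KH; have [[p0 _]|nP] := pselect (exists p : P, True); last first.
  rewrite (_ : [set _ | _] = set0); first exact: compact0.
  by apply/seteqP; split=> // p; case: nP; exists p.
have [ic _] := ac.
rewrite (_ : [set _ | _] = cinv c p0 @` K); first exact: compact_cinv.
apply/seteqP; split=> [q [cq xq]|_ [w xw <-]].
  by exists (ccoord c q) => //; rewrite cinvK.
by have [p cp pw] := KH w xw; rewrite -pw cinvK//; split=> //; rewrite pw.
Qed.

Section AffineManifoldIsManifold.
Variables (R : realType) (V : vectType R) (M : affineSpace V).

Lemma affmfd_is_manifold : is_manifold (affmfd M).
Proof.
have aM := affmfd_is_atlas M.
pose c : chart (affmfd M) M := Chart setT id.
have ac : admissible c by apply: atlas_admissible.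
have cc : continuous (ccoord c) by move=> p; exact: ccoord_continuous.
have hM : hausdorff_space (affmfd M).
  apply: hausdorff_injective (@norm_hausdorff _ _) cc _.
  by move=> p q; apply: ccoord_inj; case: ac.
split=> //.
pose B r := [set w : 'rV[R]_(\dim {:V}) | `|w - 0| <= r].
have cL n : compact (cinv c (aff_origin M : affmfd M) @` B n%:R).
  apply: compact_cinv => // [|w _]; first exact: compact_closed_ball.
  by exists (aff_param (aff_origin M) w : affmfd M) => //; exact: aff_paramK.
apply: (@paracompact_sigma_compact _ unit (fun=> tt)
  (fun _ n => ccoord c @^-1` (ball 0 n%:R))
  (fun _ n => cinv c (aff_origin M : affmfd M) @` B n%:R)).
- move=> []; rewrite (_ : mkset _ = setT); first exact: openT.
  by apply/funext => p; apply/propext; split.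
- move=> _ n; split=> //.
  + by apply: open_comp => [p _|]; [exact: cc|exact: ball_open].
  + exact: compact_closed.
  + move=> p /= /ballrV/ltW Bp; exists (ccoord c p) => //.
    by rewrite cinvK//; case: ac.
- move=> p; exists (Num.bound `|ccoord c p|); apply/ballrV; rewrite subr0.
  exact: archi_boundP.
Qed.

End AffineManifoldIsManifold.

(** * Open submanifolds and products *)

Section Submanifold.
Variables (R : realType) (V : vectType R) (M : affineSpace V).
Variables (P : atlasSpace M) (U : set P).
Hypotheses (aP : is_atlas P) (oU : open U).

Definition sub_chart (c : chart P M) : chart (submfd U) M :=
  Chart (sval @^-1` cdom c) (c \o sval).

Lemma sub_chart_image (c : chart P M) (A : set P) :
  sub_chart c @` (sval @^-1` A) = c @` (U `&` A).
Proof.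
apply/seteqP; split=> [_ [p Ap <-]|_ [p [Up Ap] <-]].
  by exists (sval p) => //; split=> //; exact: (svalP p).
by exists (exist _ p Up).
Qed.

Lemma sub_chart_is_chart c : admissible c -> is_chart (sub_chart c).
Proof.
move=> ac; have [[inj oc] _] := ac; split.
  move=> p q; rewrite !inE => cp cq /inj pq.
  have {}pq : sval p = sval q by apply: pq; rewrite inE.
  by case: p q pq {cp cq} => p Up [q Uq] /= pq; exact: eq_exist.
by rewrite [X in X @` _]/= sub_chart_image; exact: open_chart_image.
Qed.

Lemma sub_chart_transition (c d : chart P M) : admissible c -> admissible d ->
  smooth_transition c d -> smooth_transition (sub_chart c) (sub_chart d).
Proof.
move=> ac ad [oW [h hE hs]].
have WE : sub_chart c @` (cdom (sub_chart c) `&` cdom (sub_chart d)) =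
    c @` ((U `&` cdom d) `&` cdom c).
  by rewrite -preimage_setI sub_chart_image setIA setIAC.
split.
  rewrite WE; apply: open_chart_image => //; apply: openI => //; exact: open_cdom.
exists h => [p cp dp|]; first exact: hE.
rewrite WE => o'; apply: smooth_on_sub (hs o') => _ [p [[Up dp] cp] <-].
by exists p.
Qed.

Lemma admissible_transition (c d : chart P M) : admissible c -> admissible d ->
  smooth_transition c d.
Proof.
move=> ac ad; have [[ic _] [id' _]] := (ac, ad).
have oW : open (c @` (cdom c `&` cdom d)).
  by rewrite setIC; apply: open_chart_image => //; exact: open_cdom.
split=> //; have [[p0 _]|nP] := pselect (exists p : P, True); last first.
  exists (fun=> aff_origin M) => [p|o']; first by case: nP; exists p.
  by exists setT; split=> [||o k]; [exact: openT|by []|exact: Ck_cst].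
exists (fun y => d (cinv c p0 (aff_coord (aff_origin M) y))) => [p cp dp|].
  by rewrite -[aff_coord _ _]/(ccoord c p) cinvK.
apply/(smooth_on_affP (aff_origin M) (aff_origin M)) => // _ [p [cp dp] <-].
apply: smooth_at_ext (smooth_transition_admissible aP p0 ac ad cp dp) => w.
by rewrite /= aff_paramK.
Qed.

Lemma sub_chart_compatible (c d : chart P M) : admissible c -> admissible d ->
  compatible (sub_chart c) (sub_chart d).
Proof.
by move=> ac ad; split; apply: sub_chart_transition => //; exact: admissible_transition.
Qed.

Lemma submfd_is_atlas : is_atlas (submfd U).
Proof.
split=> [_ [d dP ->]|_ _ [c cP ->] [d dP ->]|p].
- exact/sub_chart_is_chart/atlas_admissible.
- by apply: sub_chart_compatible; exact: atlas_admissible.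
- have [c cP cp] := ex_chart aP (sval p).
  by exists (sub_chart c) => //; exists c.
Qed.

Lemma sub_chart_admissible c : admissible c -> admissible (sub_chart c).
Proof.
move=> ac; split=> [|_ [d dP ->]]; first exact: sub_chart_is_chart.
by apply: sub_chart_compatible => //; exact: atlas_admissible.
Qed.

Lemma sval_continuous : continuous (sval : submfd U -> P).
Proof.
move=> p B nB; have [c cP cp] := ex_chart aP (sval p).
have ac := atlas_admissible aP cP; have [ic _] := ac.
have as' := sub_chart_admissible ac; have [is' _] := as'.
apply/(near_chart submfd_is_atlas p _ as' cp).
have : \forall w \near ccoord c (sval p), B (cinv c (sval p) w).
  exact: (iffLR (near_chart aP (sval p) B ac cp) nB).
have := near_ccoordK p as' cp.
rewrite -[ccoord (sub_chart c) p]/(ccoord c (sval p)).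
apply: filterS2 => w [cw wE].
by rewrite -{1}wE -[ccoord (sub_chart c) _]/(ccoord c (sval _)) cinvK.
Qed.

End Submanifold.

Section Functionals.
Variables (R : realType) (V : vectType R) (M : affineSpace V).

Lemma smooth_at_functional n (l : V -> R) (f : 'rV[R]_n -> V) w :
  linear_for *%R l -> (forall i, smooth_at (fun z => coord (vbasis {:V}) i (f z)) w) ->
  smooth_at (fun z => l (f z)) w.
Proof.
move=> ll sf.
pose l' : {scalar V} := HB.pack l (GRing.isLinear.Build R V R *%R l ll).
have lE z : l (f z) = \sum_i coord (vbasis {:V}) i (f z) * l (vbasis {:V})`_i.
  rewrite {1}(coord_vbasis (memvf (f z))) -[l _]/(l' _) linear_sum.
  by apply: eq_bigr => i _; rewrite linearZ.
apply: (smooth_at_ext (fun z => esym (lE z))).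
by apply: smooth_at_sum => i; apply: smooth_atM => //; exact: smooth_at_cst.
Qed.

Lemma smooth_at_vecof (l : V -> R) w :
  linear_for *%R l -> smooth_at (fun z => l (passmx.vecof (vbasis {:V}) z)) w.
Proof.
move=> ll; apply: smooth_at_functional => // i.
apply: smooth_at_ext (smooth_at_coord i w) => z.
by rewrite passmx.coord_vecof// vbasisP.
Qed.

Lemma aff_coordE (o x : M) i : aff_coord o x 0 i = coord (vbasis {:V}) i (vsub x o).
Proof. by rewrite /aff_coord -passmx.coord_rVof// vbasisP. Qed.

Lemma smooth_at_origin n (o o' : M) (f : 'rV[R]_n -> M) w :
  smooth_at (fun z => aff_coord o (f z)) w -> smooth_at (fun z => aff_coord o' (f z)) w.
Proof.
move=> sf; apply: smooth_at_ext (smooth_atD sf (smooth_at_cst (aff_coord o' o) w)) => z.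
by rewrite [RHS](aff_coord_shift o).
Qed.

End Functionals.

Section ProductManifold.
Variables (R : realType) (V V' : vectType R).
Variables (M : affineSpace V) (N : affineSpace V').
Implicit Types (oM : M) (oN : N) (oMN : affprod M N).

(** The basis [vbasis] of V * V' need not come from bases of the factors, so each coordinate of a
    pair is treated as a sum of two linear functionals, one on each factor. *)
Lemma smooth_at_pair n (f : 'rV[R]_n -> affprod M N) oM oN oMN w :
  smooth_at (fun z => aff_coord oM (f z).1) w ->
  smooth_at (fun z => aff_coord oN (f z).2) w ->
  smooth_at (fun z => aff_coord oMN (f z)) w.
Proof.
move=> /(smooth_at_origin oMN.1) s1 /(smooth_at_origin oMN.2) s2.
apply: smooth_at_row => j; pose e := vbasis {: (V * V')%type}.
have l1 : linear_for *%R (fun v : V => coord e j (v, 0)).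
  move=> a u v; rewrite (_ : (_, _) = a *: (u, 0) + (v, 0)) ?linearP//.
  by congr (_, _); rewrite /= scaler0 addr0.
have l2 : linear_for *%R (fun v : V' => coord e j (0, v)).
  move=> a u v; rewrite (_ : (_, _) = a *: (0, u) + (0, v)) ?linearP//.
  by congr (_, _); rewrite /= scaler0 addr0.
apply: (@smooth_at_ext _ _ _ (fun z => coord e j (vsub (f z).1 oMN.1, 0) +
    coord e j (0, vsub (f z).2 oMN.2))).
  move=> z; rewrite aff_coordE -linearD; congr (coord _ _ (_, _)); rewrite /=.
    by rewrite addr0.
  by rewrite add0r.
apply: smooth_atD.
  apply: (smooth_at_functional l1) => i.
  apply: smooth_at_ext (smooth_at_rowE i s1) => z; exact: aff_coordE.
apply: (smooth_at_functional l2) => i.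
apply: smooth_at_ext (smooth_at_rowE i s2) => z; exact: aff_coordE.
Qed.

Lemma smooth_at_fst oM oMN w : smooth_at (fun z => aff_coord oM (aff_param oMN z).1) w.
Proof.
apply: (@smooth_at_origin _ _ _ _ oMN.1); apply: smooth_at_row => j.
apply: (@smooth_at_ext _ _ _
  (fun z => coord (vbasis {:V}) j (passmx.vecof (vbasis {: (V * V')%type}) z).1)).
  by move=> z; rewrite aff_coordE /aff_param /= vaddK.
apply: (@smooth_at_vecof _ _ (fun v => coord (vbasis {:V}) j v.1)) => a u v.
by rewrite -[(_ + _).1]/(_ *: _ + _) linearP.
Qed.

Lemma smooth_at_snd oN oMN w : smooth_at (fun z => aff_coord oN (aff_param oMN z).2) w.
Proof.
apply: (@smooth_at_origin _ _ _ _ oMN.2); apply: smooth_at_row => j.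
apply: (@smooth_at_ext _ _ _
  (fun z => coord (vbasis {:V'}) j (passmx.vecof (vbasis {: (V * V')%type}) z).2)).
  by move=> z; rewrite aff_coordE /aff_param /= vaddK.
apply: (@smooth_at_vecof _ _ (fun v => coord (vbasis {:V'}) j v.2)) => a u v.
by rewrite -[(_ + _).2]/(_ *: _ + _) linearP.
Qed.

Lemma open_affprod (A : set M) (B : set N) : open A -> open B ->
  open (A `*` B : set (affprod M N)).
Proof.
move=> oA oB; pose oM := aff_origin M; pose oN := aff_origin N.
pose oMN : affprod M N := (oM, oN); apply: (@open_affP _ _ _ oMN).
rewrite (_ : _ @^-1` _ =
  (fun z => aff_coord oM (aff_param oMN z).1) @^-1` (aff_param oM @^-1` A) `&`
  (fun z => aff_coord oN (aff_param oMN z).2) @^-1` (aff_param oN @^-1` B)).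
  apply: openI; apply: open_comp => [w _|]; [|exact: oA| |exact: oB].
    exact/smooth_at_continuous/smooth_at_fst.
  exact/smooth_at_continuous/smooth_at_snd.
by apply/funext => z; rewrite /preimage /setX /setI /= !aff_coordK.
Qed.

Variables (P : atlasSpace M) (Q : atlasSpace N).

Definition prod_chart (c : chart P M) (d : chart Q N) : chart (prodmfd P Q) (affprod M N) :=
  Chart (cdom c `*` cdom d) (fun p => (c p.1, d p.2)).

Lemma prod_chart_is_chart c d : is_chart c -> is_chart d -> is_chart (prod_chart c d).
Proof.
move=> [ci co] [di do']; split.
  move=> [p q] [p' q']; rewrite !inE => -[/= cp dq] [/= cp' dq'] [pp' qq'].
  by congr (_, _); [apply: ci|apply: di]; rewrite ?inE.
rewrite (_ : _ @` _ = (c @` cdom c) `*` (d @` cdom d)); first exact: open_affprod.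
apply/seteqP; split=> [_ [[p q] [/= cp dq] <-]|[x y] /= [[p cp <-] [q dq <-]]].
  by split; [exists p|exists q].
by exists (p, q).
Qed.

Lemma prod_chart_transition (c c' : chart P M) (d d' : chart Q N) :
  smooth_transition c c' -> smooth_transition d d' ->
  smooth_transition (prod_chart c d) (prod_chart c' d').
Proof.
move=> [oW [h hE hs]] [oW' [h' hE' hs']].
have WE : prod_chart c d @` (cdom (prod_chart c d) `&` cdom (prod_chart c' d')) =
  (c @` (cdom c `&` cdom c')) `*` (d @` (cdom d `&` cdom d')).
  apply/seteqP; split=> [_ [[p q] [[/= cp dq] [/= c'p d'q]] <-]|[x y] /=].
    by split; [exists p|exists q].
  by move=> [[p [cp c'p] <-] [q [dq d'q] <-]]; exists (p, q).
split; rewrite WE; first exact: open_affprod.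
exists (fun x => (h x.1, h' x.2)) => [[p q] [/= cp dq] [/= c'p d'q]|].
  by rewrite hE// hE'.
pose oM := aff_origin M; pose oN := aff_origin N; pose oMN := aff_origin (affprod M N).
apply/(smooth_on_affP oMN oMN); first exact: open_affprod.
move=> [x y] [/= Wx Wy]; apply: (@smooth_at_pair _ _ oM oN).
  have := @smooth_at_vcomp _ _ _ _ _ (aff_coord oM \o h \o aff_param oM) _
    (smooth_at_fst oM oMN (aff_coord oMN (x, y))).
  rewrite aff_coordK => /(_ (iffLR (smooth_on_affP _ _ _ oW) hs _ Wx)).
  by apply: smooth_at_ext => z; rewrite /= aff_coordK.
have := @smooth_at_vcomp _ _ _ _ _ (aff_coord oN \o h' \o aff_param oN) _
  (smooth_at_snd oN oMN (aff_coord oMN (x, y))).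
rewrite aff_coordK => /(_ (iffLR (smooth_on_affP _ _ _ oW') hs' _ Wy)).
by apply: smooth_at_ext => z; rewrite /= aff_coordK.
Qed.

Hypotheses (aP : is_atlas P) (aQ : is_atlas Q).

Lemma prodmfd_is_atlas : is_atlas (prodmfd P Q).
Proof.
have [aP1 aP2 aP3] := aP; have [aQ1 aQ2 aQ3] := aQ.
split=> [_ [c [d [cP dQ ->]]]|_ _ [c [d [cP dQ ->]]] [c' [d' [cP' dQ' ->]]]|[p q]].
- by apply: prod_chart_is_chart; [exact: aP1|exact: aQ1].
- have [t1 t2] := aP2 _ _ cP cP'; have [t3 t4] := aQ2 _ _ dQ dQ'.
  by split; exact: prod_chart_transition.
- have [c cP cp] := aP3 p; have [d dQ dq] := aQ3 q.
  by exists (prod_chart c d) => //; exists c, d.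
Qed.

End ProductManifold.

(** * Bump functions on a manifold *)

Section ManifoldBump.
Variables (R : realType) (V : vectType R) (M : affineSpace V).
Variable P : atlasSpace M.
Hypotheses (aP : is_atlas P) (hP : hausdorff_space P).
Implicit Types (c : chart P M) (p q : P).

Lemma smooth_near_locally_constant T (b : P -> T) (g : T -> R) p :
  (\forall q \near p, b q = b p) -> smooth_near (g \o b) p.
Proof.
move=> nb; apply: (smooth_near_near aP _ (smooth_near_cst aP (g (b p)) p)).
by apply: filterS nb => q /= ->.
Qed.

Definition chart_bump c (x : 'rV[R]_(\dim {:V})) r q : R :=
  if `[< cdom c q >] then cube_bump x r (ccoord c q) else 0.

Definition chart_ball c (x : 'rV[R]_(\dim {:V})) r : set P :=
  [set q | cdom c q /\ `|ccoord c q - x| <= 2 * r].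

Lemma chart_bump_ge0 c x r q : 0 <= chart_bump c x r q.
Proof. by rewrite /chart_bump; case: ifP => // _; exact: bump_ge0. Qed.

Lemma chart_bump_le1 c x r q : chart_bump c x r q <= 1.
Proof. by rewrite /chart_bump; case: ifP => // _; exact: bump_le1. Qed.

Lemma chart_bump_support c x r q : 0 < r -> chart_bump c x r q != 0 -> chart_ball c x r q.
Proof.
rewrite /chart_bump => r0; case: ifPn => [/asboolP cq|]; last by rewrite eqxx.
by move=> /(bump_support r0).
Qed.

Lemma chart_bump1 c x r p : admissible c -> cdom c p -> 0 < r -> ball x r (ccoord c p) ->
  \forall q \near p, chart_bump c x r q = 1.
Proof.
move=> ac cp r0 xp; have nb : nbhs (ccoord c p) (ball x r).
  by apply: open_nbhs_nbhs; split=> //; exact: ball_open.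
apply: filterS (near_chart_in aP ac cp nb) => q [cq xq].
by rewrite /chart_bump asboolT// bump1.
Qed.

Section InChart.
Variables (c : chart P M) (x : 'rV[R]_(\dim {:V})) (r : R).
Hypotheses (ac : admissible c) (r0 : 0 < r)
  (cx : forall w, `|w - x| <= 2 * r -> exists2 p, cdom c p & ccoord c p = w).

Lemma compact_chart_ball : compact (chart_ball c x r).
Proof.
apply: (compact_chart_preimage (K := [set w | `|w - x| <= 2 * r])) => //.
exact: compact_closed_ball.
Qed.

(** The Hausdorff property enters here: the compact [chart_ball] is closed, so that the extension by
    0 vanishes near every point outside the chart domain. *)
Lemma chart_bump_smooth : chart_bump c x r \in smooth_pred P.
Proof.
apply/(smooth_funP aP) => p; have [cp|ncp] := pselect (cdom c p).
  apply: (smooth_near_near aP (f := cube_bump x r \o ccoord c)).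
    by apply: filterS (near_cdom aP ac cp) => q cq; rewrite /chart_bump asboolT.
  apply: smooth_near_comp => // [j|]; first exact: smooth_near_coord.
  exact: smooth_at_bump.
have oL : open (~` chart_ball c x r).
  exact: (closed_openC (compact_closed hP compact_chart_ball)).
apply: (smooth_near_near aP _ (smooth_near_cst aP 0 p)).
apply: filterS (open_nbhs_nbhs (conj oL _)) => [q nq|[]//].
by apply/esym/eqP/negPn/negP => /(chart_bump_support r0).
Qed.

End InChart.

Lemma ex_chart_ball c p (B : set P) : admissible c -> cdom c p -> nbhs p B ->
  exists r, [/\ 0 < r, chart_ball c (ccoord c p) r `<=` B &
    forall w, `|w - ccoord c p| <= 2 * r -> exists2 q, cdom c q & ccoord c q = w].
Proof.
move=> ac cp nB.
have : \forall w \near ccoord c p, B (cinv c p w) /\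
    cdom c (cinv c p w) /\ ccoord c (cinv c p w) = w.
  apply: filterI; first exact: (iffLR (near_chart aP p B ac cp) nB).
  exact: near_ccoordK.
move=> /nbhs_ballP[r /= r0 rB]; have r4 : 0 < r / 4 by rewrite divr_gt0.
have lr w : `|w - ccoord c p| <= 2 * (r / 4) -> ball (ccoord c p) r w.
  move=> H; apply/ballrV; apply: le_lt_trans H _; lra.
exists (r / 4); split=> // [q [cq /lr/rB[Bq _]]|w /lr/rB[_ [cw wE]]].
  by have [ic _] := ac; rewrite cinvK in Bq.
by exists (cinv c p w).
Qed.

Lemma ex_bump p (B : set P) : nbhs p B -> exists chi : P -> R,
  [/\ chi \in smooth_pred P, \forall q \near p, chi q = 1 & forall q, ~ B q -> chi q = 0].
Proof.
move=> nB; have [c cP cp] := ex_chart aP p; have ac := atlas_admissible aP cP.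
have [r [r0 rB rc]] := ex_chart_ball ac cp nB.
exists (chart_bump c (ccoord c p) r); split; first exact: chart_bump_smooth.
  by apply: chart_bump1 => //; exact: ballxx.
move=> q nBq; apply/eqP/negPn/negP => /(chart_bump_support r0)/rB; exact: nBq.
Qed.

Lemma smooth_separates p q : (forall f : Cinf P, f p = f q) -> p = q.
Proof.
move=> H; apply: hP => A B nA nB; have [chi [schi chi1 chi0]] := ex_bump nA.
exists q; split; last exact: nbhs_singleton.
apply: contrapT => nAq; have := H (MkCinf schi).
rewrite /= (nbhs_singleton chi1) chi0//; move/eqP; rewrite oner_eq0//.
Qed.

End ManifoldBump.

(** * Characters of the algebra of smooth functions *)

Section Evaluation.
Variables (R : realType) (V : vectType R) (M : affineSpace V).
Variable P : atlasSpace M.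

(* All that the evaluation theorem uses of P. A space with a global chart has
   this property whatever its cardinal, with a single piece. *)
Definition exhaustible : Prop :=
  exists (I : Type) (b : P -> I) (chi : nat -> P -> R),
  [/\ nonmeasurable I, forall i, open [set p | b p = i],
      forall n, chi n \in smooth_pred P /\ forall p, 0 <= chi n p <= 1,
      forall p : P, exists n, \forall q \near p, chi n q = 1 &
      forall i n, exists2 L : set P, compact L & forall q, b q = i -> chi n q != 0 -> L q].

Hypotheses (aP : is_atlas P).

Section Morphism.
Variable phi : Cinf P -> R.
Hypotheses (phi1 : phi 1 = 1) (phiB : forall f g, phi (f - g) = phi f - phi g)
  (phiM : forall f g, phi (f * g) = phi f * phi g)
  (phiZ : forall (r : R) f, phi (r *: f) = r * phi f).
Implicit Types f g : Cinf P.

Lemma phi0 : phi 0 = 0. Proof. by rewrite -(subrr 0) phiB subrr. Qed.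

Lemma phiD f g : phi (f + g) = phi f + phi g.
Proof.
have phiN : phi (- g) = - phi g by rewrite -sub0r phiB phi0 sub0r.
by rewrite -{1}[g]opprK phiB phiN opprK.
Qed.

Lemma phi_sum (T : Type) (s : seq T) (F : T -> Cinf P) :
  phi (\sum_(x <- s) F x) = \sum_(x <- s) phi (F x).
Proof. exact: (big_morph phi phiD phi0). Qed.

Lemma cinfD f g p : (f + g) p = f p + g p. Proof. by []. Qed.
Lemma cinfB f g p : (f - g) p = f p - g p. Proof. by []. Qed.
Lemma cinfM f g p : (f * g) p = f p * g p. Proof. by []. Qed.
Lemma cinfZ (r : R) f p : (r *: f) p = r * f p. Proof. by []. Qed.
Lemma cinf1 p : (1 : Cinf P) p = 1. Proof. by []. Qed.
Lemma cinf0 p : (0 : Cinf P) p = 0. Proof. by []. Qed.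

Lemma cinf_sum (T : Type) (s : seq T) (F : T -> Cinf P) p :
  (\sum_(x <- s) F x) p = \sum_(x <- s) F x p.
Proof. exact: (big_morph (fun f : Cinf P => f p) (fun f g => cinfD f g p) (cinf0 p)). Qed.

(** A nowhere vanishing smooth function is invertible, and a unital morphism cannot kill it. The
    arguments below all build one function killed by phi whose zeros say enough. *)
Lemma phi_zero f : phi f = 0 -> exists p, f p = 0.
Proof.
move=> f0; apply: contrapT => nf.
have nz p : f p != 0 by apply/eqP => fp; apply: nf; exists p.
have sV : (fun p => (f p)^-1) \in smooth_pred P.
  apply/(smooth_funP aP) => p; apply: smooth_nearV => //.
  exact: (iffLR (smooth_funP aP f) (cinfP f)).
have : MkCinf sV * f = 1.
  by apply: val_inj; apply/funext => p; rewrite /= -[LHS]/(_^-1 * _) mulVf.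
by move=> /(congr1 phi); rewrite phiM f0 mulr0 phi1 => /eqP; rewrite eq_sym oner_eq0.
Qed.

(** The function f - phi f is killed, hence has a zero: phi f is a value of f. *)
Lemma phi_ge0 f : (forall p, 0 <= f p) -> 0 <= phi f.
Proof.
move=> fge0; rewrite leNgt; apply/negP => fn.
have [|p] := @phi_zero (f - phi f *: (1 : Cinf P)); first by rewrite phiB phiZ phi1 mulr1 subrr.
rewrite cinfB cinfZ cinf1 mulr1 => /eqP; rewrite subr_eq0 => /eqP fp.
by have := fge0 p; rewrite fp leNgt fn.
Qed.

Lemma phi_mulr f g : phi f = 0 -> phi (f * g) = 0.
Proof. by move=> f0; rewrite phiM f0 mul0r. Qed.

Section Exhaustion.
Variables (chi : nat -> P -> R).
Hypotheses (chi_smooth : forall n, chi n \in smooth_pred P)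
  (chi01 : forall n p, 0 <= chi n p <= 1)
  (chi_cover : forall p : P, exists n, \forall q \near p, chi n q = 1).

Let cchi n : Cinf P := MkCinf (chi_smooth n).

(** A partition of unity obtained by telescoping, without division: the partial sums are 1 minus the
    product of the 1 - chi k, and where chi m = 1 all terms after the m-th vanish. *)
Definition partition_step n : Cinf P := cchi n * \prod_(k < n) (1 - cchi k).
Local Notation psi := partition_step.

Lemma psiE n p : psi n p = chi n p * \prod_(k < n) (1 - chi k p).
Proof.
rewrite cinfM; congr (_ * _).
exact: (big_morph (fun f : Cinf P => f p) (fun f g => cinfM f g p) (cinf1 p)).
Qed.

Opaque partition_step.

Lemma psi_ge0 n p : 0 <= psi n p.
Proof.
rewrite psiE mulr_ge0//; first by case/andP: (chi01 n p).
by apply: prodr_ge0 => k _; rewrite subr_ge0; case/andP: (chi01 k p).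
Qed.

Lemma psi_eq0 n m p : chi m p = 1 -> (m < n)%N -> psi n p = 0.
Proof.
move=> m1 mn; rewrite psiE (bigD1 (Ordinal mn))//= m1 subrr mul0r mulr0//.
Qed.

Lemma psi_sum n p : \sum_(k < n) psi k p = 1 - \prod_(k < n) (1 - chi k p).
Proof.
elim: n => [|n IH]; first by rewrite !big_ord0 subrr.
rewrite big_ord_recr [in RHS]big_ord_recr IH [X in _ + X = _]psiE /=; ring.
Qed.

Lemma psi_sum_cut (a : nat -> R) m n p : chi m p = 1 -> (m < n)%N ->
  \sum_(k < n) a k * psi k p = \sum_(k < m.+1) a k * psi k p.
Proof.
move=> m1 mn; rewrite -(big_mkord xpredT (fun k => a k * psi k p)).
rewrite (@big_cat_nat _ _ _ m.+1)//= [X in _ + X]big_nat_cond [X in _ + X]big1 ?addr0.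
  by rewrite big_mkord.
by move=> k /andP[/andP[mk _] _]; rewrite (psi_eq0 m1 mk) mulr0.
Qed.

(* Otherwise the exhaustion function [rho], the sum of the [n * psi n], would
   have a value under [phi] above every n. *)
Lemma ex_chi_neq0 : exists n, phi (cchi n) != 0.
Proof.
apply: contrapT => H.
have chi0 n : phi (cchi n) = 0 by apply: contrapT => /eqP n0; apply: H; exists n.
have psi0 n : phi (psi n) = 0 by exact: phi_mulr.
have /choice[m Hm] := chi_cover.
(* The bound varies with p, but every larger one gives the same value; near p a single finite sum
   therefore represents rho, which is smooth. *)
pose rho p := \sum_(k < (m p).+1) k%:R * psi k p.
have rhoE n p : (m p < n)%N -> rho p = \sum_(k < n) k%:R * psi k p.
  by move=> mn; rewrite (psi_sum_cut _ _ mn)// (nbhs_singleton (Hm p)).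
have srho : rho \in smooth_pred P.
  apply/(smooth_funP aP) => p.
  pose f : Cinf P := \sum_(k < (m p).+1) k%:R *: psi k.
  apply: (smooth_near_near aP (f := f)); last exact: (iffLR (smooth_funP aP f) (cinfP f)).
  apply: filterS (Hm p) => q mq.
  have fE n : (m p < n)%N -> f q = \sum_(k < n) k%:R * psi k q.
    by move=> mn; rewrite (psi_sum_cut _ mq mn) /f cinf_sum.
  pose N := (maxn (m p) (m q)).+1.
  by rewrite (fE N) ?(rhoE N)// ltnS ?leq_maxl ?leq_maxr.
have ge n : n%:R <= phi (MkCinf srho).
  (* As the psi k add up to 1, g is the sum of the (k - n) psi k with k >= n, hence nonnegative; as
     phi kills each psi k, its value on g is phi rho - n. *)
  pose g : Cinf P := MkCinf srho - n%:R *: (1 : Cinf P) - \sum_(k < n) (k%:R - n%:R) *: psi k.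
  have : 0 <= phi g.
    apply: phi_ge0 => p; rewrite !cinfB cinfZ cinf1 mulr1 cinf_sum.
    set N := (maxn (m p) n).+1.
    have mN : (m p < N)%N by rewrite ltnS leq_maxl.
    have nN : (n <= N)%N by rewrite ltnW// ltnS leq_maxr.
    have s1 : \sum_(k < N) psi k p = 1.
      rewrite psi_sum (bigD1 (Ordinal mN))//= (nbhs_singleton (Hm p)).
      by rewrite subrr mul0r subr0.
    rewrite -[MkCinf srho p]/(rho p) (rhoE N)//.
    have -> : \sum_(k < N) k%:R * psi k p - n%:R = \sum_(k < N) (k%:R - n%:R) * psi k p.
      under [RHS]eq_bigr do rewrite mulrBl.
      by rewrite sumrB -mulr_sumr s1 mulr1.
    rewrite -(big_mkord xpredT (fun k => (k%:R - n%:R) * psi k p)).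
    rewrite (@big_cat_nat _ _ _ n)//= big_mkord addrAC subrr add0r.
    rewrite big_nat_cond; apply: sumr_ge0 => k /andP[/andP[nk _] _].
    by rewrite mulr_ge0 ?psi_ge0// subr_ge0 ler_nat.
  rewrite /g !phiB phiZ phi1 mulr1 phi_sum big1 ?subr0 ?subr_ge0// => k _.
  by rewrite phiZ psi0 mulr0.
have := ge (Num.bound `|phi (MkCinf srho)|); rewrite leNgt.
by rewrite (le_lt_trans (ler_norm _) (archi_boundP (normr_ge0 _))).
Qed.

End Exhaustion.

Section Pieces.
Variables (I : Type) (b : P -> I).
Hypotheses (ob : forall i, open [set p | b p = i]).

Lemma smooth_piecewise (g : I -> R) : g \o b \in smooth_pred P.
Proof.
apply/(smooth_funP aP) => p; apply: smooth_near_locally_constant => //.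
have : (b @^-1` [set b p]) p by [].
by move=> bp; apply: open_nbhs_nbhs; split=> //; exact: ob.
Qed.

Definition piecewise (g : I -> R) : Cinf P := MkCinf (smooth_piecewise g).

Definition pieces_indicator (J : set I) : Cinf P := piecewise (\1_J).
Local Notation e_ := pieces_indicator.

Lemma pieces_indicatorE J p : e_ J p = (b p \in J)%:R.
Proof. by rewrite /= indicE. Qed.

Lemma phi_indicator J : phi (e_ J) = 1 \/ phi (e_ J) = 0.
Proof.
have : e_ J * e_ J = e_ J.
  apply: val_inj; apply/funext => p; rewrite -[LHS]/(e_ J p * e_ J p) -[RHS]/(e_ J p).
  by rewrite !pieces_indicatorE; case: (_ \in _); rewrite ?mulr1 ?mulr0.
move=> /(congr1 phi); rewrite phiM => /eqP.
rewrite -subr_eq0 -[X in _ - X]mulr1 -mulrBr mulf_eq0 subr_eq0.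
by case/orP => /eqP ->; [right|left].
Qed.

Lemma phi_indicatorC J : phi (e_ (~` J)) = 1 - phi (e_ J).
Proof.
rewrite -phi1 -phiB; congr phi; apply: val_inj; apply/funext => p.
rewrite -[RHS]/(1 - e_ J p) -[LHS]/(e_ (~` J) p) !pieces_indicatorE in_setC.
by case: (_ \in _); rewrite ?subr0 ?subrr.
Qed.

Lemma phi_indicatorI J K : phi (e_ (J `&` K)) = phi (e_ J) * phi (e_ K).
Proof.
rewrite -phiM; congr phi; apply: val_inj; apply/funext => p.
rewrite -[RHS]/(e_ J p * e_ K p) -[LHS]/(e_ (J `&` K) p) !pieces_indicatorE in_setI.
by rewrite -natrM mulnb.
Qed.

(** On the functions constant on each piece, phi acts as a measure on I with values 0 and 1, of
    which these are the sets of measure 1. Nonmeasurability of I will concentrate it on one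
    piece. *)
Definition pieces_filter : set_system I := [set J | phi (e_ J) = 1].

Lemma pieces_filter_ultra : UltraFilter pieces_filter.
Proof.
have PF : ProperFilter pieces_filter.
  split; last split.
  - move=> H; have [|] := phi_zero (f := 1 - e_ set0).
      by rewrite phiB phi1 H subrr.
    by move=> p; rewrite cinfB cinf1 pieces_indicatorE in_set0 subr0 => /eqP; rewrite oner_eq0.
  - rewrite /pieces_filter /= -phi1; congr phi; apply: val_inj; apply/funext => p.
    by rewrite -[LHS]/(e_ setT p) pieces_indicatorE in_setT.
  - by move=> J K /= J1 K1; rewrite /pieces_filter /= phi_indicatorI J1 K1 mulr1.
  - move=> J K JK /= J1; have := phi_indicatorI J K.
    by rewrite /pieces_filter (_ : J `&` K = J) ?J1 ?mul1r//; exact/setIidPl.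
split=> // G PG FG; apply/seteqP; split=> [J GJ|]; last exact: FG.
have [//|J0] := phi_indicator J.
have : G (~` J) by apply: FG; rewrite /pieces_filter /= phi_indicatorC J0 subr0.
move=> GC; have : G set0 by rewrite -(setICr J); exact: filterI.
by move=> /filter_not_empty.
Qed.

(** If the intersection were null, let k i be the index of some G n missing i. The value of phi on k
    is attained, say as K. Then the indicator of the intersection, (k - K)^2 and the indicator of
    the complement of G K are all killed; a zero of their sum lies in G K, although k tells that G K
    misses it. *)
Lemma pieces_filter_complete (G : nat -> set I) :
  (forall n, pieces_filter (G n)) -> pieces_filter (\bigcap_n G n).
Proof.
move=> FG; have [//|H0] := phi_indicator (\bigcap_n G n).
have /choice[k Hk] (i : I) : exists k : nat, ~ (\bigcap_n G n) i -> ~ G k i.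
  have [Gi|] := pselect ((\bigcap_n G n) i); first by exists 0%N.
  by move=> /existsNP[n /not_implyP[_ nG]]; exists n.
pose f := piecewise (fun i => (k i)%:R).
pose f2 (c : R) := (f - c *: (1 : Cinf P)) * (f - c *: (1 : Cinf P)).
have f20 c : c = phi f -> phi (f2 c) = 0.
  by move=> ->; rewrite phiM phiB phiZ phi1 mulr1 subrr mul0r.
have f2E c p : f2 c p = ((k (b p))%:R - c) ^+ 2.
  by rewrite cinfM cinfB cinfZ cinf1 mulr1 expr2.
have [|p] := phi_zero (f := e_ (\bigcap_n G n) + f2 (phi f)).
  by rewrite phiD H0 f20 ?addr0.
rewrite cinfD f2E pieces_indicatorE => /eqP; rewrite paddr_eq0 ?sqr_ge0// sqrf_eq0 subr_eq0.
move=> /andP[_ /eqP kp].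
have [|q] := phi_zero (f := e_ (\bigcap_n G n) + f2 (phi f) + e_ (~` G (k (b p)))).
  have FG' : phi (e_ (G (k (b p)))) = 1 := FG _.
  by rewrite !phiD H0 f20// phi_indicatorC FG' subrr !addr0.
rewrite !cinfD f2E !pieces_indicatorE => /eqP.
rewrite !paddr_eq0 ?sqr_ge0 ?addr_ge0 ?sqr_ge0// sqrf_eq0 subr_eq0 -kp eqr_nat.
move=> /andP[/andP[nq /eqP kq] nG]; exfalso.
have nGq : ~ (\bigcap_n G n) (b q).
  by move=> Gq; move: nq; rewrite mem_set// oner_eq0.
have := Hk _ nGq; rewrite kq => nGk.
by move: nG; rewrite mem_set// oner_eq0.
Qed.

End Pieces.

Lemma phi_evaluation : exhaustible -> exists p, forall f, phi f = f p.
Proof.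
move=> [I [b [chi [nI ob chiP cover supp]]]].
have chi_smooth n : chi n \in smooth_pred P by have [] := chiP n.
have chi01 n p : 0 <= chi n p <= 1 by have [] := chiP n.
have [n phin] := ex_chi_neq0 chi_smooth chi01 cover.
have [i phii] := nI _ (pieces_filter_ultra ob) (@pieces_filter_complete _ _ ob).
have [L cL suppL] := supp i n.
apply: contrapT => H.
have /choice[f Hf] (p : P) : exists f : Cinf P, phi f = 0 /\ f p != 0.
  apply: contrapT => Hp; apply: H; exists p => g; apply: contrapT => gp.
  apply: Hp; exists (g - phi g *: (1 : Cinf P)); split.
    by rewrite phiB phiZ phi1 mulr1 subrr.
  by rewrite cinfB cinfZ cinf1 mulr1 subr_eq0; apply/eqP => e; apply: gp.
have [x Lx|s [sL Ls]] := compact_pointwise_cover (U := fun p => [set q | f p q != 0]) cL.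
  split; last by have [] := Hf x.
  rewrite openE => q /= fq.
  have /smooth_near_continuous cf := iffLR (smooth_funP aP (f x)) (cinfP _) q.
  exact: (cvgr_neq0 (f x q) (cf aP) fq).
set a := phi _ in phin.
(* A zero of g lies in the piece i and takes the value a <> 0 under chi n, so it belongs to L; yet
   all the f x vanish there, against the choice of s. *)
pose g : Cinf P := \sum_(x <- s) f x * f x +
  (MkCinf (chi_smooth n) - a *: (1 : Cinf P)) * (MkCinf (chi_smooth n) - a *: (1 : Cinf P)) +
  (1 - pieces_indicator ob [set i]).
have [q] : exists q, g q = 0.
  apply: phi_zero; rewrite !phiD phi_sum big1 => [|x _].
    have phii' : phi (pieces_indicator ob [set i]) = 1 := phii.
    have a0 : phi (MkCinf (chi_smooth n) - a *: (1 : Cinf P)) = 0.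
      by rewrite phiB phiZ phi1 mulr1 subrr.
    by rewrite phiM a0 mul0r -phiD phiB phi1 phii' subrr !addr0.
  by rewrite phiM; have [-> _] := Hf x; rewrite mul0r.
rewrite /g 2!cinfD cinf_sum cinfM !cinfB cinfZ cinf1 pieces_indicatorE mulr1 => /eqP.
have ge1 : 0 <= \sum_(x <- s) (f x * f x) q by apply: sumr_ge0 => x _; rewrite cinfM -expr2 sqr_ge0.
have ge3 : 0 <= 1 - (b q \in [set i])%:R :> R by case: (_ \in _); rewrite ?subrr ?subr0.
have key (x y z : R) : 0 <= x -> 0 <= y -> 0 <= z -> x + y + z == 0 ->
    [/\ x == 0, y == 0 & z == 0].
  move=> x0 y0 z0; rewrite paddr_eq0 ?addr_ge0// paddr_eq0//.
  by move=> /andP[/andP[-> ->] ->].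
rewrite -[_ * _]expr2 => /(key _ _ _ ge1 (sqr_ge0 _) ge3)[s0 c0 e0].
have bq : b q = i.
  by move: e0; case: (boolP (b q \in _)) => [|_]; [rewrite inE|rewrite subr0 oner_eq0].
move: c0; rewrite sqrf_eq0 subr_eq0 => /eqP cq.
have /Ls[x xs /= fxq] : L q by apply: suppL => //; rewrite -[chi n q]/(MkCinf (chi_smooth n) q) cq.
move: s0; rewrite psumr_eq0; last by move=> y _; rewrite cinfM -expr2 sqr_ge0.
by move=> /allP/(_ x xs); rewrite cinfM mulf_eq0 orbb (negbTE fxq).
Qed.

End Morphism.
End Evaluation.

(** * Exhaustions of manifolds and of global charts *)

Section ManifoldPieces.
Variables (R : realType) (V : vectType R) (M : affineSpace V).
Variable P : atlasSpace M.

(** [paracompact_blocks] is applied to coordinate balls of radius r p inside compact ones of radius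
    2 * r p; s i lists the centres needed for the piece i. *)
Lemma manifold_pieces : is_manifold P ->
  exists (c : P -> chart P M) (r : P -> R) (b : P -> P) (s : P -> nat -> P),
  [/\ forall p, [/\ admissible (c p), 0 < r p & forall w,
        `|w - ccoord (c p) p| <= 2 * r p -> exists2 q, cdom (c p) q & ccoord (c p) q = w],
      forall i, open [set p | b p = i] &
      forall q, exists n, cdom (c (s (b q) n)) q /\
        ball (ccoord (c (s (b q) n)) (s (b q) n)) (r (s (b q) n)) (ccoord (c (s (b q) n)) q)].
Proof.
move=> [aP hP pP].
have /choice[cr Hcr] (p : P) : exists cr : chart P M * R,
    [/\ admissible cr.1, cdom cr.1 p, 0 < cr.2 & forall w,
      `|w - ccoord cr.1 p| <= 2 * cr.2 -> exists2 q, cdom cr.1 q & ccoord cr.1 q = w].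
  have [c cP cp] := ex_chart aP p; have ac := atlas_admissible aP cP.
  have nT : nbhs p setT by exact: filterT.
  by have [r [r0 _ rc]] := ex_chart_ball aP ac cp nT; exists (c, r).
pose c p := (cr p).1; pose r p := (cr p).2.
pose O p := [set q | cdom (c p) q /\ ball (ccoord (c p) p) (r p) (ccoord (c p) q)].
have [p|b [s [ob sb]]] := paracompact_blocks (O := O)
    (L := fun p => chart_ball (c p) (ccoord (c p) p) (r p)) pP.
  have [ac cp r0 Hc] := Hcr p; split.
  - rewrite openE => q [cq qr].
    have nb : nbhs (ccoord (c p) q) (ball (ccoord (c p) p) (r p)).
      by apply: open_nbhs_nbhs; split=> //; exact: ball_open.
    exact: (near_chart_in aP ac cq nb).
  - by split=> //; exact: ballxx.
  - move=> q [cq /ballrV/ltW qr]; split=> //; apply: le_trans qr _.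
    by rewrite ler_peMl ?ltW// ltr1n.
  - exact: compact_chart_ball.
exists c, r, b, s; split=> // p.
by have [ac cp r0 Hc] := Hcr p.
Qed.

Lemma manifold_exhaustible : is_manifold P -> nonmeasurable P -> exhaustible P.
Proof.
move=> mP nP; have [aP hP _] := mP.
have [c [r [b [s [Hc ob cover]]]]] := manifold_pieces mP.
(* The n-th bumps of all pieces are assembled into one function, smooth because the piece is locally
   constant. *)
pose chi n q := chart_bump (c (s (b q) n)) (ccoord (c (s (b q) n)) (s (b q) n)) (r (s (b q) n)) q.
have nb q : \forall q' \near q, b q' = b q.
  by have := ob (b q); rewrite openE => /(_ q erefl).
exists P, b, chi; split=> // [n|q|i n].
- split=> [|q]; last by rewrite chart_bump_ge0 chart_bump_le1.
  apply/(smooth_funP aP) => q; set p := s (b q) n.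
  apply: (smooth_near_near aP (f := chart_bump (c p) (ccoord (c p) p) (r p))).
    by apply: filterS (nb q) => q' bq; rewrite /chi bq.
  have [ac r0 Hp] := Hc p.
  exact: (iffLR (smooth_funP aP _) (chart_bump_smooth aP hP ac r0 Hp)).
- have [n [cq qr]] := cover q; exists n; have [ac r0 Hp] := Hc (s (b q) n).
  apply: filterS2 (nb q) (chart_bump1 aP ac cq r0 qr) => q' bq.
  by rewrite /chi bq.
- have [ac r0 Hp] := Hc (s i n).
  exists (chart_ball (c (s i n)) (ccoord (c (s i n)) (s i n)) (r (s i n))).
    exact: compact_chart_ball.
  by move=> q bq; rewrite /chi bq; exact: chart_bump_support.
Qed.

Lemma rational_row n (w : 'rV[R]_n) (e : R) : 0 < e ->
  exists x : 'rV[rat]_n, `|w - map_mx ratr x| < e.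
Proof.
move=> e0; have e2 : 0 < e / 2 by rewrite divr_gt0.
have /choice[x Hx] (i : 'I_n) : exists q : rat, `|w 0 i - ratr q| < e / 2.
  have [|q] := @rat_in_itvoo R (w 0 i - e / 2) (w 0 i + e / 2); first by lra.
  by rewrite in_itv /= => /andP[q1 q2]; exists q; rewrite ltr_norml; lra.
exists (\row_i x i); apply: (@le_lt_trans _ _ (e / 2)); last by lra.
by apply/row_norm_le; [exact: ltW|move=> i; rewrite !mxE ltW].
Qed.

Lemma global_chart_hausdorff (c : chart P M) : is_atlas P -> admissible c -> cdom c = setT ->
  hausdorff_space P.
Proof.
move=> aP ac cT; apply: (hausdorff_injective (f := ccoord c) (@norm_hausdorff _ _)).
  by move=> p; apply: ccoord_continuous => //; rewrite cT.
by move=> p q; apply: ccoord_inj; [case: ac|rewrite cT|rewrite cT].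
Qed.

(** Balls with rational centre and radius 1/(k + 1), enumerated through [unpickle], exhaust the
    single piece; those whose double leaves the image of the chart are replaced by the zero
    function. *)
Lemma global_chart_exhaustible (c : chart P M) : is_atlas P -> admissible c -> cdom c = setT ->
  exhaustible P.
Proof.
move=> aP ac cT; have hP := global_chart_hausdorff aP ac cT.
pose fits x r := `[< forall w, `|w - x| <= 2 * r -> exists2 q, cdom c q & ccoord c q = w >].
pose T := ('rV[rat]_(\dim {:V}) * nat)%type.
pose ctr (t : T) : 'rV[R]_(\dim {:V}) := map_mx ratr t.1.
pose rad (t : T) : R := t.2.+1%:R^-1.
have rad0 t : 0 < rad t by rewrite invr_gt0.
pose good (t : T) := fits (ctr t) (rad t).
pose chi n q := if unpickle n is Some t then
  if good t then chart_bump c (ctr t) (rad t) q else 0 else 0.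
exists unit, (fun=> tt), chi; split.
- move=> F UF _; exists tt.
  rewrite (_ : [set tt] = setT); first exact: filterT.
  by apply/funext => -[]; apply/propext; split.
- move=> []; rewrite (_ : mkset _ = setT); first exact: openT.
  by apply/funext => p; apply/propext; split.
- move=> n; rewrite /chi; case: unpickle => [t|]; last first.
    by split=> [|p]; [exact: (cinfP (0 : Cinf P))|rewrite lexx ler01].
  case: (boolP (good t)) => [/asboolP gt|_]; last first.
    by split=> [|p]; [exact: (cinfP (0 : Cinf P))|rewrite lexx ler01].
  split=> [|p]; last by rewrite chart_bump_ge0 chart_bump_le1.
  exact: (chart_bump_smooth aP hP ac (rad0 t)).
- move=> p; have cp : cdom c p by rewrite cT.
  have nT : nbhs p setT by exact: filterT.
  have [r [r0 _ rc]] := ex_chart_ball aP ac cp nT.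
  (* Twice the new radius plus the distance from p to the new centre is at most 3/(k + 1), which is
     less than 2 * r. *)
  have [k kr] : exists k : nat, k.+1%:R^-1 < r / 2.
    exists (Num.bound (2 / r)); rewrite invf_plt ?posrE ?divr_gt0// invf_div.
    apply: lt_trans (archi_boundP _) _; first by rewrite divr_ge0// ltW.
    by rewrite ltr_nat.
  have [x xk] := @rational_row _ (ccoord c p) k.+1%:R^-1 (ltac:(by rewrite invr_gt0)).
  pose t : T := (x, k); exists (pickle t).
  have gt : good t.
    apply/asboolP => w wx; apply: rc; rewrite -[w](subrK (ctr t)) -addrA.
    apply: le_trans (ler_normD _ _) _; rewrite [`|_ - _| in X in _ + X]distrC.
    have radE : rad t = k.+1%:R^-1 by []; rewrite radE in wx.
    by apply: (le_trans (lerD wx (ltW xk))); move: kr; set y := _^-1; lra.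
  rewrite /chi pickleK gt; apply: chart_bump1 => //; exact/ballrV.
- move=> i n; rewrite /chi; case: unpickle => [t|]; last first.
    by exists set0 => [|q _]; [exact: compact0|rewrite eqxx].
  case: (boolP (good t)) => [/asboolP gt|_]; last first.
    by exists set0 => [|q _]; [exact: compact0|rewrite eqxx].
  exists (chart_ball c (ctr t) (rad t)) => [|q _]; first exact: compact_chart_ball.
  exact: chart_bump_support.
Qed.

Lemma zeroA_alphaT (A : localAlgebra R) (u : weil_pt A P) (f : Cinf P) :
  is_atlas P -> exhaustible P -> zeroA A (u f) = f (alphaT u).
Proof.
move=> aP eP; have [p Hp] : exists p, forall f : Cinf P, zeroA A (u f) = f p.
  apply: (phi_evaluation aP (phi := fun f => zeroA A (u f))) => //.
  - by rewrite rmorph1 zeroA1.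
  - by move=> g h; rewrite rmorphB zeroAB.
  - by move=> g h; rewrite rmorphM zeroAM.
  - by move=> a g; rewrite weil_scal zeroAZ.
exact: (xgetPex _ (ex_intro (fun p => forall f : Cinf P, zeroA A (u f) = f p) p Hp)).
Qed.

Lemma alphaT_unique (A : localAlgebra R) (u : weil_pt A P) p :
  is_atlas P -> hausdorff_space P -> exhaustible P ->
  (forall f : Cinf P, zeroA A (u f) = f p) -> alphaT u = p.
Proof.
move=> aP hP eP up; apply: smooth_separates => // f.
by rewrite -up zeroA_alphaT.
Qed.

End ManifoldPieces.

(** * The bundle of A-points *)

(** Common ground of P, where [exhaustible] comes from nonmeasurability, and of chart domains and
    chart images, where it comes from the global chart. *)
Definition tame (R : realType) (V : vectType R) (M : affineSpace V) (P : atlasSpace M) :=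
  [/\ is_atlas P, hausdorff_space P & exhaustible P].

Lemma weil_pt_ext (R : realType) (A : localAlgebra R) (V : vectType R)
    (M : affineSpace V) (P : atlasSpace M) (u v : weil_pt A P) :
  (forall f, u f = v f) -> u = v.
Proof.
case: u v => [[f Cf] sf] [[g Cg] sg] /= /funext fg; subst g.
have e : Cf = Cg.
  case: Cf Cg {sf sg} => [[m1] [m2]] [[m1'] [m2']].
  by rewrite (Prop_irrelevance m1 m1') (Prop_irrelevance m2 m2').
by subst Cg; congr WeilPt; exact: Prop_irrelevance.
Qed.

(** * Points of AP as morphisms on germs *)

Section Germs.
Variables (R : realType) (A : localAlgebra R).
Variables (V : vectType R) (M : affineSpace V) (P : atlasSpace M).
Hypothesis tP : tame P.
Local Notation I := (la_ideal A).
Local Notation E := 'rV[R]_(\dim {:V}).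
Implicit Types (u v : weil_pt A P) (p q : P) (c d : chart P M) (f g : P -> R).

Let aP : is_atlas P. Proof. by case: tP. Qed.
Let hP : hausdorff_space P. Proof. by case: tP. Qed.
Let eP : exhaustible P. Proof. by case: tP. Qed.

Lemma smooth_nearI f p p0 c : admissible c -> cdom c p ->
  smooth_at (f \o cinv c p0) (ccoord c p) -> smooth_near f p.
Proof.
move=> ac cp sf; exists c; split=> //; have [ic _] := ac; apply: smooth_at_eq sf.
have := near_ccoordK p0 ac cp; apply: filterS => w [cw wE] /=.
by rewrite -wE !cinvK.
Qed.

Lemma near_smooth_near f p : smooth_near f p -> \forall q \near p, smooth_near f q.
Proof.
move=> [c [ac cp /smooth_at_near nf]].
have := near_chart_in aP ac cp nf; apply: filterS => q [cq sf].
exact: smooth_nearI ac cq sf.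
Qed.

(** Cut-off by a bump whose support lies in the set where f is smooth, not merely in the chart
    domain; otherwise the product might fail to be smooth far from p. *)
Lemma smooth_near_global f p : smooth_near f p -> exists g : Cinf P, \forall q \near p, g q = f q.
Proof.
move=> sf; have nB := near_smooth_near sf; have [c cP cp] := ex_chart aP p.
have ac := atlas_admissible aP cP; have [r [r0 rB rc]] := ex_chart_ball aP ac cp nB.
set x := ccoord c p in rB rc; pose chi := chart_bump c x r.
have schi := chart_bump_smooth aP hP ac r0 rc.
have sg : (fun q => chi q * f q) \in smooth_pred P.
  apply/(smooth_funP aP) => q; have [/rB Bq|nLq] := pselect (chart_ball c x r q).
    by apply: smooth_nearM => //; exact: (iffLR (smooth_funP aP _) schi).
  have oL : open (~` chart_ball c x r).
    exact: (closed_openC (compact_closed hP (compact_chart_ball aP ac rc))).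
  apply: (smooth_near_near aP _ (smooth_near_cst aP 0 q)).
  apply: filterS (open_nbhs_nbhs (conj oL nLq)) => q' nq'.
  rewrite (_ : chi q' = 0) ?mul0r//; apply/eqP/negPn/negP.
  by move=> /(chart_bump_support r0).
exists (MkCinf sg).
have := chart_bump1 aP ac cp r0 (ballxx x r0); apply: filterS => q /= cq.
by rewrite -[RHS]mul1r -cq.
Qed.

Lemma weil_near u (g h : Cinf P) : (\forall q \near alphaT u, g q = h q) -> u g = u h.
Proof.
move=> gh; have [chi [schi chi1 chi0]] := ex_bump aP hP gh.
apply/eqP; rewrite -subr_eq0 -rmorphB; apply/eqP.
apply: (@la_regular _ _ (u (MkCinf schi))).
  by rewrite zeroA_alphaT//= (nbhs_singleton chi1) oner_eq0.
rewrite -rmorphM (_ : _ * _ = 0) ?rmorph0//; apply: val_inj; apply/funext => q /=.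
have [e|ne] := eqVneq (g q) (h q); last first.
  by rewrite -[LHS]/(chi q * _) chi0 ?mul0r// => e; rewrite e eqxx in ne.
by rewrite -[LHS]/(_ * (g q - h q)) e subrr mulr0.
Qed.

(* Two functions with the same germ at the base point have the same image under
   u, which thus extends to the functions only smooth near this point. *)
Definition wgerm u f : A := u (xget 0 [set g : Cinf P | \forall q \near alphaT u, g q = f q]).

Lemma wgermE u f (g : Cinf P) : (\forall q \near alphaT u, g q = f q) -> wgerm u f = u g.
Proof.
move=> gf; apply: weil_near.
have := xgetI (0 : Cinf P) (gf : [set g : Cinf P | \forall q \near alphaT u, g q = f q] g).
by apply: filterS2 gf => q -> ->.
Qed.

Lemma wgerm_near u f g : smooth_near f (alphaT u) -> (\forall q \near alphaT u, f q = g q) ->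
  wgerm u f = wgerm u g.
Proof.
move=> /smooth_near_global[h hf] fg; rewrite (wgermE hf); apply/esym/wgermE.
by apply: filterS2 hf fg => q -> ->.
Qed.

Lemma wgermD u f g : smooth_near f (alphaT u) -> smooth_near g (alphaT u) ->
  wgerm u (fun q => f q + g q) = wgerm u f + wgerm u g.
Proof.
move=> /smooth_near_global[f' ff'] /smooth_near_global[g' gg'].
rewrite (wgermE ff') (wgermE gg') -rmorphD; apply: wgermE.
by apply: filterS2 ff' gg' => q <- <-.
Qed.

Lemma wgermM u f g : smooth_near f (alphaT u) -> smooth_near g (alphaT u) ->
  wgerm u (fun q => f q * g q) = wgerm u f * wgerm u g.
Proof.
move=> /smooth_near_global[f' ff'] /smooth_near_global[g' gg'].
rewrite (wgermE ff') (wgermE gg') -rmorphM; apply: wgermE.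
by apply: filterS2 ff' gg' => q <- <-.
Qed.

Lemma wgerm_cst u (r : R) : wgerm u (fun=> r) = r *: 1.
Proof.
rewrite (@wgermE _ _ (r *: (1 : Cinf P))); first by rewrite weil_scal rmorph1.
by apply: filterE => q; rewrite -[LHS]/(r * 1) mulr1.
Qed.

Lemma zeroA_wgerm u f : smooth_near f (alphaT u) -> zeroA A (wgerm u f) = f (alphaT u).
Proof.
move=> /smooth_near_global[g gf]; rewrite (wgermE gf) zeroA_alphaT//.
exact: nbhs_singleton gf.
Qed.

Section InChart.
Variable c : chart P M.
Hypothesis ac : admissible c.
Let ic : is_chart c. Proof. by case: ac. Qed.

Lemma smooth_near_ccoord (F : E -> R) p : cdom c p -> smooth_at F (ccoord c p) ->
  smooth_near (F \o ccoord c) p.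
Proof. by move=> cp sF; apply: smooth_near_comp => // j; exact: smooth_near_coord. Qed.

Lemma germ_hom_wgerm u : cdom c (alphaT u) ->
  germ_hom (ccoord c (alphaT u)) (fun F => wgerm u (F \o ccoord c)).
Proof.
move=> cu; split=> [F G sF FG|F G sF sG|F G sF sG|r].
- apply: wgerm_near; first exact: smooth_near_ccoord.
  by apply: filterS (near_chart_in aP ac cu FG) => q [_].
- by apply: wgermD; exact: smooth_near_ccoord.
- by apply: wgermM; exact: smooth_near_ccoord.
- exact: wgerm_cst.
Qed.

(** The elements u(x^i) of the identification of AM with M x (I_A (x) V), for the coordinates x^i
    that vanish at the base point; germs are required, since the coordinates of a chart are not
    globally defined. *)
Definition wvec u i : A :=
  wgerm u (fun q => ccoord c q 0 i) - ccoord c (alphaT u) 0 i *: 1.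

Lemma wvec_ideal u i : cdom c (alphaT u) -> wvec u i \in I.
Proof.
move=> cu; rewrite -zeroA_ker zeroAB zeroAZ zeroA1 mulr1.
by rewrite zeroA_wgerm ?subrr//; exact: smooth_near_coord.
Qed.

(** Both sides are morphisms on germs at the base point and agree on the coordinates, so that
    [germ_hom_uniq] identifies them. *)
Lemma wgerm_taylor u (F : E -> R) : cdom c (alphaT u) -> smooth_at F (ccoord c (alphaT u)) ->
  wgerm u (F \o ccoord c) = taylor (wvec u) F (ccoord c (alphaT u)).
Proof.
move=> cu sF; have uI i := wvec_ideal i cu.
apply: (germ_hom_uniq (germ_hom_wgerm cu) (germ_hom_taylor _ uI) _ _ sF) => // i.
by rewrite taylor_coord addrC subrK.
Qed.

Lemma weil_taylor u (f : Cinf P) p0 : cdom c (alphaT u) ->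
  u f = taylor (wvec u) (f \o cinv c p0) (ccoord c (alphaT u)).
Proof.
move=> cu; have sf := iffLR (smooth_funP aP f) (cinfP f) (alphaT u).
rewrite -wgerm_taylor//; last exact: (smooth_near_chart aP p0 sf ac cu).
apply/esym/wgermE; apply: filterS (near_cdom aP ac cu) => q cq.
by rewrite /= cinvK.
Qed.

Lemma wvec_inj u v : cdom c (alphaT u) -> alphaT u = alphaT v ->
  wvec u =1 wvec v -> u = v.
Proof.
move=> cu uv /funext wuv; apply: weil_pt_ext => f.
by rewrite (weil_taylor f (alphaT u) cu) (@weil_taylor v f (alphaT u)) -?uv// wuv.
Qed.

Section TaylorPoint.
Variables (p : P) (a : 'I_(\dim {:V}) -> A).
Hypotheses (cp : cdom c p) (aI : forall i, a i \in I).

Let tay (f : Cinf P) : A := taylor a (f \o cinv c p) (ccoord c p).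

Let tay_smooth (f : Cinf P) : smooth_at (f \o cinv c p) (ccoord c p).
Proof. exact: (smooth_near_chart aP p (iffLR (smooth_funP aP f) (cinfP f) p) ac cp). Qed.

Fact taylor_point_scal : scalable tay.
Proof. by move=> r f; apply: etrans (taylorZ aI r (tay_smooth f)). Qed.

Fact taylor_point_zmod : zmod_morphism tay.
Proof.
move=> f g; have -> : f - g = f + (-1) *: g by rewrite scaleN1r.
apply: etrans (taylorD a (tay_smooth f) (tay_smooth (-1 *: g))) _.
by rewrite -[X in _ + X]/(tay (-1 *: g)) taylor_point_scal scaleN1r.
Qed.

Fact taylor_point_monoid : monoid_morphism tay.
Proof.
split=> [|f g]; last by apply: etrans (taylorM aI (tay_smooth f) (tay_smooth g)) _.
by apply: etrans (taylor_cst a 1 (ccoord c p)) _; rewrite scale1r.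
Qed.

Definition taylor_point : weil_pt A P :=
  @WeilPt R A V M P
    (HB.pack tay (GRing.isZmodMorphism.Build (Cinf P) A tay taylor_point_zmod)
      (GRing.isMonoidMorphism.Build (Cinf P) A tay taylor_point_monoid))
    taylor_point_scal.

Lemma alphaT_taylor_point : alphaT taylor_point = p.
Proof.
apply: alphaT_unique => // f; rewrite -[taylor_point f]/(tay f) zeroA_taylor//=.
by rewrite cinvK.
Qed.

Lemma wvec_taylor_point : wvec taylor_point =1 a.
Proof.
move=> i; rewrite /wvec alphaT_taylor_point.
have sc : smooth_near (fun q => ccoord c q 0 i) p by exact: smooth_near_coord.
have [g gc] := smooth_near_global sc.
rewrite (@wgermE _ _ g); last by rewrite alphaT_taylor_point.
rewrite -[taylor_point g]/(tay g) /tay (@taylor_near _ _ _ _ _ (fun z => z 0 i)).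
  by rewrite taylor_coord// addrAC subrr add0r.
have := near_ccoordK p ac cp.
have := iffLR (near_chart aP p _ ac cp) gc.
by apply: filterS2 => w /= -> [_ ->].
Qed.

End TaylorPoint.
End InChart.
End Germs.

Section VectorValued.
Variables (R : realType) (m : nat).
Local Notation E := 'rV[R]_m.
Implicit Types (w : E).

(** A and the fibre are vector spaces without a norm, so smoothness with values in them is tested on
    the coordinates. *)
Definition vsmooth (W : vectType R) (f : E -> W) w : Prop :=
  forall i, smooth_at (fun z => coord (vbasis {:W}) i (f z)) w.

Section Linear.
Variables W W' : vectType R.
Implicit Types (f g : E -> W).

Lemma vsmoothD f g w : vsmooth f w -> vsmooth g w -> vsmooth (fun z => f z + g z) w.
Proof.
move=> sf sg i; apply: smooth_at_ext (smooth_atD (sf i) (sg i)) => z.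
by rewrite linearD.
Qed.

Lemma vsmooth_sum k (f : 'I_k -> E -> W) w : (forall j, vsmooth (f j) w) ->
  vsmooth (fun z => \sum_j f j z) w.
Proof.
move=> sf i; apply: smooth_at_ext (smooth_at_sum (fun j => sf j i)) => z.
by rewrite linear_sum.
Qed.

Lemma vsmoothZ (h : E -> R) f w : smooth_at h w -> vsmooth f w ->
  vsmooth (fun z => h z *: f z) w.
Proof.
move=> sh sf i; apply: smooth_at_ext (smooth_atM sh (sf i)) => z.
by rewrite linearZ.
Qed.

Lemma vsmooth_cst (v : W) w : vsmooth (fun=> v) w.
Proof. by move=> i; exact: smooth_at_cst. Qed.

Lemma vsmooth_linear (g : W -> W') f w : linear g -> vsmooth f w ->
  vsmooth (fun z => g (f z)) w.
Proof.
move=> lg sf i.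
apply: (@smooth_at_functional _ _ m (fun v => coord (vbasis {:W'}) i (g v)) f w) => //.
by move=> r x y; rewrite lg linearP.
Qed.

End Linear.

Variable A : localAlgebra R.

Lemma vsmoothM (f g : E -> A) w : vsmooth f w -> vsmooth g w ->
  vsmooth (fun z => f z * g z) w.
Proof.
move=> sf sg; rewrite (_ : (fun z => _) =
    fun z => \sum_j coord (vbasis {:A}) j (f z) *: ((vbasis {:A})`_j * g z)); last first.
  apply/funext => z; rewrite {1}(coord_vbasis (memvf (f z))) mulr_suml.
  by apply: eq_bigr => j _; rewrite scalerAl.
apply: vsmooth_sum => j; apply: vsmoothZ; first exact: sf.
by apply: vsmooth_linear sg => r x y; rewrite mulrDr scalerAr.
Qed.

Section Taylor.
Variables (n : nat) (X : E -> 'rV[R]_n) (a : E -> 'I_n -> A) (w : E).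
Hypotheses (sX : smooth_at X w) (sa : forall i, vsmooth (fun z => a z i) w).

Lemma vsmooth_jet k f : smooth_at f (X w) -> vsmooth (fun z => jet k f (X z) (a z)) w.
Proof.
elim: k f => [|k IH] f sf.
  by apply: vsmoothZ; [exact: (smooth_at_comp sX sf)|exact: vsmooth_cst].
apply: vsmoothZ; first exact: smooth_at_cst.
apply: vsmooth_sum => i; apply: vsmoothM => //; apply: IH.
exact: smooth_at_partial.
Qed.

Lemma vsmooth_taylor f : smooth_at f (X w) ->
  vsmooth (fun z => taylor (a z) f (X z)) w.
Proof. by move=> sf; apply: vsmooth_sum => k; exact: vsmooth_jet. Qed.

End Taylor.
End VectorValued.

Section Fibre.
Variables (R : realType) (A : localAlgebra R) (V : vectType R).
Local Notation I := (la_ideal A).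
Local Notation F := (weil_fibre A V).
Local Notation e := (vbasis {:V}).
Local Notation n := (\dim {:V}).

Definition fib_of (a : 'I_n -> A) : F := \sum_i tens (vsproj I (a i)) e`_i.

Definition dual_basis i : 'Hom(V, R^o) := linfun (coord e i : V -> R^o).

(** As I_A (x) V is realised as Hom(V^*, I_A), the components of a tensor are its values on the dual
    basis. *)
Definition fib_coord (x : F) i : A := vsval (x (dual_basis i)).

Lemma dual_basisE i v : dual_basis i v = coord e i v.
Proof. by rewrite lfunE. Qed.

Lemma fib_ofK (a : 'I_n -> A) : (forall i, a i \in I) -> fib_coord (fib_of a) =1 a.
Proof.
move=> aI i; rewrite /fib_coord /fib_of sum_lfunE (bigD1 i) //= big1 => [|j ji].
  rewrite addr0 tensE dual_basisE coord_free ?(basis_free (vbasisP _)) // eqxx.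
  by rewrite scale1r vsprojK.
rewrite tensE dual_basisE coord_free ?(basis_free (vbasisP _)) //.
by rewrite (negbTE ji) scale0r.
Qed.

Lemma fib_coord_ideal x i : fib_coord x i \in I.
Proof. exact: subvsP. Qed.

Lemma fib_coordK x : fib_of (fib_coord x) = x.
Proof.
have H i : fib_of (fib_coord x) (dual_basis i) = x (dual_basis i).
  apply: val_inj; exact: (fib_ofK (fib_coord_ideal x)).
apply/lfunP => l.
have -> : l = \sum_(i < n) l e`_i *: dual_basis i.
  apply/lfunP => v; rewrite sum_lfunE {1}(coord_vbasis (memvf v)) linear_sum.
  by apply: eq_bigr => i _; rewrite linearZ !lfunE /= dual_basisE; exact: mulrC.
rewrite !linear_sum; apply: eq_bigr => i _.
by rewrite [LHS]linearZ [RHS]linearZ; congr (_ *: _); exact: H.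
Qed.

Lemma fib_of_inj (a b : 'I_n -> A) : (forall i, a i \in I) -> (forall i, b i \in I) ->
  fib_of a = fib_of b -> a =1 b.
Proof. by move=> aI bI ab i; rewrite -(fib_ofK aI) ab fib_ofK. Qed.

Lemma vsmooth_fib_coord m (f : 'rV[R]_m -> F) w i : vsmooth f w ->
  vsmooth (fun z => fib_coord (f z) i) w.
Proof.
apply: (vsmooth_linear (g := fun x => fib_coord x i)) => r x y.
by rewrite /fib_coord !lfunE /= !lfunE /=.
Qed.

Lemma vsmooth_fib_of m (a : 'rV[R]_m -> 'I_n -> A) w :
  (forall i, vsmooth (fun z => a z i) w) -> vsmooth (fun z => fib_of (a z)) w.
Proof.
move=> sa; apply: vsmooth_sum => i.
apply: (vsmooth_linear (g := fun y => tens (vsproj I y) e`_i)) (sa i) => r x y.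
by rewrite linearP tens_linearl.
Qed.

End Fibre.

Section WeilMap.
Variables (R : realType) (A : localAlgebra R) (V V' : vectType R).
Variables (M : affineSpace V) (N : affineSpace V').
Variables (P : atlasSpace M) (Q : atlasSpace N) (phi : P -> Q).
Hypothesis phiP : forall g : Cinf Q, (g : Q -> R) \o phi \in smooth_pred P.
Hypotheses (tP : tame P) (tQ : tame Q).
Implicit Types u : weil_pt A P.

Lemma alphaT_weil_map u : alphaT (weil_map phiP u) = phi (alphaT u).
Proof.
have [aP hP eP] := tP; have [aQ hQ eQ] := tQ.
by apply: alphaT_unique => // f; exact: etrans (zeroA_alphaT u (pullback phiP f) aP eP) _.
Qed.

Lemma wgerm_weil_map u (g : Q -> R) : {for alphaT u, continuous phi} ->
  smooth_near g (phi (alphaT u)) -> wgerm (weil_map phiP u) g = wgerm u (g \o phi).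
Proof.
move=> cphi /(smooth_near_global tQ)[h hg].
rewrite (@wgermE _ _ _ _ _ tQ _ _ h); last by rewrite alphaT_weil_map.
apply/esym; apply: (@wgermE _ _ _ _ _ tP u _ (pullback phiP h)).
exact: near_continuous cphi hg.
Qed.

End WeilMap.

Lemma wvec_weil_map (R : realType) (A : localAlgebra R) (V : vectType R)
    (M : affineSpace V) (P Q : atlasSpace M) (phi : P -> Q)
    (phiP : forall g : Cinf Q, (g : Q -> R) \o phi \in smooth_pred P)
    (c : chart P M) (d : chart Q M) (u : weil_pt A P) :
  tame P -> tame Q -> {for alphaT u, continuous phi} ->
  admissible c -> admissible d -> cdom c (alphaT u) -> cdom d (phi (alphaT u)) ->
  (\forall q \near alphaT u, ccoord d (phi q) = ccoord c q) ->
  wvec d (weil_map phiP u) =1 wvec c u.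
Proof.
move=> tP tQ cphi ac ad cu du cd i; have [aP _ _] := tP; have [aQ _ _] := tQ.
rewrite /wvec alphaT_weil_map// (nbhs_singleton cd) wgerm_weil_map//; last exact: smooth_near_coord.
congr (_ - _); apply/esym/wgerm_near => //; first exact: smooth_near_coord.
by apply: filterS cd => q /= ->.
Qed.

Section Tame.
Variables (R : realType) (V : vectType R) (M : affineSpace V).

Lemma tame_global_chart (P : atlasSpace M) (c : chart P M) :
  is_atlas P -> admissible c -> cdom c = setT -> tame P.
Proof.
move=> aP ac cT; split=> //; first exact: global_chart_hausdorff ac cT.
exact: global_chart_exhaustible ac cT.
Qed.

Lemma tame_manifold (P : atlasSpace M) : is_manifold P -> nonmeasurable P -> tame P.
Proof.
move=> mP nP; have [aP hP _] := mP; split=> //; exact: manifold_exhaustible.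
Qed.

Variables (P : atlasSpace M) (c : chart P M).
Hypotheses (aP : is_atlas P) (ac : admissible c).

Lemma sub_chart_domT : cdom (sub_chart (cdom c) c : chart (chart_dom c) M) = setT.
Proof. by apply/seteqP; split=> // -[]. Qed.

Lemma chart_dom_is_atlas : is_atlas (chart_dom c).
Proof. by apply: submfd_is_atlas => //; exact: open_cdom. Qed.

Lemma sub_chart_dom_admissible : admissible (sub_chart (cdom c) c : chart (chart_dom c) M).
Proof. by apply: sub_chart_admissible => //; exact: open_cdom. Qed.

Lemma tame_chart_dom : tame (chart_dom c).
Proof. exact: tame_global_chart chart_dom_is_atlas sub_chart_dom_admissible sub_chart_domT. Qed.

Definition im_chart : chart (chart_im c) M :=
  sub_chart _ (Chart setT id : chart (affmfd M) M).

Lemma im_chart_atlas : atlas (chart_im c) im_chart.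
Proof. by exists (Chart setT id). Qed.

Lemma im_chart_domT : cdom im_chart = setT.
Proof. by []. Qed.

Lemma open_chart_im : open (c @` cdom c : set (affmfd M)).
Proof.
have [[_ oc] _] := ac.
have := @open_chart_preimage _ _ _ (affmfd M) (Chart setT id) _ erefl oc.
by rewrite /= setTI.
Qed.

Lemma chart_im_is_atlas : is_atlas (chart_im c).
Proof. by apply: submfd_is_atlas open_chart_im; exact: affmfd_is_atlas. Qed.

Lemma tame_chart_im : tame (chart_im c).
Proof.
apply: (tame_global_chart chart_im_is_atlas _ im_chart_domT).
exact: (atlas_admissible chart_im_is_atlas im_chart_atlas).
Qed.

End Tame.

(** In these two global charts f is the identity, and so is its inverse; the second-to-last
    hypothesis says that f is onto. *)
Lemma diffeo_global_charts (R : realType) (V : vectType R) (M : affineSpace V)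
    (P Q : atlasSpace M) (c : chart P M) (d : chart Q M) (f : P -> Q) :
  is_atlas P -> is_atlas Q -> admissible c -> admissible d ->
  cdom c = setT -> cdom d = setT ->
  (forall q, exists p, c p = d q) -> (forall p, d (f p) = c p) -> diffeo f.
Proof.
move=> aP aQ ac ad cT dT cd fE; have [[ic _] _] := ac; have [[dI _] _] := ad.
pose g q := projT1 (cid (cd q)); have gE q : c (g q) = d q := projT2 (cid (cd q)).
have sm (P' Q' : atlasSpace M) (c' : chart P' M) (d' : chart Q' M) (f' : P' -> Q') :
    is_atlas P' -> is_atlas Q' -> admissible c' -> admissible d' ->
    cdom c' = setT -> cdom d' = setT -> (forall p, d' (f' p) = c' p) -> smooth_map f'.
  move=> aP' aQ' ac' ad' cT' dT' f'E.
  apply: smooth_map_chart => // p; exists c', d', id; rewrite cT' dT'; split=> //.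
    exact: smooth_at_id.
  by apply: filterE => q; rewrite /ccoord f'E.
split; first exact: (sm _ _ c d).
exists g; split; first exact: (sm _ _ d c).
- by move=> p; apply: ic; rewrite ?inE ?cT// gE.
- by move=> q; apply: dI; rewrite ?inE ?dT// fE.
Qed.

Section WeilCharts.
Variables (R : realType) (A : localAlgebra R) (V : vectType R) (M : affineSpace V).
Variables (P : atlasSpace M) (c : chart P M).
Hypotheses (tP : tame P) (cP : admissible c).
Local Notation sc := (sub_chart (cdom c) c : chart (chart_dom c) M).

Let aP : is_atlas P. Proof. by case: tP. Qed.
Let tD : tame (chart_dom c). Proof. exact: tame_chart_dom. Qed.
Let asc : admissible sc. Proof. exact: sub_chart_dom_admissible. Qed.

Lemma sc_dom p : cdom sc p. Proof. by rewrite sub_chart_domT. Qed.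

Lemma alphaT_weil_incl (u : weil_pt A (chart_dom c)) :
  alphaT (weil_incl u) = sval (alphaT u).
Proof. exact: alphaT_weil_map. Qed.

Lemma wvec_weil_incl (u : weil_pt A (chart_dom c)) : wvec c (weil_incl u) =1 wvec sc u.
Proof.
apply: wvec_weil_map => //; last 3 first.
- exact: sc_dom.
- exact: svalP.
- exact: filterE.
by apply: sval_continuous => //; exact: open_cdom.
Qed.

(** A point above the chart domain is determined by its base point and its [wvec]; the Taylor point
    with the same data on the submanifold is therefore a preimage. *)
Lemma range_weil_incl :
  range (@weil_incl R A V M P (cdom c)) = [set w | cdom c (alphaT w)].
Proof.
apply/seteqP; split=> [_ [u _ <-]|w /= cw].
  by rewrite /= alphaT_weil_incl; exact: svalP.
have wI i := wvec_ideal tP cP i cw.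
pose p : chart_dom c := exist _ _ cw.
pose u : weil_pt A (chart_dom c) := taylor_point tD asc (sc_dom p) wI.
exists u => //.
have au : alphaT u = p by exact: alphaT_taylor_point.
apply: (wvec_inj tP cP); rewrite ?alphaT_weil_incl ?au// => i.
by rewrite wvec_weil_incl wvec_taylor_point.
Qed.

Lemma weil_chart_map_alphaT (u : weil_pt A (chart_dom c)) :
  alphaT (weil_chart_map cP u) = chart_map (alphaT u).
Proof. by apply: alphaT_weil_map => //; exact: tame_chart_im. Qed.

(** [weil_aff] evaluates u on coordinates recentred at the base point, [wvec] subtracts the value
    there from coordinates with a fixed origin; these are the same functions. *)
Lemma weil_trivE (u : weil_pt A (chart_dom c)) :
  weil_triv cP u = (chart_map (alphaT u), fib_of (wvec sc u)).
Proof.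
rewrite /weil_triv /weil_aff weil_chart_map_alphaT; congr (_, _).
apply: eq_bigr => i _; congr (tens (vsproj _ _) _).
rewrite /weil_chart_map /weil_map /=.
set p := alphaT u; set k := pullback _ _.
have aD : is_atlas (chart_dom c) by case: tD.
have scI : smooth_near (fun q => ccoord sc q 0 i) p.
  by apply: smooth_near_coord => //; exact: sc_dom.
rewrite -[RHS]/(wgerm u (fun q => ccoord sc q 0 i) - ccoord sc p 0 i *: 1) -scaleNr.
rewrite -(wgerm_cst tD u) -wgermD//; last exact: smooth_near_cst.
apply/esym/(wgermE tD); apply: filterE => q.
rewrite /ccoord !aff_coordE -linearB /=; congr (coord _ _ _).
by rewrite [X in _ = X - _](vsub_chain (c (sval p))) addrK.
Qed.

Lemma weil_chart_dom : cdom (weil_chart A cP) = [set w | cdom c (alphaT w)].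
Proof. exact: range_weil_incl. Qed.

(** The choice in [weil_chart] is harmless: every preimage of w under [weil_incl] yields the same
    base point and the same [wvec]. *)
Lemma weil_chartE (w : weil_pt A P) : cdom c (alphaT w) ->
  weil_chart A cP w = (c (alphaT w), fib_of (wvec c w)).
Proof.
move=> cw; have [u _ uw] : range (@weil_incl R A V M P (cdom c)) w.
  by rewrite range_weil_incl.
pose S : set (weil_model A M) := [set y | exists2 u', weil_incl u' = w &
  y = (sval (weil_triv cP u').1, (weil_triv cP u').2)].
have [v vw SE] : S (weil_chart A cP w).
  by apply: (@xgetPex _ _ S); eexists; exists u.
rewrite SE weil_trivE [LHS]/= -{1}vw alphaT_weil_incl.
by congr (_, fib_of _); apply/funext => i; rewrite -wvec_weil_incl vw.
Qed.

End WeilCharts.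

(** * The atlas of AP *)

Section WeilAtlas.
Variables (R : realType) (A : localAlgebra R) (V : vectType R) (M : affineSpace V).
Variable P : atlasSpace M.
Hypothesis tP : tame P.
Local Notation F := (weil_fibre A V).
Local Notation o := (aff_origin M).
Local Notation oW := (aff_origin (weil_model A M)).
Local Notation oF := (0 : vectaff F).
Implicit Types (c d : chart P M) (p : P) (u : weil_pt A P) (y : weil_model A M).

Let aP : is_atlas P. Proof. by case: tP. Qed.

(** Subtracting the value of H removes the Taylor term of degree 0, so that what remains lies in
    I_A. *)
Definition weil_transition c d p0 y : weil_model A M :=
  let H := ccoord d \o cinv c p0 in let w := aff_coord o y.1 in
  (aff_param o (H w),
   fib_of (fun j => taylor (fib_coord y.2) (fun z => H z 0 j) w - H w 0 j *: 1)).

Lemma weil_transitionE c d (cP : admissible c) (dP : admissible d) p0 u :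
  cdom c (alphaT u) -> cdom d (alphaT u) ->
  weil_transition c d p0 (weil_chart A cP u) = weil_chart A dP u.
Proof.
move=> cu du; have [ic _] := cP.
rewrite !weil_chartE// /weil_transition /= -/(ccoord c (alphaT u)) cinvK// aff_coordK.
congr (_, fib_of _); apply/funext => j; congr (_ - _).
rewrite (_ : fib_coord _ = wvec c u); last first.
  by apply/funext => i; rewrite fib_ofK// => k; exact: wvec_ideal.
have sH := smooth_at_rowE j (smooth_transition_admissible aP p0 cP dP cu du).
rewrite -(wgerm_taylor tP cP cu sH); apply: (wgerm_near tP).
  by apply: smooth_near_ccoord.
by apply: filterS (near_cdom aP cP cu) => q cq; rewrite /= cinvK.
Qed.

Lemma smooth_weil_transition c d (cP : admissible c) (dP : admissible d) p0 p y :
  cdom c p -> cdom d p -> y.1 = c p ->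
  smooth_at (aff_coord oW \o weil_transition c d p0 \o aff_param oW) (aff_coord oW y).
Proof.
move=> cp dp yp.
pose X z := aff_coord o (aff_param oW z : weil_model A M).1.
have sX : smooth_at X (aff_coord oW y) by exact: smooth_at_fst.
have Xy : X (aff_coord oW y) = ccoord c p by rewrite /X aff_coordK yp.
have sH : smooth_at (ccoord d \o cinv c p0) (X (aff_coord oW y)).
  by rewrite Xy; exact: smooth_transition_admissible.
have sF : vsmooth (fun z => (aff_param oW z : weil_model A M).2 : F) (aff_coord oW y).
  move=> i; have := smooth_at_rowE i (smooth_at_snd (oF) oW (aff_coord oW y)).
  by apply: smooth_at_ext => z; rewrite aff_coordE /= subr0.
apply: (smooth_at_pair (f := weil_transition c d p0 \o aff_param oW) (oM := o) (oN := oF)).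
  apply: smooth_at_ext (smooth_at_vcomp sX sH) => z.
  by rewrite /= aff_paramK.
apply: smooth_at_row => i.
have sv : vsmooth (fun z => (weil_transition c d p0 (aff_param oW z)).2 : F) (aff_coord oW y).
  apply: vsmooth_fib_of => j.
  rewrite (_ : (fun z => _) = fun z => taylor (fib_coord (aff_param oW z : weil_model A M).2)
    (fun z' => (ccoord d \o cinv c p0) z' 0 j) (X z)
    + (-1) *: ((ccoord d \o cinv c p0) (X z) 0 j *: 1)); last first.
    by apply/funext => z; rewrite scaleN1r.
  apply: vsmoothD.
    apply: vsmooth_taylor => //; last exact: smooth_at_rowE.
    by move=> k; exact: vsmooth_fib_coord.
  apply: vsmoothZ; first exact: smooth_at_cst.
  apply: vsmoothZ; last exact: vsmooth_cst.
  exact: (smooth_at_rowE j (smooth_at_vcomp sX sH)).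
by apply: smooth_at_ext (sv i) => z; rewrite aff_coordE /= subr0.
Qed.

(** The whole fibre is reached because [taylor_point] realises every tuple of I_A above every
    point. *)
Lemma weil_chart_image c (cP : admissible c) (B : set P) : B `<=` cdom c ->
  weil_chart A cP @` [set u | B (alphaT u)] = (c @` B) `*` setT.
Proof.
move=> Bc; apply/seteqP; split=> [_ [u Bu <-]|[x f] [[p Bp pE] _]].
  rewrite weil_chartE//; last exact: Bc.
  by split=> //; exists (alphaT u).
pose u : weil_pt A P := taylor_point tP cP (Bc p Bp) (fib_coord_ideal f).
have au : alphaT u = p by exact: alphaT_taylor_point.
exists u; first by rewrite /= au.
rewrite weil_chartE ?au; [|done|exact: (Bc p Bp)].
apply: (congr2 pair pE).
rewrite -[RHS]fib_coordK; congr fib_of.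
by apply/funext => i; exact: wvec_taylor_point.
Qed.

Lemma weil_chart_is_chart c (cP : admissible c) : is_chart (weil_chart A cP).
Proof.
have [[ic oc] _] := cP; split.
  move=> u v; rewrite !inE weil_chart_dom// => cu cv.
  rewrite !weil_chartE// => -[/ic]; rewrite !inE => /(_ cu cv) uv /fib_of_inj ww.
  by apply: (wvec_inj tP cP) => //; apply: ww => i; exact: wvec_ideal.
rewrite weil_chart_dom// weil_chart_image//.
by apply: open_affprod => //; exact: openT.
Qed.

Lemma weil_chart_transition c d (cP : admissible c) (dP : admissible d) :
  smooth_transition (weil_chart A cP) (weil_chart A dP).
Proof.
rewrite /smooth_transition !weil_chart_dom//=.
rewrite -[X in _ @` X]/[set u | (cdom c `&` cdom d) (alphaT u)].
rewrite weil_chart_image => [|p []//].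
have oW' : open ((c @` (cdom c `&` cdom d)) `*` setT : set (weil_model A M)).
  apply: open_affprod; last exact: openT.
  by rewrite setIC; apply: open_chart_image => //; exact: open_cdom.
split=> //; have [[p0 _]|nP] := pselect (exists p : P, True).
  exists (weil_transition c d p0); first by move=> u /= cu du; exact: weil_transitionE.
  apply/(smooth_on_affP oW oW _ oW') => y [[p [cp dp] pE] _].
  exact: smooth_weil_transition cp dp (esym pE).
exists id; first by move=> u; case: nP; exists (alphaT u).
by apply/(smooth_on_affP oW oW _ oW') => y [[p]]; case: nP; exists p.
Qed.

Lemma weil_bundle_is_atlas : is_atlas (weil_bundle A P).
Proof.
split=> [_ [c [cP ->]]|_ _ [c [cP ->]] [d [dP ->]]|u].
- exact: weil_chart_is_chart.
- by split; exact: weil_chart_transition.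
- have [c cP cu] := ex_chart aP (alphaT u).
  have ac := atlas_admissible aP cP; exists (weil_chart A ac); first by exists c, ac.
  by rewrite weil_chart_dom.
Qed.

Lemma weil_chart_atlas c (cP : admissible c) : atlas (weil_bundle A P) (weil_chart A cP).
Proof. by exists c, cP. Qed.

End WeilAtlas.

Lemma continuous_dist (R : realType) n m (g : 'rV[R]_n -> 'rV[R]_m) x : continuous g ->
  continuous (fun z => `|g z - x|).
Proof.
move=> cg z.
have c1 : {for z, continuous (g - cst x)} by apply: continuousB; [exact: cg|exact: cst_continuous].
exact: (continuous_comp c1 (@norm_continuous _ _ _)).
Qed.
Lemma closed_dist (R : realType) n m (g : 'rV[R]_n -> 'rV[R]_m) x r : continuous g ->
  closed [set z | `|g z - x| <= r].
Proof.
move=> /continuous_dist cg.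
exact: (closed_comp (f := fun z => `|g z - x|) (fun z _ => cg x z) (@closed_le R r)).
Qed.
Lemma open_dist (R : realType) n m (g : 'rV[R]_n -> 'rV[R]_m) x r : continuous g ->
  open [set z | `|g z - x| < r].
Proof.
move=> /continuous_dist cg.
exact: (open_comp (f := fun z => `|g z - x|) (fun z _ => cg x z) (@open_lt R r)).
Qed.

(** * AP is a manifold *)

Section WeilManifold.
Variables (R : realType) (A : localAlgebra R) (V : vectType R) (M : affineSpace V).
Variable P : atlasSpace M.
Hypothesis tP : tame P.
Local Notation W := (weil_bundle A P).
Local Notation o := (aff_origin M).
Local Notation oW := (aff_origin (weil_model A M)).
Implicit Types (c : chart P M).

Let aP : is_atlas P. Proof. by case: tP. Qed.
Let aW : is_atlas W. Proof. exact: weil_bundle_is_atlas. Qed.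

Lemma weil_chart_admissible c (cP : admissible c) :
  admissible (weil_chart A cP : chart W _).
Proof. exact: (atlas_admissible aW (weil_chart_atlas A cP)). Qed.

Lemma ccoord_alphaT c (cP : admissible c) (u : W) : cdom c (alphaT u) ->
  ccoord c (alphaT u) = aff_coord o (aff_param oW (ccoord (weil_chart A cP) u)).1.
Proof. by move=> cu; rewrite /ccoord aff_coordK weil_chartE. Qed.

Lemma smooth_alphaT : smooth_map (P := W) (Q := P) (fun u => alphaT u).
Proof.
apply: smooth_map_chart => // u; have [c cA cu] := ex_chart aP (alphaT u).
have cP := atlas_admissible aP cA; have cW := weil_chart_admissible cP.
have du : cdom (weil_chart A cP) u by rewrite weil_chart_dom.
exists (weil_chart A cP), c, (fun z => aff_coord o (aff_param oW z).1); split=> //.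
  exact: smooth_at_fst.
apply: filterS (near_cdom aW cW du) => v; rewrite weil_chart_dom// => cv.
by rewrite -ccoord_alphaT.
Qed.

Lemma alphaT_continuous : continuous (fun u : W => alphaT u : P).
Proof. by case: smooth_alphaT. Qed.

Lemma range_alphaT : range (fun u : W => alphaT u : P) = setT.
Proof.
apply/seteqP; split=> // p _; have [c cA cp] := ex_chart aP p.
have cP := atlas_admissible aP cA.
exists (taylor_point tP cP cp (fib_coord_ideal (0 : weil_fibre A V))) => //.
exact: alphaT_taylor_point.
Qed.

(** Points that cannot be separated have the same base point, P being Hausdorff; they then share a
    chart, whose coordinates separate them. *)
Lemma weil_bundle_hausdorff : hausdorff_space W.
Proof.
move=> u v uv.
have sep (T : topologicalType) (f : W -> T) : hausdorff_space T ->
    {for u, continuous f} -> {for v, continuous f} -> f u = f v.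
  move=> hT fu fv; apply: hT => B C nB nC.
  by have [w [Bw Cw]] := uv _ _ (fu _ nB) (fv _ nC); exists (f w).
have [_ hP _] := tP.
have e : alphaT u = alphaT v.
  by apply: (sep P (fun w => alphaT w : P)) => //; exact: alphaT_continuous.
have [c cA cu] := ex_chart aP (alphaT u); have cP := atlas_admissible aP cA.
have cW := weil_chart_admissible cP; have [iW _] := cW.
have du : cdom (weil_chart A cP) u by rewrite weil_chart_dom.
have dv : cdom (weil_chart A cP) v by rewrite weil_chart_dom//= -e.
apply: (ccoord_inj iW du dv); apply: (sep _ (ccoord (weil_chart A cP))).
- exact: norm_hausdorff.
- exact: ccoord_continuous.
- exact: ccoord_continuous.
Qed.

Lemma weil_bundle_paracompact : is_manifold P -> paracompact W.
Proof.
move=> mP; have [c [r [b [s [cr ob cov]]]]] := manifold_pieces mP.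
have cA p : admissible (c p) by case: (cr p).
have r0 p : 0 < r p by case: (cr p).
pose e p : chart W _ := weil_chart A (cA p).
have eW p : admissible (e p) by exact: weil_chart_admissible.
pose g (z : 'rV[R]_(\dim {: (V * weil_fibre A V)%type})) : 'rV[R]_(\dim {:V}) :=
  aff_coord o (aff_param oW z).1.
have cg : continuous g by move=> z; apply: smooth_at_continuous; exact: smooth_at_fst.
pose x p := ccoord (c p) p.
(* Since the basis of the model is not adapted to the product, a ball of the total coordinates cut
   by a condition on the base stands in for a product of balls; the closed version is again
   compact. *)
pose O0 p m := [set z | `|z - 0| < m%:R] `&` [set z | `|g z - x p| < r p].
pose K p m := [set z | `|z - 0| <= m%:R] `&` [set z | `|g z - x p| <= r p].
(* One index encodes both the number of the base ball and the size m; the default pair only repeats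
   an existing set. *)
pose pk n : nat * nat := odflt (0, 0)%N (unpickle n).
pose O i k := [set u : W | cdom (e (s i (pk k).1)) u /\
  O0 (s i (pk k).1) (pk k).2 (ccoord (e (s i (pk k).1)) u)].
pose L i k := [set u : W | cdom (e (s i (pk k).1)) u /\
  K (s i (pk k).1) (pk k).2 (ccoord (e (s i (pk k).1)) u)].
apply: (@paracompact_sigma_compact W P (fun u => b (alphaT u)) O L).
- by move=> i; apply: open_comp (ob i) => u _; exact: alphaT_continuous.
- move=> i k; rewrite /O /L; move: (s i (pk k).1) (pk k).2 => p m.
  have cK : compact (K p m).
    apply: compact_closedI; first exact: compact_closed_ball.
    exact: closed_dist.
  have cL : compact [set u : W | cdom (e p) u /\ K p m (ccoord (e p) u)].
    apply: compact_chart_preimage => // z [_ zK].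
    have [_ _ /(_ (g z))[|q cq qz]] := cr p.
      by apply: le_trans zK _; rewrite ler_peMl ?ler1n//; exact: ltW.
    have : (weil_chart A (cA p) @` [set u | cdom (c p) (alphaT u)]) (aff_param oW z).
      rewrite weil_chart_image//; split=> //; exists q => //.
      by apply: (can_inj (aff_coordK o)).
    move=> [u cu uz]; exists u; first by rewrite /e weil_chart_dom.
    by rewrite /ccoord /e uz aff_paramK.
  split=> //.
  + rewrite (_ : [set _ | _] = cdom (e p) `&` e p @^-1` (aff_coord oW @^-1` O0 p m))//.
    apply: open_chart_preimage; first exact: weil_chart_atlas.
    apply: open_comp => [z _|]; first exact: aff_coord_continuous.
    by apply: openI; apply: open_dist => // z; exact: cvg_id.
  + exact: compact_closed weil_bundle_hausdorff cL.
  + move=> u [eu [Om Or]]; split=> //; split; exact: ltW.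
- move=> u; have [n [cn bn]] := cov (alphaT u).
  pose z := ccoord (e (s (b (alphaT u)) n)) u.
  pose m := (Num.truncn `|z|).+1.
  exists (pickle (n, m)); rewrite /O /pk pickleK [odflt _ _]/= [_.1]/= [_.2]/=; split.
    by rewrite /e weil_chart_dom.
  split; first by rewrite /= subr0; exact: truncnS_gt.
  move: bn; rewrite -ball_normE /= distrC /e ccoord_alphaT//.
Qed.

Lemma weil_bundle_is_manifold : is_manifold P -> is_manifold W.
Proof.
by move=> mP; split; [|exact: weil_bundle_hausdorff|exact: weil_bundle_paracompact].
Qed.

End WeilManifold.

(** * The local trivializations *)

Section MainTheorem.
Variables (R : realType) (A : localAlgebra R) (V : vectType R) (M : affineSpace V).
Variable P : atlasSpace M.
Hypothesis tP : tame P.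
Local Notation F := (affmfd (vectaff (weil_fibre A V))).

Let aP : is_atlas P. Proof. by case: tP. Qed.
Let aW : is_atlas (weil_bundle A P). Proof. exact: weil_bundle_is_atlas. Qed.

Let fc : chart F (vectaff (weil_fibre A V)) := Chart setT id.
Variables (c : chart P M) (cP : admissible c).
Local Notation W := (weil_bundle A P).
Local Notation D := (weil_bundle A (chart_dom c)).
Local Notation pi := (fun u : W => alphaT u : P).
Local Notation WU := (submfd (pi @^-1` cdom c)).
Local Notation sc := (sub_chart (cdom c) c : chart (chart_dom c) M).

Let tD : tame (chart_dom c). Proof. exact: tame_chart_dom. Qed.
Let asc : admissible sc. Proof. exact: sub_chart_dom_admissible. Qed.
Let dc : chart D (weil_model A M) := weil_chart A asc.
Let wc : chart WU (weil_model A M) := sub_chart _ (weil_chart A cP : chart W _).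

Lemma open_over : open (pi @^-1` cdom c).
Proof.
apply: open_comp (open_cdom aP cP) => u _; exact: alphaT_continuous.
Qed.

Lemma over_is_atlas : is_atlas WU.
Proof. exact: submfd_is_atlas aW open_over. Qed.

Lemma dom_chart_admissible : admissible dc.
Proof. exact: weil_chart_admissible. Qed.

Lemma dom_chart_domT : cdom dc = setT.
Proof. by rewrite /dc weil_chart_dom//; apply/seteqP; split=> // u _; exact: sc_dom. Qed.

Lemma over_chart_admissible : admissible wc.
Proof. by apply: sub_chart_admissible => //; [exact: open_over|exact: weil_chart_admissible]. Qed.

Lemma over_chart_domT : cdom wc = setT.
Proof.
apply/seteqP; split=> // -[u cu] _.
by have : cdom (weil_chart A cP) u by rewrite weil_chart_dom.
Qed.

Lemma weil_chart_incl (u : D) : weil_chart A cP (weil_incl u) = dc u.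
Proof.
rewrite weil_chartE ?alphaT_weil_incl//; last exact: svalP.
rewrite /dc weil_chartE//; last exact: sc_dom.
by congr (_, fib_of _); apply/funext => i; exact: wvec_weil_incl.
Qed.

Lemma diffeo_weil_incl :
  exists2 j' : D -> WU, diffeo j' & sval \o j' = @weil_incl R A V M P (cdom c).
Proof.
have jU (u : D) : (pi @^-1` cdom c) (weil_incl u).
  by rewrite /preimage /= alphaT_weil_incl//; exact: svalP.
exists (fun u => exist _ (weil_incl u) (jU u) : WU) => //.
apply: (diffeo_global_charts (c := dc) (d := wc)).
- exact: weil_bundle_is_atlas.
- exact: over_is_atlas.
- exact: dom_chart_admissible.
- exact: over_chart_admissible.
- exact: dom_chart_domT.
- exact: over_chart_domT.
- move=> [v cv]; have : range (@weil_incl R A V M P (cdom c)) v by rewrite range_weil_incl.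
  by move=> [u _ uv]; exists u; rewrite -weil_chart_incl uv.
- exact: weil_chart_incl.
Qed.

Lemma diffeo_chart_map : diffeo (@chart_map R V M P c).
Proof.
apply: (diffeo_global_charts (c := sc) (d := im_chart c)) => //.
- exact: chart_dom_is_atlas.
- exact: chart_im_is_atlas.
- exact: (atlas_admissible (chart_im_is_atlas cP) (im_chart_atlas c)).
- exact: sub_chart_domT.
- by move=> [x [p cp pE]]; exists (exist _ p cp).
Qed.

Lemma diffeo_weil_triv :
  diffeo (weil_triv cP : D -> prodmfd (chart_im c) F).
Proof.
have aF : is_atlas F by exact: affmfd_is_atlas.
have aI := chart_im_is_atlas cP.
have aX : is_atlas (prodmfd (chart_im c) F) by exact: prodmfd_is_atlas.
apply: (diffeo_global_charts (c := dc) (d := prod_chart (im_chart c) fc)) => //.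
- exact: weil_bundle_is_atlas.
- exact: dom_chart_admissible.
- apply: (atlas_admissible aX); exists (im_chart c), fc; split=> //; exact: im_chart_atlas.
- exact: dom_chart_domT.
- by apply/seteqP.
- move=> [[x [p cp pE]] f].
  have : (dc @` [set u : D | setT (alphaT u)]) (x, f).
    rewrite weil_chart_image//; last by move=> q _; exact: sc_dom.
    by split=> //; exists (exist _ p cp).
  by move=> [u _ uE]; exists u.
- move=> u; rewrite weil_trivE// /dc weil_chartE//; exact: sc_dom.
Qed.

(** The definition of [fibre_bundle] wants trivializations that cover the identity of an open set of
    P. This is A xi with the base point left in P instead of being sent to the model by c. *)
Lemma diffeo_over (cA : atlas P c) : exists Phi : WU -> prodmfd (submfd (cdom c)) F,
  diffeo Phi /\ forall v : WU, (Phi v).1 = exist _ (alphaT (sval v)) (svalP v).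
Proof.
exists (fun v : WU => (exist (cdom c) (alphaT (sval v)) (svalP v), fib_of (wvec c (sval v)))).
split=> //.
have aF : is_atlas F by exact: affmfd_is_atlas.
have aD : is_atlas (submfd (cdom c)) by exact: chart_dom_is_atlas.
have aX : is_atlas (prodmfd (submfd (cdom c)) F) by exact: prodmfd_is_atlas.
apply: (diffeo_global_charts (c := wc) (d := prod_chart sc fc)) => //.
- exact: over_is_atlas.
- exact: over_chart_admissible.
- by apply: (atlas_admissible aX); exists sc, fc; split=> //; exists c.
- exact: over_chart_domT.
- by apply/seteqP; split=> // -[[p cp] f] _; split.
- move=> [[p cp] f].
  have : (weil_chart A cP @` [set u : W | cdom c (alphaT u)]) (c p, f).
    by rewrite weil_chart_image//; split=> //; exists p.
  by move=> [u cu uE]; exists (exist _ u cu).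
- by move=> [u cu]; apply: etrans (esym (weil_chartE tP cP cu)) _.
Qed.

End MainTheorem.

Lemma diffeo_id (R : realType) (V : vectType R) (M : affineSpace V)
    (P : atlasSpace M) (c : chart P M) : is_atlas P -> admissible c -> cdom c = setT ->
  diffeo (@id P).
Proof.
move=> aP ac cT; apply: (diffeo_global_charts (c := c) (d := c)) => // p; by exists p.
Qed.

Theorem mainTheorem2 (R : realType) (A : localAlgebra R)
    (V : vectType R) (M : affineSpace V) (P : atlasSpace M)
    (P_manifold : is_manifold P) (P_nonmeasurable : nonmeasurable P) :
  (forall (xi : chart P M) (xiP : admissible xi),
     (forall u : weil_pt A (chart_dom xi),
        alphaT (weil_chart_map xiP u) = chart_map (alphaT u)) /\
     local_trivialization
       (E := weil_bundle A P) (B := P)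
       (F := affmfd (vectaff (weil_fibre A V)))
       (C := chart_im xi) (D := weil_bundle A (chart_dom xi))
       (fun u : weil_pt A P => alphaT u) (cdom xi)
       (fun u : weil_pt A (chart_dom xi) => weil_incl u)
       (fun p : chart_dom xi => chart_map p)
       (fun u : weil_pt A (chart_dom xi) => weil_triv xiP u)) /\
  fibre_bundle (E := weil_bundle A P) (B := P)
    (affmfd (vectaff (weil_fibre A V)))
    (fun u : weil_pt A P => alphaT u).
Proof.
have tP := tame_manifold P_manifold P_nonmeasurable; have [aP _ _] := tP.
split=> [xi xiP|].
  split; first by move=> u; exact: weil_chart_map_alphaT.
  split.
  - exact: open_cdom.
  - exact: diffeo_weil_incl.
  - exact: diffeo_chart_map.
  - exact: diffeo_weil_triv.
  - move=> u Uu; rewrite weil_trivE//; congr chart_map.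
    apply: eq_sig_hprop => [? ? ?|]; first exact: Prop_irrelevance.
    by rewrite [RHS]/= alphaT_weil_incl.
split.
- exact: weil_bundle_is_manifold.
- by [].
- exact: affmfd_is_manifold.
- by split; [exact: smooth_alphaT|exact: range_alphaT].
- move=> p; have [c cA cp] := ex_chart aP p; have cP := atlas_admissible aP cA.
  exists (cdom c); split=> //; have [Phi [dPhi PhiE]] := diffeo_over A tP cP cA.
  exists Phi; split=> //.
  + exact: open_cdom.
  + exists id => //; apply: (diffeo_id _ (over_chart_admissible A tP cP) (over_chart_domT A tP cP)).
    exact: over_is_atlas.
  + apply: (diffeo_id _ (sub_chart_dom_admissible aP cP) (sub_chart_domT c)).
    exact: chart_dom_is_atlas.
  + move=> v Uv; rewrite PhiE; exact: eq_exist.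
Qed.
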